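(* (Inner product relation.) Let $n\equiv 2$ or $3\pmod 4$ and let $\psi\in L^2(\mathbb{R}^n;Cl_n)$ be an admissible Clifford mother wavelet with admissibility constant $C_\psi$. Then for all $f,g\in L^2(\mathbb{R}^n;Cl_n)$, $$(T_\psi f,T_\psi g)_{L^2(\mathcal G;Cl_n)}=(fC_\psi,g)_{L^2(\mathbb{R}^n;Cl_n)} .$$
   Context: $Cl_n=Cl_{n,0}$ is the real Clifford algebra of Euclidean $\mathbb{R}^n$ with orthonormal vectors $e_1,\dots,e_n$ ($e_k^2=1$, $e_je_k=-e_ke_j$ for $j\ne k$) and basis blades $e_A$; $M=\sum_A M_Ae_A$ with $M_A\in\mathbb{R}$. $\langle M\rangle_k$ is the grade-$k$ part, $\langle M\rangle=\langle M\rangle_0$ the scalar part. The reverse is $\widetilde M=\sum_k(-1)^{k(k-1)/2}\langle M\rangle_k$ (also written $\{M\}^\sim$), an anti-automorphism; $|M|^2=\langle M\widetilde M\rangle=\sum_A M_A^2$. $Cl_n^{+}$, $Cl_n^{-}$ are the subspaces of elements with only even, respectively only odd grades. $i_n=e_1e_2\cdots e_n$ satisfies $i_n^2=-1$ for $n\equiv 2,3\pmod 4$. Inner product of $f,g:\mathbb{R}^n\to Cl_n$: $(f,g)=\int_{\mathbb{R}^n}f(x)\widetilde{g(x)}\,d^nx\in Cl_n$; $\|f\|^2=\langle(f,f)\rangle=\int|f|^2$; $L^2(\mathbb{R}^n;Cl_n)=\{f:\|f\|<\infty\}$. Clifford Fourier transform: $\widehat f(\omega)=\int_{\mathbb{R}^n}f(x)e^{-i_n\omega\cdot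 x}d^nx$ (extended to $L^2$ in the usual way). Similitude group: $\mathcal G=\{(a,r_\theta,b): a>0,\ r_\theta\in SO(n),\ b\in\mathbb{R}^n\}$, with left Haar measure $d\lambda=d\mu\,d^nb$, $d\mu=a^{-(n+1)}\,da\,d\theta$, $d\theta$ the normalized Haar measure on $SO(n)$. For $F,G:\mathcal G\to Cl_n$, $(F,G)_{L^2(\mathcal G;Cl_n)}=\int_{\mathcal G}F\,\widetilde{G}\,d\lambda$. Daughter wavelets: $\psi_{a,\theta,b}(x)=a^{-n/2}\psi\bigl(r_\theta^{-1}((x-b)/a)\bigr)$. Admissibility: $\psi\in L^2(\mathbb{R}^n;Cl_n)$ is admissible if $C_\psi=\int_{\mathbb{R}^+}\int_{SO(n)}a^n\{\widehat\psi(a r_\theta^{-1}(\omega))\}^{\sim}\,\widehat\psi(a r_\theta^{-1}(\omega))\,d\mu$ is, for a.e. $\omega\in\mathbb{R}^n$, a finite invertible multivector constant (independent of $\omega$). In addition, if $n\equiv2\pmod 4$ the mother wavelet is required to take values either entirely in $Cl_n^+$ or entirely in $Cl_n^-$; if $n\equiv 3\pmod 4$ there is no grade restriction. Clifford wavelet transform: $T_\psi f(a,\theta,b)=\int_{\mathbb{R}^n}f(x)\widetilde{\psi_{a,\theta,b}(x)}\,d^nx$. *)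

(* Defs.v *)
From HB Require Import structures.
From mathcomp Require Import all_boot all_order all_algebra.
From mathcomp Require Import all_classical all_reals all_analysis.
From mathcomp Require Import measurable_realfun ring.

Set Implicit Arguments.
Unset Strict Implicit.
Unset Printing Implicit Defensive.

Import Order.TTheory GRing.Theory Num.Theory.
Import numFieldNormedType.Exports.

Local Open Scope classical_set_scope.
Local Open Scope ring_scope.

Definition symd (T : finType) (A B : {set T}) : {set T} :=
  (A :\: B) :|: (B :\: A).

Section symd_theory.
Variable T : finType.
Implicit Types A B C : {set T}.

Lemma in_symd A B x : (x \in symd A B) = (x \in A) (+) (x \in B).
Proof. by rewrite !inE; case: (x \in A); case: (x \in B). Qed.

Lemma symdA A B C : symd A (symd B C) = symd (symd A B) C.
Proof. by apply/setP => x; rewrite !in_symd addbA. Qed.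

Lemma symdC A B : symd A B = symd B A.
Proof. by apply/setP => x; rewrite !in_symd addbC. Qed.

Lemma symd0s A : symd finset.set0 A = A.
Proof. by apply/setP => x; rewrite in_symd finset.in_set0. Qed.

Lemma symds0 A : symd A finset.set0 = A.
Proof. by rewrite symdC symd0s. Qed.

Lemma symdd A : symd A A = finset.set0.
Proof. by apply/setP => x; rewrite in_symd addbb finset.in_set0. Qed.

Lemma symdK A B : symd A (symd A B) = B.
Proof. by rewrite symdA symdd symd0s. Qed.

End symd_theory.

Section clifford.
Variables (R : comNzRingType) (n : nat).
Implicit Types (A B C : {set 'I_n}).

(* A multivector is the family of its coefficients M_A on the basis blades
   e_A, where e_A is the product of the e_i, i in A, in increasing order. *)
Definition clifford : Type := {ffun {set 'I_n} -> R}.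

HB.instance Definition _ :=
  GRing.Lmodule.copy clifford {ffun {set 'I_n} -> R^o}.

Implicit Types M N P : clifford.

Definition inversions A B : nat :=
  (\sum_(i in A) \sum_(j in B) (j < i))%N.

(* e_A e_B = (-1)^(inversions A B) e_(symd A B): sort the concatenation of the
   two words, one sign per transposition, then cancel e_k e_k = 1. *)
Definition cl_mul M N : clifford :=
  [ffun C => \sum_A \sum_(B | symd A B == C)
     (-1) ^+ inversions A B * M A * N B].

Definition cl_blade A : clifford := [ffun B => (B == A)%:R].

Let sgn A B : R := (-1) ^+ inversions A B.

Let odd_sum (I : finType) (p : pred I) (F : I -> nat) :
  odd (\sum_(i | p i) F i) = \big[addb/false]_(i | p i) odd (F i).
Proof. exact: (big_morph odd oddD (erefl : odd 0 = false)). Qed.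

Let sgn_symdl A B C : sgn (symd A B) C = sgn A C * sgn B C.
Proof.
rewrite /sgn -exprD -signr_odd -[in RHS]signr_odd; congr (_ ^+ nat_of_bool _).
rewrite oddD /inversions !odd_sum.
rewrite big_mkcond [X in _ = X (+) _]big_mkcond [X in _ = _ (+) X]big_mkcond/=.
rewrite -big_split/=; apply: eq_bigr => i _; rewrite in_symd.
by case: (i \in A); case: (i \in B); rewrite //= ?addbb ?addbF.
Qed.

Let sgn_symdr A B C : sgn A (symd B C) = sgn A B * sgn A C.
Proof.
rewrite /sgn -exprD -signr_odd -[in RHS]signr_odd; congr (_ ^+ nat_of_bool _).
rewrite oddD /inversions !odd_sum -big_split/=; apply: eq_bigr => i _.
rewrite !odd_sum.
rewrite big_mkcond [X in _ = X (+) _]big_mkcond [X in _ = _ (+) X]big_mkcond/=.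
rewrite -big_split/=; apply: eq_bigr => j _; rewrite in_symd.
by case: (j \in B); case: (j \in C); rewrite //= ?addbb ?addbF.
Qed.

Let sgn0s A : sgn finset.set0 A = 1.
Proof. by rewrite /sgn /inversions big_set0 expr0. Qed.

Let sgns0 A : sgn A finset.set0 = 1.
Proof.
by rewrite /sgn /inversions big1 ?expr0// => i _; rewrite big_set0.
Qed.

Let cl_mulE M N C :
  cl_mul M N C = \sum_A sgn A (symd A C) * M A * N (symd A C).
Proof.
rewrite ffunE; apply: eq_bigr => A _; apply: big_pred1 => B /=.
by apply/eqP/eqP => [<-|->]; rewrite symdK.
Qed.

Let cl_mulA : associative cl_mul.
Proof.
move=> M N P; apply/ffunP => D; rewrite !cl_mulE.
under eq_bigr do rewrite cl_mulE mulr_sumr.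
under [RHS]eq_bigr do rewrite cl_mulE mulr_sumr mulr_suml.
rewrite [RHS]exchange_big/=; apply: eq_bigr => A _.
rewrite [RHS](reindex_inj (can_inj (symdK A)))/=; apply: eq_bigr => B _.
rewrite symdK -symdA (_ : symd A (symd B D) = symd B (symd A D)); last first.
  by rewrite symdA [symd A B]symdC -symdA.
set E := symd B (symd A D); have -> : symd A D = symd B E by rewrite /E symdK.
by rewrite sgn_symdl sgn_symdr; ring.
Qed.

Let cl_mul1 : left_id (cl_blade finset.set0) cl_mul.
Proof.
move=> M; apply/ffunP => C; rewrite cl_mulE (bigD1 finset.set0)//= ffunE eqxx.
rewrite symd0s sgn0s !mul1r big1 ?addr0// => A /negPf A0.
by rewrite ffunE A0 mulr0 mul0r.
Qed.

Let cl_mulr1 : right_id (cl_blade finset.set0) cl_mul.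
Proof.
move=> M; apply/ffunP => C; rewrite cl_mulE (bigD1 C)//= ffunE symdd eqxx.
rewrite sgns0 mul1r mulr1 big1 ?addr0// => A AC.
rewrite ffunE (_ : (_ == _) = false) ?mulr0//; apply/negP => /eqP AC0.
by case/eqP: AC; rewrite -[RHS](symdK A) AC0 symds0.
Qed.

Let cl_mulDl : left_distributive cl_mul +%R.
Proof.
move=> M N P; apply/ffunP => C; rewrite [RHS]ffunE !cl_mulE -big_split/=.
by apply: eq_bigr => A _; rewrite ffunE mulrDr mulrDl.
Qed.

Let cl_mulDr : right_distributive cl_mul +%R.
Proof.
move=> M N P; apply/ffunP => C; rewrite [RHS]ffunE !cl_mulE -big_split/=.
by apply: eq_bigr => A _; rewrite ffunE mulrDr.
Qed.

Let cl_1neq0 : cl_blade finset.set0 != 0.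
Proof.
apply/eqP => /ffunP/(_ finset.set0); rewrite !ffunE eqxx.
by apply/eqP; exact: oner_neq0.
Qed.

HB.instance Definition _ := GRing.Zmodule_isNzRing.Build clifford
  cl_mulA cl_mul1 cl_mulr1 cl_mulDl cl_mulDr cl_1neq0.

Let cl_scaleAl (a : R) M N : a *: (M * N) = (a *: M) * N.
Proof.
apply/ffunP => C; rewrite [LHS]ffunE [in LHS]cl_mulE [in RHS]cl_mulE scaler_sumr.
by apply: eq_bigr => A _; rewrite ffunE /= /GRing.scale/=; ring.
Qed.

HB.instance Definition _ :=
  GRing.Lmodule_isLalgebra.Build R clifford cl_scaleAl.

Let cl_scaleAr (a : R) M N : a *: (M * N) = M * (a *: N).
Proof.
apply/ffunP => C; rewrite [LHS]ffunE [in LHS]cl_mulE [in RHS]cl_mulE scaler_sumr.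
by apply: eq_bigr => A _; rewrite ffunE /= /GRing.scale/=; ring.
Qed.

HB.instance Definition _ :=
  GRing.Lalgebra_isAlgebra.Build R clifford cl_scaleAr.

End clifford.

Section clifford_notions.
Variables (R : comNzRingType) (n : nat).
Local Notation Cl := (clifford R n).
Implicit Types (A B : {set 'I_n}) (M : Cl).

Lemma cl_bladeM A B : cl_blade R A * cl_blade R B
  = (-1) ^+ inversions A B *: cl_blade R (symd A B) :> Cl.
Proof.
apply/ffunP => C; rewrite [LHS]ffunE (bigD1 A)//= [X in _ + X]big1 ?addr0;
  last first.
  by move=> i /negPf iA; rewrite big1// => j _; rewrite ffunE iA mulr0 mul0r.
rewrite big_mkcond (bigD1 B)//= [X in _ + X]big1 ?addr0; last first.
  by move=> j /negPf jB; case: ifP => // _; rewrite [cl_blade R B j]ffunE jB mulr0.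
rewrite !ffunE !eqxx !mulr1 eq_sym /GRing.scale/=.
by case: eqP => _; rewrite ?mulr1 ?mulr0.
Qed.

Definition cl_gen (i : 'I_n) : Cl := cl_blade R (finset.set1 i).

Lemma cl_gen_sqr (i : 'I_n) : cl_gen i ^+ 2 = 1.
Proof.
rewrite expr2 cl_bladeM /inversions !big_set1 ltnn scale1r symdd.
by [].
Qed.

Lemma cl_gen_anticomm (i j : 'I_n) :
  i != j -> cl_gen i * cl_gen j = - (cl_gen j * cl_gen i).
Proof.
move=> ij; rewrite !cl_bladeM /inversions !big_set1 symdC -scaleNr.
congr (_ *: _); have : (i != j :> nat) by [].
by case: ltngtP => //= _ _; rewrite ?expr1 ?expr0 ?opprK.
Qed.

Definition cl_pseudoscalar : Cl := \prod_(i < n) cl_gen i.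

Definition cl_grade (k : nat) M : Cl :=
  [ffun A : {set 'I_n} => if #|A| == k then M A else 0].

(* The scalar part, as an element of R: the coefficient of the empty blade. *)
Definition cl_scalar M : R := M finset.set0.

Definition cl_rev M : Cl :=
  \sum_(k < n.+1) (-1) ^+ (k * k.-1)./2 *: cl_grade k M.

Definition cl_sqnorm M : R := cl_scalar (M * cl_rev M).

Definition cl_even M : Prop := forall k, odd k -> cl_grade k M = 0.
Definition cl_odd M : Prop := forall k, ~~ odd k -> cl_grade k M = 0.

Definition cl_invertible M : Prop := exists N, M * N = 1 /\ N * M = 1.

Lemma cl_revE M A : cl_rev M A = (-1) ^+ (#|A| * #|A|.-1)./2 * M A.
Proof.
have cA : (#|A| < n.+1)%N by rewrite ltnS -[leqRHS]card_ord max_card.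
rewrite /cl_rev sum_ffunE (bigD1 (Ordinal cA))//= big1 ?addr0; last first.
  move=> k kA; rewrite !ffunE ifF ?scaler0//.
  by apply: contra_neqF kA => /eqP kE; apply/val_inj.
by rewrite !ffunE eqxx.
Qed.

End clifford_notions.

Arguments cl_gen {R n}.
Arguments cl_pseudoscalar {R n}.

(* Componentwise limit of the exponential series. *)
Definition cl_exp (R : realType) (n : nat) (M : clifford R n) : clifford R n :=
  [ffun A => limn (series (fun k => k`!%:R^-1 * (M ^+ k) A))].

(* The sigma-algebra on matrices generated by the coordinates; on 'M[R]_(m, n)
   it is the Borel sigma-algebra. *)
Section measurable_matrix.
Variables (R : realType) (m n : nat).

Definition mx_cylinders : set (set 'M[R]_(m, n)) :=
  [set A | exists i j (B : set R),
     measurable B /\ A = (fun M : 'M[R]_(m, n) => M i j) @^-1` B].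

HB.instance Definition _ := @isMeasurable.Build (sigma_display mx_cylinders)
  'M[R]_(m, n) <<s mx_cylinders >> (@sigma_algebra0 _ setT mx_cylinders)
  (@sigma_algebraC _ mx_cylinders) (@sigma_algebra_bigcup _ setT mx_cylinders).

Lemma measurable_coord i j :
  measurable_fun [set: 'M[R]_(m, n)] (fun M => M i j).
Proof.
by move=> _ B mB; rewrite setTI; apply: sub_sigma_algebra; exists i, j, B.
Qed.

Lemma measurable_fun_mx d (T : measurableType d) (f : T -> 'M[R]_(m, n)) :
  (forall i j, measurable_fun [set: T] (fun t => f t i j)) ->
  measurable_fun [set: T] f.
Proof.
move=> mf; apply: (measurability mx_cylinders) => //.
by move=> _ [_ [i [j [B [mB ->]]]] <-]; have := mf i j measurableT B mB.
Qed.

End measurable_matrix.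

Lemma sigma_finite_prod d1 d2 (T1 : measurableType d1) (T2 : measurableType d2)
    (R : realType) (m1 : {sigma_finite_measure set T1 -> \bar R})
    (m2 : {sigma_finite_measure set T2 -> \bar R}) :
  sigma_finite setT (m1 \x m2)%E.
Proof.
have /sigma_finiteP[F [TF ndF Foo]] := sigma_finiteT m1.
have /sigma_finiteP[G [TG ndG Goo]] := sigma_finiteT m2.
exists (fun n => F n `*` G n).
  rewrite -setXTT TF TG predeqE => -[x y]; split.
    move=> [/= [n _ Fnx] [k _ Gky]]; exists (maxn n k) => //; split.
    - by move: x Fnx; exact/subsetPset/ndF/leq_maxl.
    - by move: y Gky; exact/subsetPset/ndG/leq_maxr.
  by move=> [n _ []/= ? ?]; split; exists n.
move=> k; have [? ?] := Foo k; have [? ?] := Goo k.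
split; first exact: measurableX.
by rewrite product_measure1E// lte_mul_pinfty// ge0_fin_numE.
Qed.

(* Lebesgue measure on R^n, as the n-fold product of lebesgue_measure. *)
Section lebesgue_cV.
Variable R : realType.

Definition cons_cV n (p : measurableTypeR R * 'cV[R]_n) : 'cV[R]_n.+1 :=
  col_mx (const_mx p.1 : 'cV_1) p.2.

Lemma cons_cVE n p (i : 'I_n.+1) :
  @cons_cV n p i ord0 = if unlift ord0 i is Some j then p.2 j ord0 else p.1.
Proof.
rewrite /cons_cV; case: unliftP => [/= j|] ->.
  have -> : lift ord0 j = @rshift 1 n j by exact/val_inj.
  exact: (@col_mxEd _ 1 n 1 (const_mx p.1) p.2 j ord0).
have -> : ord0 = @lshift 1 n ord0 by exact/val_inj.
by rewrite (@col_mxEu _ 1 n 1) mxE.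
Qed.

Lemma measurable_cons_cV n : measurable_fun setT (@cons_cV n).
Proof.
apply: measurable_fun_mx => i j; rewrite [j]ord1.
under eq_fun do rewrite cons_cVE; case: (unlift ord0 i) => [k|].
  exact: (measurableT_comp (measurable_coord _ _) measurable_snd).
exact: measurable_fst.
Qed.

Definition uncons_cV n (v : 'cV[R]_n.+1) : measurableTypeR R * 'cV[R]_n :=
  (v ord0 ord0, \col_j v (lift ord0 j) ord0).

Lemma cons_cVK n : cancel (@cons_cV n) (@uncons_cV n).
Proof.
move=> [x v]; rewrite /uncons_cV cons_cVE unlift_none; congr pair.
by apply/colP => j; rewrite mxE cons_cVE liftK.
Qed.

Lemma measurable_uncons_cV n : measurable_fun setT (@uncons_cV n).
Proof.
apply: measurable_fun_pair; first exact: measurable_coord.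
apply: measurable_fun_mx => i j; under eq_fun do rewrite mxE.
exact: measurable_coord.
Qed.

Section step.
Variables (n : nat) (mu : {sigma_finite_measure set 'cV[R]_n -> \bar R}).

Definition lebesgue_step : set 'cV[R]_n.+1 -> \bar R :=
  pushforward (lebesgue_measure \x mu)%E (@cons_cV n).

HB.instance Definition _ := Measure.copy lebesgue_step
  (@measure_function_pushforward__canonical__measure_function_Measure _ _ _ _ _
     (lebesgue_measure \x mu)%E _ (@measurable_cons_cV n)).

Let lebesgue_step_sigma_finite : sigma_finite setT lebesgue_step.
Proof.
have [F FT mF] := sigma_finite_prod (@lebesgue_measure R) mu.
exists (fun k => @uncons_cV n @^-1` F k).
  by rewrite -preimage_bigcup -FT preimage_setT.
move=> k; have [mFk Fk] := mF k; split.
  by rewrite -[X in measurable X]setTI; exact: measurable_uncons_cV.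
rewrite /lebesgue_step /pushforward -comp_preimage.
by rewrite (_ : _ \o _ = id) ?preimage_id//; apply/funext => p; exact: cons_cVK.
Qed.

HB.instance Definition _ := Measure_isSigmaFinite.Build _ _ _ lebesgue_step
  lebesgue_step_sigma_finite.

End step.

Fixpoint lebesgue_cV n : {sigma_finite_measure set 'cV[R]_n -> \bar R} :=
  if n is m.+1 then lebesgue_step (lebesgue_cV m) else \d_(0 : 'cV[R]_0).

End lebesgue_cV.

Lemma lebesgue_cV_box (R : realType) n (A : 'I_n -> set R) :
  (forall i, measurable (A i)) ->
  lebesgue_cV R n [set x | forall i, A i (x i ord0)]
  = (\prod_(i < n) lebesgue_measure (A i))%E.
Proof.
elim: n A => [|n IHn] A mA.
  by rewrite big_ord0 /= diracE mem_set// => -[].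
have mbox : measurable [set x : 'cV[R]_n | forall i, A (lift ord0 i) (x i ord0)].
  rewrite (_ : mkset _ = \big[setI/setT]_(i < n)
      ((fun x : 'cV[R]_n => x i ord0) @^-1` A (lift ord0 i))).
    apply: bigsetI_measurable => i _; rewrite -[X in measurable X]setTI.
    exact: measurable_coord.
  rewrite -bigcap_seq; apply/seteqP; split => x xA i; first by move=> _; exact: xA.
  by apply: xA; rewrite /= mem_index_enum.
rewrite big_ord_recl -IHn// -product_measure1E//=; last exact: mA.
rewrite /lebesgue_step /pushforward; congr (product_measure1 _ _ _).
apply/seteqP; split => -[a x] /=.
  move=> axA; split=> [|i]; first by have := axA ord0; rewrite cons_cVE unlift_none.
  by have := axA (lift ord0 i); rewrite cons_cVE liftK.
move=> [aA xA] i; rewrite cons_cVE.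
by case: unliftP => [j|] ->; [exact: xA|exact: aA].
Qed.

(* The measure a^-(n+1) da on ]0, +oo[, as a measure on R. *)
Section scale_measure.
Variables (R : realType) (n : nat).

Definition scale_measure (A : set (measurableTypeR R)) : \bar R :=
  (\int[lebesgue_measure]_(a in A `&` `]0%R, +oo[) (a ^- n.+1)%:E)%E.

Let measurable_density :
  measurable_fun (`]0%R, +oo[%classic : set R) (fun a : R => a ^- n.+1).
Proof.
apply: open_continuous_measurable_fun.
  exact: interval_open.
move=> a; rewrite inE/= in_itv/= andbT => a0.
apply: cvgV; first by rewrite expf_neq0// gt_eqF.
exact: exprn_continuous.
Qed.

Let density_ge0 (a : R) : `]0%R, +oo[%classic a -> (0 <= (a ^- n.+1)%:E)%E.
Proof.
by rewrite /= in_itv/= andbT lee_fin invr_ge0 => /ltW; exact: exprn_ge0.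
Qed.

Let scale_measure0 : scale_measure set0 = 0%E.
Proof. by rewrite /scale_measure set0I integral_set0. Qed.

Let scale_measure_ge0 A : (0 <= scale_measure A)%E.
Proof. by apply: integral_ge0 => a [_ /density_ge0]. Qed.

Let scale_measure_sigma_additive : semi_sigma_additive scale_measure.
Proof.
move=> F mF tF mUF; rewrite /scale_measure; apply: cvg_toP.
  apply: ereal_nondecreasing_is_cvgn => i j ij.
  apply: lee_sum_nneg_natr => // k _ _; exact: scale_measure_ge0.
rewrite setI_bigcupl ge0_integral_bigcup//=.
- by move=> k; exact: measurableI.
- apply/measurable_EFinP; apply: measurable_funS measurable_density => //.
  by move=> a [k _ []].
- by move=> a [k _ [_ /density_ge0]].
- exact: trivIset_setIr.
Qed.

HB.instance Definition _ := isMeasure.Build _ _ _ scale_measure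
  scale_measure0 scale_measure_ge0 scale_measure_sigma_additive.

Let scale_measure_sigma_finite : sigma_finite setT scale_measure.
Proof.
exists (fun k => `]-oo, 0%R] `|` `[k.+1%:R^-1, k.+1%:R]).
  apply/esym; rewrite -subTset => a _; have [a0|a0] := lerP a 0.
    by exists 0 => //; left; rewrite /= in_itv.
  exists (Num.trunc (Num.max a a^-1)) => //; right; rewrite /= in_itv/=.
  have lt_max := @truncnS_gt R (Num.max a a^-1).
  apply/andP; split.
    rewrite invf_ple ?posrE//; apply: ltW; apply: le_lt_trans lt_max.
    by rewrite le_max lexx orbT.
  by apply: ltW; apply: le_lt_trans lt_max; rewrite le_max lexx.
move=> k; split; first exact: measurableU.
rewrite /scale_measure setIUl (_ : _ `&` _ = set0) ?set0U; last first.
  apply/seteqP; split => // a /= []; rewrite !in_itv/= andbT => a0.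
  by rewrite ltNge a0.
set D := _ `&` _.
have mD : measurable D by exact: measurableI.
apply: (@le_lt_trans _ _
  (\int[lebesgue_measure]_(a in D) (k.+1%:R ^+ n.+1)%:E)%E).
  apply: ge0_le_integral => //.
  - by move=> a [_ /density_ge0].
  - apply/measurable_EFinP.
    by apply: measurable_funS measurable_density => // a [].
  - move=> a [/=]; rewrite !in_itv/= andbT => /andP[ka _] a0.
    rewrite lee_fin -exprVn lerXn2r ?nnegrE ?invr_ge0 ?(ltW a0)//.
    by rewrite invf_ple ?posrE.
rewrite integral_cst// lte_mul_pinfty//.
apply: (@le_lt_trans _ _ (lebesgue_measure (`[k.+1%:R^-1, k.+1%:R]%classic : set R))).
  by apply: le_measure; rewrite ?inE//; exact: subIsetl.
by rewrite lebesgue_measure_itv/=; case: ifP => _; rewrite ?ltry// -EFinB ltry.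
Qed.

HB.instance Definition _ := Measure_isSigmaFinite.Build _ _ _ scale_measure
  scale_measure_sigma_finite.

End scale_measure.

Section rotations.
Variables (R : realType) (n : nat).

Record SO : Type := MkSO {
  so_mx :> 'M[R]_n;
  so_mxP : (so_mx *m so_mx^T == 1%:M) && (\det so_mx == 1) }.

HB.instance Definition _ := [isSub for so_mx].
HB.instance Definition _ := [Choice of SO by <:].

Let so1P : (1%:M *m (1%:M : 'M[R]_n)^T == 1%:M) && (\det (1%:M : 'M[R]_n) == 1).
Proof. by rewrite trmx1 mulmx1 det1 !eqxx. Qed.

HB.instance Definition _ := isPointed.Build SO (MkSO so1P).
HB.instance Definition _ :=
  Measurable.copy SO (g_sigma_algebra_preimageType so_mx).

Let so_mulP (r s : SO) :
  ((r *m s) *m (r *m s)^T == 1%:M) && (\det (r *m s) == 1).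
Proof.
case: r s => [r /andP[/eqP rP /eqP dr]] [s /andP[/eqP sP /eqP ds]] /=.
by rewrite trmx_mul mulmxA -(mulmxA r) sP mulmx1 rP det_mulmx dr ds mulr1 !eqxx.
Qed.

Definition so_mul (r s : SO) : SO := MkSO (so_mulP r s).

(* The normalized Haar measure on SO(n) is the only such probability. *)
Definition is_haar (theta : probability SO R) : Prop :=
  forall (r : SO) (A : set SO), measurable A ->
    theta (so_mul r @^-1` A) = theta A.

End rotations.

Section clifford_functions.
Context d (T : measurableType d) (R : realType) (n : nat).
Variable mu : {measure set T -> \bar R}.
Local Notation Cl := (clifford R n).
Implicit Types f g : T -> Cl.

Definition cl_integrable f : Prop :=
  forall A, mu.-integrable setT (fun x => (f x A)%:E).

Definition cl_integral f : Cl := [ffun A => \int[mu]_x f x A].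

(* The squared norm, in [0, +oo]. *)
Definition cl_normL2 f : \bar R := (\int[mu]_x (cl_sqnorm (f x))%:E)%E.

Definition cl_L2 f : Prop :=
  (forall A, measurable_fun setT (fun x => f x A)) /\ (cl_normL2 f < +oo)%E.

Definition cl_inner f g : Cl := cl_integral (fun x => f x * cl_rev (g x)).

End clifford_functions.

Section clifford_fourier.
Variables (R : realType) (n : nat).
Local Notation Cl := (clifford R n).
Local Notation Rn := 'cV[R]_n.
Local Notation leb := (lebesgue_cV R n).
Implicit Types f g : Rn -> Cl.

Definition dot (x y : Rn) : R := \sum_i x i ord0 * y i ord0.

Definition cl_fourier f (w : Rn) : Cl :=
  cl_integral leb (fun x => f x * cl_exp (- dot w x *: cl_pseudoscalar)).

(* fhat is a representative of the Fourier transform of f : L^2, obtained by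
   continuous extension from the dense subspace of integrable functions. *)
Definition is_cl_fourierL2 f fhat : Prop :=
  cl_L2 leb fhat /\
  exists u : nat -> Rn -> Cl,
    [/\ forall k, cl_L2 leb (u k) /\ cl_integrable leb (u k),
        cl_normL2 leb (fun x => u k x - f x) @[k --> \oo] --> 0%E &
        cl_normL2 leb (fun w => cl_fourier (u k) w - fhat w) @[k --> \oo]
          --> 0%E].

End clifford_fourier.

Section similitude.
Variables (R : realType) (n : nat) (theta : probability (SO R n) R).
Local Notation Cl := (clifford R n).
Local Notation Rn := 'cV[R]_n.
Local Notation leb := (lebesgue_cV R n).

(* The similitude group is carried by R * SO(n) * R^n; its Haar measure is
   concentrated on the triples (a, r, b) with a > 0. *)
Definition scale_rotation_measure :
    set (measurableTypeR R * SO R n) -> \bar R :=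
  (@scale_measure R n \x theta)%E.

HB.instance Definition _ := Measure.on scale_rotation_measure.
HB.instance Definition _ := Measure_isSigmaFinite.Build _ _ _
  scale_rotation_measure (sigma_finite_prod (@scale_measure R n) theta).

Definition similitude_measure :
    set (measurableTypeR R * SO R n * Rn) -> \bar R :=
  (scale_rotation_measure \x leb)%E.

HB.instance Definition _ := Measure.on similitude_measure.
HB.instance Definition _ := Measure_isSigmaFinite.Build _ _ _
  similitude_measure (sigma_finite_prod scale_rotation_measure leb).

Definition daughter (psi : Rn -> Cl) (a : R) (r : SO R n) (b x : Rn) : Cl :=
  (a `^ (- (n%:R / 2))) *: psi (invmx r *m (a^-1 *: (x - b))).

Definition wavelet_transform (psi f : Rn -> Cl)
    (s : measurableTypeR R * SO R n * Rn) : Cl :=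
  cl_inner leb f (daughter psi s.1.1 s.1.2 s.2).

Definition admissibility_integrand (psihat : Rn -> Cl) (w : Rn)
    (s : measurableTypeR R * SO R n) : Cl :=
  let p := psihat ((s.1 : R) *: (invmx s.2 *m w)) in
  (s.1 : R) ^+ n *: (cl_rev p * p).

(* psi is admissible, with admissibility constant C. *)
Definition admissible (psi : Rn -> Cl) (C : Cl) : Prop :=
  [/\ cl_L2 leb psi,
      exists2 psihat, is_cl_fourierL2 psi psihat &
        {ae leb, forall w,
          cl_integrable scale_rotation_measure
            (admissibility_integrand psihat w) /\
          cl_integral scale_rotation_measure
            (admissibility_integrand psihat w) = C},
      cl_invertible C &
      (n %% 4 = 2)%N ->
        {ae leb, forall x, cl_even (psi x)} \/
        {ae leb, forall x, cl_odd (psi x)}].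

End similitude.

(* Main.v *)
(* By polarization and left linearity of T_psi it suffices to compute the norm of
   T_psi f, namely ||T_psi f||^2 = int <f C f~>.
   Fix (a, r).  As a function of b, T_psi f is the correlation F of f with a
   dilate h of psi.  The grade condition makes i_n commute with psi up to a sign
   s, so that, for the cosine and sine transforms F_c and F_s of F,
   f^ (h^)~ = F_c - s F_s i_n.  Plancherel for F then gives, c being (2 pi)^n,
   c int_b |T_psi f|^2 = a^n int_w |f^(w) (psi^(a r^-1 w))~|^2,
   and Tonelli over (a, r) yields c ||T_psi f||^2 = int <f^ C (f^)~>.
   C commutes with i_n, so the reflection w -> - w replaces this integral by
   int <f_c C f_c~> + <f_s C f_s~>.  Writing <M C M~> as the integral over (a, r)
   of a^n |M (psi^(a r^-1 w0))~|^2 for one admissible frequency w0, Parseval for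
   the functions f (psi^(a r^-1 w0))~ brings back c int <f C f~>.
   This is for f in L^1 and L^2; truncation, Fatou's lemma and the parallelogram
   law extend it to L^2.
   The scalar Plancherel theorem is obtained by damping with
   prod_j exp (- e |w_j|), whose transform is the Poisson kernel: the upper bound
   is AM-GM, the lower one Fatou's lemma and continuity of translations. *)

Require Import Defs.
From HB Require Import structures.
From mathcomp Require Import all_boot all_order all_algebra.
From mathcomp Require Import all_classical all_reals all_analysis.
From mathcomp Require Import measurable_realfun ring lra zify.

Set Implicit Arguments.
Unset Strict Implicit.
Unset Printing Implicit Defensive.

Import Order.TTheory GRing.Theory Num.Theory.
Import numFieldNormedType.Exports.

Local Open Scope classical_set_scope.
Local Open Scope ring_scope.

(** * Clifford algebra *)

(** The exponential of [- w.x i_n] need not commute with the values of [f] and [g], so the two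
    transforms cannot be expanded and merged under one integral as in the complex case. With squared
    norms every integrand is nonnegative: Tonelli and Fatou apply before any integrability is known,
    and multiplication by [i_n] is an isometry. The cross terms between [f_c] and [f_s] are odd in
    [w], which is why reflection removes them.

    Admissibility serves twice. At almost every frequency it turns the integral over [(a, r)] into
    [C]. At the single frequency [w0] it opens [C] again: this shows [<M C M~>] to be nonnegative
    and makes the weighted form a superposition of unweighted norms, so that no square root of [C]
    is needed. [C] commutes with [i_n] because the sign [s] occurs twice in each product [p~ p].

    As [psi] is only in [L^2], its transform is a limit of transforms of integrable functions. These
    need not satisfy the grade condition and are first projected onto the elements with sign [s]. *)

Section inversions.
Variable n : nat.
Implicit Types A B C : {set 'I_n}.

Lemma odd_sumn (I : finType) (p : pred I) (F : I -> nat) :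
  odd (\sum_(i | p i) F i) = \big[addb/false]_(i | p i) odd (F i).
Proof. exact: (big_morph odd oddD (erefl : odd 0 = false)). Qed.

Lemma odd_inversions_symdl A B C :
  odd (inversions (symd A B) C) = odd (inversions A C) (+) odd (inversions B C).
Proof.
rewrite /inversions !odd_sumn.
rewrite big_mkcond [X in _ = X (+) _]big_mkcond [X in _ = _ (+) X]big_mkcond/=.
rewrite -big_split/=; apply: eq_bigr => i _; rewrite in_symd.
by case: (i \in A); case: (i \in B); rewrite //= ?addbb ?addbF.
Qed.

Lemma odd_inversions_symdr A B C :
  odd (inversions A (symd B C)) = odd (inversions A B) (+) odd (inversions A C).
Proof.
rewrite /inversions !odd_sumn -big_split/=; apply: eq_bigr => i _.
rewrite !odd_sumn.
rewrite big_mkcond [X in _ = X (+) _]big_mkcond [X in _ = _ (+) X]big_mkcond/=.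
rewrite -big_split/=; apply: eq_bigr => j _; rewrite in_symd.
by case: (j \in B); case: (j \in C); rewrite //= ?addbb ?addbF.
Qed.

(** Each pair [(i, j)] of [A] times [B] satisfies exactly one of [j < i], [i < j] and [i = j].
    Modulo 2 this is the sign for exchanging two blades. *)
Lemma inversionsC A B :
  (inversions A B + inversions B A + #|A :&: B| = #|A| * #|B|)%N.
Proof.
rewrite /inversions [X in (_ + X + _)%N]exchange_big/= -big_split/=.
rewrite -[#|A :&: B|]sum1_card.
under [X in (_ + X)%N]eq_bigl do rewrite inE.
rewrite [X in (_ + X)%N]big_mkcondr/= -big_split/= -sum_nat_const.
apply: eq_bigr => i iA; rewrite -big_split/=.
rewrite -sum1_card.
rewrite [X in (_ + X)%N](_ : _ = \sum_(j in B) (j == i))%N; last first.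
  case: ifPn => iB.
    by rewrite (bigD1 i)//= eqxx big1// => j /andP[_ /negPf ->].
  by rewrite big1// => j jB; case: eqP => // ji; rewrite -ji jB in iB.
rewrite -big_split/=; apply: eq_bigr => j _.
by rewrite -val_eqE/=; case: ltngtP.
Qed.

(** Squaring [e_A] and reversing it cost the same number of transpositions; hence the sign in
    [cl_rev] is the diagonal value of the sign of the product. *)
Lemma inversions_diag A : inversions A A = (#|A| * #|A|.-1)./2.
Proof.
have := inversionsC A A; rewrite finset.setIid addnn => h.
have -> : (#|A| * #|A|.-1 = (inversions A A).*2)%N.
  by case: #|A| h => [|k]; [rewrite mul0n addn0|rewrite mulnS addnC => /addnI ->; rewrite mulnC].
by rewrite doubleK.
Qed.

End inversions.

Section clifford_algebra.
Variables (R : comNzRingType) (n : nat).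
Local Notation Cl := (clifford R n).
Implicit Types (A B : {set 'I_n}) (M N : Cl).

Definition cl_sign A B : R := (-1) ^+ inversions A B.

Lemma cl_sign_sqr A B : cl_sign A B * cl_sign A B = 1.
Proof. by rewrite /cl_sign -exprD addnn -muln2 exprM sqrr_sign. Qed.

Lemma cl_sign_symdl A B C : cl_sign (symd A B) C = cl_sign A C * cl_sign B C.
Proof.
rewrite /cl_sign -exprD -signr_odd -[in RHS]signr_odd.
by rewrite oddD odd_inversions_symdl.
Qed.

Lemma cl_sign_symdr A B C : cl_sign A (symd B C) = cl_sign A B * cl_sign A C.
Proof.
rewrite /cl_sign -exprD -signr_odd -[in RHS]signr_odd.
by rewrite oddD odd_inversions_symdr.
Qed.

Lemma cl_addE M N A : (M + N) A = M A + N A. Proof. by rewrite ffunE. Qed.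

Lemma cl_oppE M A : (- M) A = - M A. Proof. by rewrite ffunE. Qed.

Lemma cl_subE M N A : (M - N) A = M A - N A.
Proof. by rewrite cl_addE cl_oppE. Qed.

Lemma cl_scaleE (a : R) M A : (a *: M) A = a * M A.
Proof. by rewrite ffunE. Qed.

Lemma cl_zeroE A : (0 : Cl) A = 0. Proof. by rewrite ffunE. Qed.

(** For given [A] and [C] only [B = symd A C] solves [symd A B = C], so the double sum collapses. *)
Lemma cl_coefM M N C :
  (M * N) C = \sum_A cl_sign A (symd A C) * M A * N (symd A C).
Proof.
rewrite [LHS]ffunE; apply: eq_bigr => A _; apply: big_pred1 => B /=.
by apply/eqP/eqP => [<-|->]; rewrite symdK.
Qed.

Lemma cl_rev_coef M A : cl_rev M A = cl_sign A A * M A.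
Proof. by rewrite cl_revE /cl_sign inversions_diag. Qed.

Lemma cl_revM M N : cl_rev (M * N) = cl_rev N * cl_rev M.
Proof.
apply/ffunP => C; rewrite cl_rev_coef !cl_coefM mulr_sumr.
rewrite [RHS](reindex_inj (can_inj (symdK C)))/=; apply: eq_bigr => A _.
have -> : symd C A = symd A C by rewrite symdC.
have -> : symd (symd A C) C = A by rewrite [symd A C]symdC symdC symdK.
have [B [-> ->]] : exists B, symd A C = B /\ C = symd A B.
  by exists (symd A C); rewrite symdK.
rewrite !cl_rev_coef cl_sign_symdl !cl_sign_symdr.
(* The sign of [symd A B] against itself splits into four factors. One of them, [cl_sign A B], meets
   the sign of the product and cancels. *)
transitivity (cl_sign B A * (cl_sign A A * M A) * (cl_sign B B * N B)
  * (cl_sign A B * cl_sign A B)); first by ring.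
by rewrite cl_sign_sqr; ring.
Qed.

Lemma cl_revK M : cl_rev (cl_rev M) = M.
Proof. by apply/ffunP => A; rewrite !cl_rev_coef mulrA cl_sign_sqr mul1r. Qed.

Lemma cl_revD M N : cl_rev (M + N) = cl_rev M + cl_rev N.
Proof. by apply/ffunP => A; rewrite cl_rev_coef !cl_addE !cl_rev_coef mulrDr. Qed.

Lemma cl_revN M : cl_rev (- M) = - cl_rev M.
Proof. by apply/ffunP => A; rewrite cl_rev_coef !cl_oppE cl_rev_coef mulrN. Qed.

Lemma cl_revB M N : cl_rev (M - N) = cl_rev M - cl_rev N.
Proof. by rewrite cl_revD cl_revN. Qed.

Lemma cl_revZ (a : R) M : cl_rev (a *: M) = a *: cl_rev M.
Proof. by apply/ffunP => A; rewrite cl_rev_coef !cl_scaleE cl_rev_coef mulrCA. Qed.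

Lemma cl_scalarM M N : cl_scalar (M * N) = \sum_A cl_sign A A * M A * N A.
Proof.
by rewrite /cl_scalar cl_coefM; apply: eq_bigr => A _; rewrite symds0.
Qed.

Lemma cl_scalarC M N : cl_scalar (M * N) = cl_scalar (N * M).
Proof. by rewrite !cl_scalarM; apply: eq_bigr => A _; ring. Qed.

Lemma cl_scalar_rev M : cl_scalar (cl_rev M) = cl_scalar M.
Proof.
rewrite /cl_scalar cl_rev_coef /cl_sign inversions_diag cards0 mul0n.
by rewrite expr0 mul1r.
Qed.

Lemma cl_scalarD M N : cl_scalar (M + N) = cl_scalar M + cl_scalar N.
Proof. exact: cl_addE. Qed.

Lemma cl_scalarMrev M N : cl_scalar (M * cl_rev N) = \sum_A M A * N A.
Proof.
rewrite cl_scalarM; apply: eq_bigr => A _; rewrite cl_rev_coef.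
transitivity (cl_sign A A * cl_sign A A * (M A * N A)); first by ring.
by rewrite cl_sign_sqr mul1r.
Qed.

Lemma cl_sqnormE M : cl_sqnorm M = \sum_A M A ^+ 2.
Proof. by rewrite /cl_sqnorm cl_scalarMrev. Qed.

Lemma cl_blade_rev A : cl_blade R A * cl_rev (cl_blade R A) = 1.
Proof.
have -> : cl_rev (cl_blade R A) = cl_sign A A *: cl_blade R A.
  apply/ffunP => B; rewrite cl_rev_coef cl_scaleE.
  by rewrite [cl_blade _ _ _]ffunE; case: eqP => [->|]//; rewrite !mulr0.
by rewrite -scalerAr cl_bladeM symdd scalerA cl_sign_sqr scale1r.
Qed.

(** Left multiplication by a constant turns any coefficient into a scalar part. Thus an identity of
    scalar parts that is compatible with left multiplication yields the Clifford-valued one. *)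
Lemma cl_coef_scalar M A : M A = cl_scalar (cl_rev (cl_blade R A) * M).
Proof.
rewrite cl_scalarC cl_scalarMrev (bigD1 A)//= ffunE eqxx mulr1.
by rewrite big1 ?addr0// => B /negPf BA; rewrite ffunE BA mulr0.
Qed.

(** The sign is left undetermined: it cancels wherever the pseudoscalar is compared with the top
    blade. *)
Lemma cl_prod_gen (s : seq 'I_n) : uniq s -> exists b : bool,
  \prod_(i <- s) cl_gen i = (-1) ^+ b *: cl_blade R (finset (mem s)) :> Cl.
Proof.
elim: s => [_|i s IHs /= /andP[si us]].
  exists false; rewrite big_nil scale1r.
  by congr (cl_blade R _); apply/setP => i; rewrite !inE.
have [b sE] := IHs us; exists (b (+) odd (inversions (finset.set1 i) (finset (mem s)))).
rewrite big_cons sE -scalerAr cl_bladeM scalerA; congr (_ *: cl_blade R _).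
  by rewrite signr_addb signr_odd.
apply/setP => j; rewrite in_symd !inE.
by case: eqP => [->|]//=; rewrite (negPf si).
Qed.

Lemma cl_pseudoscalarE : exists b : bool,
  cl_pseudoscalar = (-1) ^+ b *: cl_blade R finset.setT :> Cl.
Proof.
have [b bE] := cl_prod_gen (index_enum_uniq 'I_n).
exists b; rewrite /cl_pseudoscalar bE; congr (_ *: cl_blade R _).
by apply/setP => j; rewrite !inE mem_index_enum.
Qed.

Lemma cl_rev_pseudoscalar :
  cl_rev cl_pseudoscalar = (-1) ^+ (n * n.-1)./2 *: cl_pseudoscalar :> Cl.
Proof.
have [b ->] := cl_pseudoscalarE; rewrite cl_revZ scalerA mulrC -scalerA; congr (_ *: _).
apply/ffunP => B; rewrite cl_rev_coef cl_scaleE [cl_blade _ _ _]ffunE.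
case: eqP => [->|]; last by rewrite !mulr0.
by rewrite /cl_sign inversions_diag cardsT card_ord.
Qed.

Lemma cl_pseudoscalar_rev :
  cl_pseudoscalar * cl_rev cl_pseudoscalar = 1 :> Cl.
Proof.
have [b ->] := cl_pseudoscalarE.
by rewrite cl_revZ -scalerAl -scalerAr scalerA cl_blade_rev -signr_addb addbb scale1r.
Qed.

(** A generator anticommutes with the [n - 1] other factors of [i_n] and commutes with itself. The
    coefficient at [A] comes from the blade complementary to [A], whence the exponent. *)
Lemma cl_pseudoscalar_comm M A :
  (cl_pseudoscalar * M) A = (-1) ^+ (n.-1 * #|symd finset.setT A|) * (M * cl_pseudoscalar) A.
Proof.
have [b ->] := cl_pseudoscalarE.
rewrite -scalerAl -scalerAr !cl_scaleE mulrCA; congr (_ * _).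
rewrite !cl_coefM (bigD1 finset.setT)//= [X in _ + X]big1 ?addr0; last first.
  by move=> B /negPf BT; rewrite [cl_blade _ _ _]ffunE BT mulr0 mul0r.
rewrite [in RHS](bigD1 (symd finset.setT A))//= [X in _ * (_ + X)]big1 ?addr0; last first.
  move=> B BT; rewrite [cl_blade _ _ _]ffunE; case: eqP => [E|]; last by rewrite mulr0.
  by case/eqP: BT; rewrite -E -symdA symdd symds0.
rewrite -symdA symdd symds0 !ffunE !eqxx !mulr1 mulrA; congr (_ * _).
set B := symd _ A; rewrite /cl_sign -exprD -[LHS]signr_odd -[RHS]signr_odd; congr (_ ^+ nat_of_bool _).
(* Exchanging [B] with the full set costs [n |B| - |B|] signs modulo 2. *)
have := congr1 odd (inversionsC finset.setT B); rewrite finset.setTI cardsT card_ord !oddD !oddM.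
have : (#|B| <= n)%N by rewrite -[leqRHS]card_ord max_card.
(* For [n = 0] the predecessor [n.-1] is 0 and not [n - 1], but then [B] is empty. *)
case: n B => [|k] B /= Bk.
  by move: Bk; rewrite leqn0 => /eqP ->/=; case: odd; case: odd.
by case: (odd k); case: (odd #|_|); case: odd; case: odd.
Qed.

End clifford_algebra.

Section clifford_norm.
Variables (R : realType) (n : nat).
Local Notation Cl := (clifford R n).
Implicit Types M N : Cl.

Lemma cl_sqnorm_ge0 M : 0 <= cl_sqnorm M.
Proof. by rewrite cl_sqnormE sumr_ge0// => A _; exact: sqr_ge0. Qed.

Lemma cl_sqnorm0 : cl_sqnorm (0 : Cl) = 0.
Proof. by rewrite cl_sqnormE big1// => A _; rewrite cl_zeroE expr0n. Qed.

Lemma cl_sqnorm_eq0 M : cl_sqnorm M = 0 -> M = 0.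
Proof.
rewrite cl_sqnormE => /eqP; rewrite psumr_eq0 => [/allP M0|A _]; last exact: sqr_ge0.
apply/ffunP => A; rewrite cl_zeroE; apply/eqP; rewrite -sqrf_eq0.
by apply: M0; rewrite mem_index_enum.
Qed.

Lemma cl_sqnormZ (a : R) M : cl_sqnorm (a *: M) = a ^+ 2 * cl_sqnorm M.
Proof.
rewrite !cl_sqnormE mulr_sumr; apply: eq_bigr => A _.
by rewrite cl_scaleE exprMn.
Qed.

Lemma cl_sqnormN M : cl_sqnorm (- M) = cl_sqnorm M.
Proof. by rewrite -scaleN1r cl_sqnormZ sqrrN expr1n mul1r. Qed.

Lemma cl_sqnorm_rev M : cl_sqnorm (cl_rev M) = cl_sqnorm M.
Proof. by rewrite /cl_sqnorm cl_revK cl_scalarC. Qed.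

Lemma cl_sqnorm_parallelogram M N :
  cl_sqnorm (M + N) + cl_sqnorm (M - N) = 2 * cl_sqnorm M + 2 * cl_sqnorm N.
Proof.
rewrite !cl_sqnormE !mulr_sumr -!big_split/=; apply: eq_bigr => A _.
by rewrite cl_addE cl_subE; ring.
Qed.

Lemma cl_sqnorm_coef M A : M A ^+ 2 <= cl_sqnorm M.
Proof.
by rewrite cl_sqnormE (bigD1 A)//= lerDl sumr_ge0// => B _; exact: sqr_ge0.
Qed.

Lemma cl_sqnormD_le M N (e : R) : 0 < e ->
  cl_sqnorm (M + N) <= (1 + e) * cl_sqnorm M + (1 + e^-1) * cl_sqnorm N.
Proof.
move=> e0; rewrite !cl_sqnormE !mulr_sumr -big_split/=; apply: ler_sum => A _.
rewrite cl_addE; set a := M A; set b := N A.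
(* Completing the square: [2 a b <= e a^2 + e^-1 b^2]. A small [e] keeps the constant in front of
   [M] close to 1. *)
rewrite -subr_ge0 (_ : _ - _ = e^-1 * (e * a - b) ^+ 2).
  by rewrite mulr_ge0 ?sqr_ge0// invr_ge0 ltW.
by field; rewrite gt_eqF.
Qed.

(** Lagrange's identity: the defect in this Cauchy-Schwarz inequality is half the sum of all
    [(a i - a j) ^+ 2]. *)
Lemma sqr_sum_le (I : finType) (a : I -> R) :
  (\sum_i a i) ^+ 2 <= #|I|%:R * \sum_i a i ^+ 2.
Proof.
have h : \sum_i \sum_j (a i - a j) ^+ 2 =
    2 * (#|I|%:R * \sum_i a i ^+ 2 - (\sum_i a i) ^+ 2).
  set S := \sum_i a i; set Q := \sum_i a i ^+ 2.
  transitivity (\sum_i (#|I|%:R * a i ^+ 2 + (- 2 * S) * a i + Q)).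
    apply: eq_bigr => i _.
    rewrite (eq_bigr (fun j => a i ^+ 2 + (- 2 * a i) * a j + a j ^+ 2)); last first.
      by move=> j _; ring.
    by rewrite !big_split/= sumr_const -mulr_natl -mulr_sumr -/S -/Q; ring.
  rewrite !big_split/= sumr_const -[Q *+ _]mulr_natl -!mulr_sumr -/S -/Q.
  by ring.
rewrite -subr_ge0 -(@pmulr_rge0 _ 2)// -h.
by apply: sumr_ge0 => i _; apply: sumr_ge0 => j _; exact: sqr_ge0.
Qed.

(** The blade norm is not submultiplicative: [(1 + e_1)^2 = 2 (1 + e_1)]. The number of blades
    enters through Cauchy-Schwarz in each coefficient of the product. *)
Lemma cl_sqnormM_le M N :
  cl_sqnorm (M * N) <= #|{set 'I_n}|%:R * cl_sqnorm M * cl_sqnorm N.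
Proof.
rewrite cl_sqnormE.
apply: (@le_trans _ _ (\sum_C #|{set 'I_n}|%:R * \sum_A M A ^+ 2 * N (symd A C) ^+ 2)).
  apply: ler_sum => C _; rewrite cl_coefM; apply: le_trans (sqr_sum_le _) _.
  rewrite ler_wpM2l//; apply: ler_sum => A _.
  by rewrite !exprMn expr2 cl_sign_sqr mul1r.
rewrite -mulr_sumr exchange_big/= -mulrA ler_wpM2l// !cl_sqnormE mulr_suml.
apply: ler_sum => A _; rewrite -mulr_sumr ler_wpM2l ?sqr_ge0//.
rewrite [leRHS](reindex_inj (can_inj (symdK A)))/=.
by [].
Qed.

End clifford_norm.

(** * The pseudoscalar as an imaginary unit *)

Section pseudoscalar_complex.
Variables (R : realType) (n : nat).
Hypothesis n_mod4 : (n %% 4 = 2)%N \/ (n %% 4 = 3)%N.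
Local Notation Cl := (clifford R n).
Local Notation i_n := (cl_pseudoscalar : Cl).
Implicit Types M N : Cl.

Lemma odd_half_mod4 : odd (n * n.-1)./2.
Proof.
rewrite (divn_eq n 4); case: n_mod4 => ->.
  have -> : ((n %/ 4 * 4 + 2) * (n %/ 4 * 4 + 2).-1 =
      ((n %/ 4 * 2 + 1) * (n %/ 4 * 4 + 1)).*2)%N by rewrite addn2/=; lia.
  by rewrite doubleK oddM !oddD !oddM/= !andbF.
have -> : ((n %/ 4 * 4 + 3) * (n %/ 4 * 4 + 3).-1 =
    ((n %/ 4 * 2 + 1) * (n %/ 4 * 4 + 3)).*2)%N by rewrite addn3/=; lia.
by rewrite doubleK oddM !oddD !oddM/= !andbF.
Qed.

(** For [n] congruent to 2 or 3 modulo 4, [n (n - 1) / 2] is odd, so on the span of 1 and [i_n] the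
    reverse acts as complex conjugation. *)
Lemma cl_rev_i : cl_rev i_n = - i_n.
Proof. by rewrite cl_rev_pseudoscalar -signr_odd odd_half_mod4 expr1 scaleN1r. Qed.

Lemma cl_i_sqr : i_n * i_n = - 1.
Proof. by have := cl_pseudoscalar_rev R n; rewrite cl_rev_i mulrN => <-; rewrite opprK. Qed.

Lemma cl_sqnorm_mul_i M : cl_sqnorm (M * i_n) = cl_sqnorm M.
Proof. by rewrite /cl_sqnorm cl_revM mulrA -(mulrA M) cl_pseudoscalar_rev mulr1. Qed.

(** The parity indicators are those in the coefficients of the cosine and sine series, so that the
    exponential series splits term by term in [cl_exp_i]. *)
Lemma cl_scale_iX (t : R) k : (t *: i_n) ^+ k =
  (t ^+ k * (~~ odd k)%:R * (-1) ^+ k./2) *: 1 + (t ^+ k * (odd k)%:R * (-1) ^+ k./2) *: i_n.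
Proof.
elim: k => [|k IHk]; first by rewrite /= !expr0 !mulr1 mulr0 scale1r scale0r addr0.
have mulZ (a b : R) M N : (a *: M) * (b *: N) = (a * b) *: (M * N).
  by rewrite -scalerAl -scalerAr scalerA.
rewrite exprS IHk mulrDr !mulZ mulr1 cl_i_sqr /= uphalf_half.
case: (odd k) => /=; rewrite !(mulr1, mulr0, mul0r) !scale0r ?add0r ?addr0.
  by rewrite scalerN -scaleNr add1n exprS; congr (_ *: _); rewrite exprS; ring.
by rewrite add0n exprS; congr (_ *: _); ring.
Qed.

Lemma cl_exp_i (t : R) : cl_exp (t *: i_n) = cos t *: 1 + sin t *: i_n.
Proof.
apply/ffunP => A; rewrite ffunE cl_addE !cl_scaleE.
apply/cvg_lim => //.
rewrite (_ : series _ = (fun m => series (cos_coeff t) m * (1 : Cl) A + series (sin_coeff t) m * i_n A)).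
  by apply: cvgD; apply: cvgMl; rewrite unlock; [exact: is_cvg_series_cos_coeff|exact: is_cvg_series_sin_coeff].
apply/funext => m; rewrite /series/= !mulr_suml -big_split/=; apply: eq_bigr => k _.
rewrite cl_scale_iX cl_addE !cl_scaleE /cos_coeff /sin_coeff.
rewrite /= -exprnP.
case: k => [|k]; rewrite /= ?uphalf_half; last first.
 case: (odd k); rewrite /= ?mulr1 ?mul1r ?mulr0 ?mul0r ?addr0 ?add0r ?add1n ?add0n.
 all: try ring.
Qed.

End pseudoscalar_complex.

(** * Lebesgue measure on R^n *)

Section measurable_mx_ops.
Context d (T : measurableType d) (R : realType).

Lemma measurable_fun_coord m n (f : T -> 'M[R]_(m, n)) i j :
  measurable_fun setT f -> measurable_fun setT (fun t => f t i j).
Proof. by move=> mf; exact: (measurableT_comp (measurable_coord i j) mf). Qed.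

Lemma measurable_addmx m n (f g : T -> 'M[R]_(m, n)) :
  measurable_fun setT f -> measurable_fun setT g ->
  measurable_fun setT (fun t => f t + g t).
Proof.
move=> mf mg; apply: measurable_fun_mx => i j.
under eq_fun do rewrite mxE.
by apply: measurable_funD; exact: measurable_fun_coord.
Qed.

Lemma measurable_oppmx m n (f : T -> 'M[R]_(m, n)) :
  measurable_fun setT f -> measurable_fun setT (fun t => - f t).
Proof.
move=> mf; apply: measurable_fun_mx => i j.
under eq_fun do rewrite mxE.
by apply: measurableT_comp => //; exact: measurable_fun_coord.
Qed.

Lemma measurable_submx m n (f g : T -> 'M[R]_(m, n)) :
  measurable_fun setT f -> measurable_fun setT g ->
  measurable_fun setT (fun t => f t - g t).
Proof. by move=> mf mg; apply: measurable_addmx => //; exact: measurable_oppmx. Qed.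

Lemma measurable_scalemx m n (a : T -> R) (f : T -> 'M[R]_(m, n)) :
  measurable_fun setT a -> measurable_fun setT f ->
  measurable_fun setT (fun t => a t *: f t).
Proof.
move=> ma mf; apply: measurable_fun_mx => i j.
under eq_fun do rewrite mxE.
by apply: measurable_funM => //; exact: measurable_fun_coord.
Qed.

Lemma measurable_mulmx m n p (f : T -> 'M[R]_(m, n)) (g : T -> 'M[R]_(n, p)) :
  measurable_fun setT f -> measurable_fun setT g ->
  measurable_fun setT (fun t => f t *m g t).
Proof.
move=> mf mg; apply: measurable_fun_mx => i j.
under eq_fun do rewrite mxE.
by apply: measurable_sum => k; apply: measurable_funM; exact: measurable_fun_coord.
Qed.

Lemma measurable_trmx m n (f : T -> 'M[R]_(m, n)) :
  measurable_fun setT f -> measurable_fun setT (fun t => (f t)^T).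
Proof.
move=> mf; apply: measurable_fun_mx => i j.
under eq_fun do rewrite mxE.
exact: measurable_fun_coord.
Qed.

Lemma measurable_dot n (f g : T -> 'cV[R]_n) :
  measurable_fun setT f -> measurable_fun setT g ->
  measurable_fun setT (fun t => dot (f t) (g t)).
Proof.
move=> mf mg; apply: measurable_sum => k.
by apply: measurable_funM; exact: measurable_fun_coord.
Qed.

End measurable_mx_ops.

(** * Translation invariance of Lebesgue measure *)

Section lebesgue_translation.
Variable R : realType.
Local Open Scope ereal_scope.

Lemma integral_lebesgue_shift (t : R) (F : measurableTypeR R -> \bar R) :
  measurable_fun setT F -> (forall x, 0 <= F x) ->
  \int[lebesgue_measure]_x F (x + t)%R = \int[lebesgue_measure]_x F x.
Proof.
move=> mF F0.
pose phi (x : measurableTypeR R) : measurableTypeR R := (x + t)%R.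
have mphi : measurable_fun setT phi by exact: measurable_funD.
rewrite -[LHS](@ge0_integral_pushforward _ _ _ _ _ phi mphi
  lebesgue_measure setT F)//.
apply: eq_measure_integral => A mA _; apply/esym/lebesgue_measure_unique => //.
move=> _ [[a b] _ <-] /=; rewrite /pushforward.
have -> : phi @^-1` `]a, b]%classic = `](a - t)%R, (b - t)%R]%classic.
  by apply/seteqP; split => x /=; rewrite !in_itv/= ltrBlDr lerBrDr.
rewrite !lebesgue_measure_itv/= !lte_fin ltrD2r.
by case: ifP => // _; rewrite -!EFinB; congr EFin; lra.
Qed.

(** The recursion behind [lebesgue_cV], read off by Tonelli; inductions on the dimension of
    nonnegative integrals rest on it. *)
Lemma integral_lebesgue_cVS n (F : 'cV[R]_n.+1 -> \bar R) :
  measurable_fun setT F -> (forall x, 0 <= F x) ->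
  \int[lebesgue_cV R n.+1]_x F x =
  \int[lebesgue_measure]_x \int[lebesgue_cV R n]_v F (cons_cV (x, v)).
Proof.
move=> mF F0.
rewrite -(fubini_tonelli1 (m1 := lebesgue_measure) (m2 := lebesgue_cV R n)
  (F \o @cons_cV R n))//=; last first.
  exact: (measurableT_comp mF (@measurable_cons_cV R n)).
exact: (@ge0_integral_pushforward _ _ _ _ _ (@cons_cV R n)
  (@measurable_cons_cV R n) _ setT F).
Qed.

Lemma integral_cV_shift n (t : 'cV[R]_n) (F : 'cV[R]_n -> \bar R) :
  measurable_fun setT F -> (forall x, 0 <= F x) ->
  \int[lebesgue_cV R n]_x F (x + t)%R = \int[lebesgue_cV R n]_x F x.
Proof.
elim: n t F => [|n IHn] t F mF F0.
  by apply: eq_integral => x _; congr F; apply/colP => -[].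
have mFt : measurable_fun setT (fun x : 'cV[R]_n.+1 => F (x + t)%R).
  by apply: (measurableT_comp mF); apply: measurable_addmx.
rewrite (integral_lebesgue_cVS mFt (fun x => F0 _)) (integral_lebesgue_cVS mF F0).
pose t0 := t ord0 ord0; pose t' := (uncons_cV t).2.
have consD x v : (cons_cV (x, v) + t = cons_cV ((x + t0)%R, (v + t')%R))%R.
  apply/colP => i; rewrite mxE !cons_cVE; case: unliftP => [j|] -> //=.
  by rewrite !mxE.
under eq_integral do under eq_integral do rewrite consD.
have mF2 : measurable_fun setT (F \o @cons_cV R n).
  exact: (measurableT_comp mF (@measurable_cons_cV R n)).
pose G (x : measurableTypeR R) := \int[lebesgue_cV R n]_v F (cons_cV (x, v)).
rewrite -[RHS](@integral_lebesgue_shift t0 G).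
- apply: eq_integral => x _.
  rewrite (IHn t' (fun v => F (cons_cV ((x + t0)%R, v))))//.
  exact: (measurableT_comp mF2 (measurable_pair1 _)).
- by apply: (measurable_fun_fubini_tonelli_F (m2 := lebesgue_cV R n) (F \o @cons_cV R n)) => //= x.
- by move=> x; exact: integral_ge0.
Qed.

End lebesgue_translation.

(** * Changes of variables by dilations and rotations *)

Section substitution.
Variable R : realType.
Local Open Scope ereal_scope.

Lemma indic_iff (T U : Type) (A : set T) (B : set U) x y :
  (A x <-> B y) -> \1_A x = \1_B y :> R.
Proof.
move=> AB; rewrite !indicE; congr ((nat_of_bool _)%:R).
by apply/idP/idP => /set_mem xy; apply/mem_set/AB.
Qed.

Section additive.
Variables (n : nat) (leb : {sigma_finite_measure set 'cV[R]_n -> \bar R}).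
Hypothesis leb_shift : forall (t : 'cV[R]_n) (F : 'cV[R]_n -> \bar R),
  measurable_fun setT F -> (forall x, 0 <= F x) ->
  \int[leb]_x F (x + t)%R = \int[leb]_x F x.

(** The argument for uniqueness of Haar measure: the double integral of [\1_B y * \1_E (phi x + y)]
    is evaluated in both orders. The pushforward by an additive bijection is therefore a multiple of
    the measure, and the factor can be found from one test set [B], with no determinant. *)
Lemma pushforward_additive (phi psi : 'cV[R]_n -> 'cV[R]_n)
    (mphi : measurable_fun setT phi)
    (phiD : {morph phi : x y / (x + y)%R}) (phiK : cancel psi phi)
    (E B : set 'cV[R]_n) : measurable E -> measurable B ->
  leb (phi @^-1` E) * leb B =
  leb E * leb [set x | B (- phi x)%R].
Proof.
move=> mE mB. 
have iE (A : set 'cV[R]_n) : measurable A -> leb A = \int[leb]_x (\1_A x)%:E.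
  by move=> mA; rewrite integral_indic// setIT.
have m1 (A : set 'cV[R]_n) d (T : measurableType d) (h : T -> 'cV[R]_n) :
    measurable A -> measurable_fun setT h ->
    measurable_fun setT (fun t => (\1_A (h t))%:E : \bar R).
  move=> mA mh; apply/measurable_EFinP; exact: (measurableT_comp (measurable_indic mA)).
have ge1 (A : set 'cV[R]_n) (x : 'cV[R]_n) : 0 <= (\1_A x : R)%:E by rewrite lee_fin.
have mpE : measurable (phi @^-1` E) by rewrite -[X in measurable X]setTI; exact: mphi.
have mNB : measurable [set x | B (- phi x)%R].
  rewrite -[X in measurable X]setTI; apply: (_ : measurable_fun setT (fun x => - phi x)%R) => //.
  exact: measurable_oppmx.
have mfst := @measurable_fst _ _ 'cV[R]_n 'cV[R]_n.
have msnd := @measurable_snd _ _ 'cV[R]_n 'cV[R]_n.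
transitivity (\int[leb]_y ((\1_B y)%:E * \int[leb]_x (\1_E (phi x + y)%R)%:E)).
  rewrite (iE _ mpE).
  rewrite muleC.
  rewrite (iE _ mB).
  rewrite -(@ge0_integralZr _ _ _ leb setT measurableT (fun y => (\1_B y)%:E)).
  - apply: eq_integral => y _; congr (_ * _).
    (* As [y = phi (psi y)], the argument is [phi (x + psi y)], and translation of [x] removes
       [y]. *)
    rewrite -(@leb_shift (psi y) (fun x => (\1_(phi @^-1` E) x)%:E))//.
      by apply: eq_integral => x _; congr EFin; apply: indic_iff; rewrite /= phiD phiK.
    exact: m1.
  - exact: m1.
  - by [].
  - by apply: integral_ge0 => x _; exact: ge1.
transitivity (\int[leb]_y (\int[leb]_x ((\1_B y)%:E * (\1_E (phi x + y)%R)%:E))).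
  apply: eq_integral => y _; rewrite ge0_integralZl//=.
  apply: m1 => //; apply: measurable_addmx => //.
rewrite -(fubini_tonelli (m1 := leb) (m2 := leb)
  (fun p : 'cV[R]_n * 'cV[R]_n => (\1_B p.2)%:E * (\1_E (phi p.1 + p.2)%R)%:E)); last 2 first.
- apply: emeasurable_funM; first exact: m1.
  apply: m1 => //; apply: measurable_addmx => //.
  exact: (measurableT_comp mphi).
- by move=> x; exact: mule_ge0.
transitivity (\int[leb]_x \int[leb]_y ((\1_B (y - phi x)%R)%:E * (\1_E y)%:E)).
  apply: eq_integral => x _ /=.
  rewrite -(@leb_shift (phi x) (fun y => ((\1_B (y - phi x)%R)%:E * (\1_E y)%:E)))//.
  - by apply: eq_integral => y _; rewrite addrK addrC.
  - apply: emeasurable_funM; apply: m1 => //.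
    by apply: measurable_submx.
rewrite (fubini_tonelli (m1 := leb) (m2 := leb)
  (fun p : 'cV[R]_n * 'cV[R]_n => ((\1_B (p.2 - phi p.1)%R)%:E * (\1_E p.2)%:E))); last 2 first.
- apply: emeasurable_funM; apply: m1 => //.
  by apply: measurable_submx => //; exact: (measurableT_comp mphi).
- by move=> x; exact: mule_ge0.
rewrite (iE _ mE) (iE _ mNB).
rewrite -(@ge0_integralZr _ _ _ leb setT measurableT (fun y => (\1_E y)%:E)); last 3 first.
- exact: m1.
- by [].
- by apply: integral_ge0 => x _; exact: ge1.
apply: eq_integral => y _ /=.
rewrite ge0_integralZr//=; last first.
  by apply: m1 => //; apply: measurable_submx.
rewrite muleC; congr (_ * _).
(* Translating [x] by [psi y] turns [y - phi x] into [- phi x], independent of [y]. *)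
rewrite -(@leb_shift (psi y) (fun x => (\1_B (y - phi x)%R)%:E))//; last first.
  by apply: m1 => //; apply: measurable_submx.
apply: eq_integral => x _; congr EFin; apply: indic_iff.
by rewrite /= phiD phiK opprD addrCA subrr addr0.
Qed.

End additive.

Lemma lebesgue_cV_cube n (s : R) : (0 <= s)%R ->
  lebesgue_cV R n [set x | forall i, `[(- s)%R, s]%classic (x i ord0)]
  = (((2 * s) ^+ n)%R)%:E.
Proof.
move=> s0; rewrite (@lebesgue_cV_box R n (fun=> `[(- s)%R, s]%classic))//.
under eq_bigr do rewrite lebesgue_measure_itv/= lte_fin.
have [s_gt0|] := ltP (- s)%R s.
  by rewrite -EFinB prodEFin big_const_ord iter_mulr_1; congr EFin; congr (_ ^+ _)%R; ring.
(* The cube is a point. Its measure is 0 except in dimension 0, where it is 1; this agrees with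
   [0 ^+ n]. *)
move=> ss; have -> : s = 0%R by lra.
rewrite mulr0 big_const_ord; elim: n => [|n IHn]; first by rewrite expr0.
by rewrite iterS mul0e expr0n.
Qed.

Lemma measurable_box n (A : 'I_n -> set R) : (forall i, measurable (A i)) ->
  measurable [set x : 'cV[R]_n | forall i, A i (x i ord0)].
Proof.
move=> mA; rewrite (_ : mkset _ = \big[setI/setT]_(i < n)
    ((fun x : 'cV[R]_n => x i ord0) @^-1` A i)).
  apply: bigsetI_measurable => i _; rewrite -[X in measurable X]setTI.
  exact: measurable_coord.
rewrite -bigcap_seq; apply/seteqP; split => x xA i; first by move=> _; exact: xA.
by apply: xA; rewrite /= mem_index_enum.
Qed.

Lemma lebesgue_cV_scale n (a : R) (E : set 'cV[R]_n) : a != 0%R -> measurable E ->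
  lebesgue_cV R n ((fun x => a *: x)%R @^-1` E) = ((`|a| ^- n)%R)%:E * lebesgue_cV R n E.
Proof.
move=> a0 mE; have aa : (0 < `|a|)%R by rewrite normr_gt0.
(* A cube as test set: its preimage under the dilation is again a cube, and both measures are
   known. *)
pose B := [set x : 'cV[R]_n | forall i, `[(- 1)%R, 1%R]%classic (x i ord0)].
have mB : measurable B by exact: (measurable_box (A := fun=> `[(- 1)%R, 1%R]%classic)).
have mphi : measurable_fun setT (fun x : 'cV[R]_n => a *: x)%R.
  by apply: measurable_scalemx.
have := @pushforward_additive n (lebesgue_cV R n) (@integral_cV_shift R n)
  (fun x => a *: x)%R (fun x => a^-1 *: x)%R mphi (fun x y => scalerDr a x y)
  (fun x => scalerKV a0 x) E B mE mB.
have -> : [set x | B (- (a *: x))%R] =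
    [set x : 'cV[R]_n | forall i, `[(- `|a|^-1)%R, `|a|^-1%R]%classic (x i ord0)].
  apply/seteqP; split => x /= Bx i; have := Bx i; rewrite !mxE/= !in_itv/=.
    rewrite -!ler_norml normrN normrM => h.
    by rewrite -[leRHS]mul1r ler_pdivlMr// mulrC.
  rewrite -!ler_norml normrN normrM => h.
  by move: h; rewrite -[leRHS]mul1r ler_pdivlMr// mulrC.
rewrite !lebesgue_cV_cube ?invr_ge0// => eq1.
have two0 : ((2 * 1 : R) ^+ n != 0)%R by rewrite expf_neq0// mulr1.
rewrite -[LHS]mule1 -[1](_ : (((2 * 1) ^+ n)%R * ((2 * 1) ^- n)%R)%:E = 1); last first.
  by congr EFin; rewrite divff.
rewrite EFinM muleA [X in X * _]eq1 -muleA -EFinM muleC; congr (_%:E * _).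
by move: two0; rewrite mulr1 => two0; rewrite exprMn mulrAC divff// mul1r exprVn.
Qed.

Lemma so_trmx n (r : SO R n) : (so_mx r)^T *m r = 1%:M.
Proof. by case: r => r /= /andP[/eqP/mulmx1C]. Qed.

Lemma so_mx_tr n (r : SO R n) : r *m (so_mx r)^T = 1%:M.
Proof. by case: r => r /= /andP[/eqP]. Qed.

Lemma so_invmx n (r : SO R n) : invmx r = (so_mx r)^T.
Proof.
have ru : so_mx r \in unitmx.
  by rewrite unitmxE; case: r => r /= /andP[_ /eqP ->]; rewrite unitr1.
by rewrite -[LHS]mulmx1 -(so_mx_tr r) mulmxA mulVmx// mul1mx.
Qed.

Lemma dotE n (x y : 'cV[R]_n) : dot x y = (x^T *m y) ord0 ord0.
Proof. by rewrite mxE; apply: eq_bigr => i _; rewrite mxE. Qed.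

Lemma lebesgue_cV_rotation n (r : 'M[R]_n) (E : set 'cV[R]_n) :
  r *m r^T = 1%:M -> measurable E ->
  lebesgue_cV R n ((fun x => r *m x) @^-1` E) = lebesgue_cV R n E.
Proof.
move=> rr mE; have rr' := mulmx1C rr.
pose B := [set x : 'cV[R]_n | (dot x x <= 1)%R].
have mB : measurable B.
  rewrite -[X in measurable X]setTI.
  rewrite (_ : B = (fun x => dot x x) @^-1` `]-oo, 1%R]%classic); last first.
    by apply/seteqP; split => x; rewrite /B/= in_itv.
  exact: measurable_dot.
have mphi : measurable_fun setT (fun x : 'cV[R]_n => r *m x).
  by apply: measurable_mulmx.
have rK : cancel (fun x : 'cV[R]_n => r^T *m x) (fun x => r *m x).
  by move=> x; rewrite mulmxA rr mul1mx.
have := @pushforward_additive n (lebesgue_cV R n) (@integral_cV_shift R n)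
  (fun x => r *m x) (fun x => r^T *m x) mphi (mulmxDr r) rK E B mE mB.
have -> : [set x | B (- (r *m x))%R] = B.
  suff dE x : dot (- (r *m x))%R (- (r *m x))%R = dot x x.
    by apply/seteqP; split => x; rewrite /B/= dE.
  have dN (y : 'cV[R]_n) : dot (- y)%R (- y)%R = dot y y.
    by apply: eq_bigr => i _; rewrite !mxE mulrNN.
  by rewrite dN !dotE trmx_mul mulmxA -(mulmxA x^T) rr' mulmx1.
have Bfin : lebesgue_cV R n B < +oo.
  apply: (@le_lt_trans _ _ (lebesgue_cV R n
      [set x | forall i, `[(- 1)%R, 1%R]%classic (x i ord0)])).
    apply: le_measure; rewrite ?inE//.
      exact: (measurable_box (A := fun=> `[(- 1)%R, 1%R]%classic)).
    move=> x; rewrite /B/= => x1 i; rewrite in_itv/= -ler_norml.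
    rewrite -(@ler_pXn2r _ 2%N) ?nnegrE// expr1n real_normK ?num_real//.
    apply: le_trans x1; rewrite /dot (bigD1 i)//= -expr2 lerDl.
    by apply: sumr_ge0 => j _; rewrite -expr2 sqr_ge0.
  by rewrite lebesgue_cV_cube// ltry.
(* The cube of half-side [1 / (n + 1)] lies in the ball: each squared coordinate is at most
   [1 / (n + 1)] and there are [n] of them. *)
have Bpos : 0 < lebesgue_cV R n B.
  apply: (@lt_le_trans _ _ (lebesgue_cV R n
      [set x | forall i, `[(- n.+1%:R^-1)%R, n.+1%:R^-1%R]%classic (x i ord0)])).
    by rewrite lebesgue_cV_cube ?invr_ge0// lte_fin exprn_gt0// mulr_gt0// invr_gt0.
  apply: le_measure; rewrite ?inE//.
    exact: (measurable_box (A := fun=> `[(- n.+1%:R^-1)%R, n.+1%:R^-1%R]%classic)).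
  move=> x /= xn; rewrite /B /dot/=.
  apply: (@le_trans _ _ (\sum_(i < n) n.+1%:R^-1)%R).
    apply: ler_sum => i _; have := xn i; rewrite in_itv/= -ler_norml => xi.
    rewrite -expr2 -real_normK ?num_real// expr2.
    apply: (@le_trans _ _ (`|x i ord0| * 1)%R); last by rewrite mulr1.
    apply: ler_wpM2l => //; apply: (le_trans xi).
    by rewrite invf_le1// ler1n.
  by rewrite sumr_const card_ord -[leLHS]mulr_natl ler_pdivrMr// mul1r ler_nat.
have Bfn : lebesgue_cV R n B \is a fin_num by rewrite ge0_fin_numE.
rewrite -(fineK Bfn) => eq1.
have b0 : (fine (lebesgue_cV R n B) != 0)%R.
  by rewrite gt_eqF// fine_gt0// Bpos.
set b := fine _ in eq1 b0.
have bb : b%:E * (b^-1)%:E = 1 :> \bar R by rewrite -EFinM divff.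
by rewrite -[LHS]mule1 -[RHS]mule1 -bb !muleA eq1.
Qed.

(** Here [k] is the inverse of the absolute value of the Jacobian determinant of [phi]. *)
Definition scales_lebesgue n (phi : 'cV[R]_n -> 'cV[R]_n) (k : R) : Prop :=
  [/\ measurable_fun setT phi, (0 <= k)%R &
  forall E, measurable E ->
    lebesgue_cV R n (phi @^-1` E) = k%:E * lebesgue_cV R n E].

Lemma ge0_integral_scales n phi k (F : 'cV[R]_n -> \bar R) :
  scales_lebesgue phi k -> measurable_fun setT F -> (forall x, 0 <= F x) ->
  \int[lebesgue_cV R n]_x F (phi x) = k%:E * \int[lebesgue_cV R n]_x F x.
Proof.
move=> [mphi k0 phiE] mF F0.
rewrite -[LHS](@ge0_integral_pushforward _ _ _ _ _ phi mphi
  (lebesgue_cV R n) setT F); [|by []..].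
rewrite -[k%:E]/((NngNum k0)%:num%:E) -ge0_integral_mscale; [|by []..].
by apply: eq_measure_integral => A mA _; exact: phiE.
Qed.

Lemma integral_scales n phi k (F : 'cV[R]_n -> \bar R) :
  scales_lebesgue phi k -> (lebesgue_cV R n).-integrable setT F ->
  \int[lebesgue_cV R n]_x F (phi x) = k%:E * \int[lebesgue_cV R n]_x F x.
Proof.
move=> phik iF; have mF := measurable_int _ iF.
have finp : \int[lebesgue_cV R n]_x F^\+ x \is a fin_num.
  by apply: integrable_pos_fin_num.
have finn : \int[lebesgue_cV R n]_x F^\- x \is a fin_num.
  by apply: integrable_neg_fin_num.
rewrite integralE [in RHS]integralE muleBr; [|by []|exact: fin_num_adde_defr].
  congr (_ - _).
    rewrite -(ge0_integral_scales (F := F^\+) phik).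
    - by apply: eq_integral => x _; rewrite !funeposE.
    - exact: measurable_funepos.
    - by [].
  rewrite -(ge0_integral_scales (F := F^\-) phik).
  - by apply: eq_integral => x _; rewrite !funenegE.
  - exact: measurable_funeneg.
  - by [].
Qed.

Lemma integrable_scales n phi k (F : 'cV[R]_n -> \bar R) :
  scales_lebesgue phi k -> (lebesgue_cV R n).-integrable setT F ->
  (lebesgue_cV R n).-integrable setT (F \o phi).
Proof.
move=> phik /integrableP[mF iF]; have [mphi k0 _] := phik.
apply/integrableP; split; first exact: (measurableT_comp mF mphi).
rewrite (ge0_integral_scales (F := fun x => `|F x|) phik).
- by rewrite lte_mul_pinfty.
- exact: measurableT_comp.
- by move=> x.
Qed.

Lemma scales_lebesgue_comp n (phi psi : 'cV[R]_n -> 'cV[R]_n) k l :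
  scales_lebesgue phi k -> scales_lebesgue psi l ->
  scales_lebesgue (phi \o psi) (k * l)%R.
Proof.
move=> [mphi k0 phiE] [mpsi l0 psiE]; split.
- exact: measurableT_comp.
- exact: mulr_ge0.
move=> E mE; rewrite comp_preimage psiE.
  by rewrite phiE// muleA -EFinM mulrC.
by rewrite -[X in measurable X]setTI; exact: mphi.
Qed.

Lemma scales_shift n (t : 'cV[R]_n) : scales_lebesgue (fun x => x + t)%R 1.
Proof.
have mphi : measurable_fun setT (fun x : 'cV[R]_n => x + t)%R.
  by apply: measurable_addmx.
split => // E mE; rewrite mul1e.
have := @integral_cV_shift R n t (fun x => (\1_E x)%:E).
rewrite -[X in _ -> _ -> _ = X]/(\int[lebesgue_cV R n]_x (\1_E x)%:E).
rewrite (_ : (\int[lebesgue_cV R n]_x (\1_E x)%:E) = lebesgue_cV R n E); last first.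
  by rewrite integral_indic// setIT.
rewrite (_ : (\int[lebesgue_cV R n]_x (\1_E (x + t)%R)%:E) =
   \int[lebesgue_cV R n]_x (\1_((fun x => x + t)%R @^-1` E) x)%:E); last first.
  by apply: eq_integral => x _; congr EFin; apply: indic_iff.
rewrite integral_indic// ?setIT; last first.
  by rewrite -[X in measurable X]setTI; exact: mphi.
apply => //; apply/measurable_EFinP; exact: measurable_indic.
Qed.

Lemma scales_scale n (a : R) : a != 0%R ->
  scales_lebesgue (fun x : 'cV[R]_n => a *: x)%R (`|a| ^- n)%R.
Proof.
move=> a0; split; first by apply: measurable_scalemx.
  by rewrite invr_ge0 exprn_ge0.
by move=> E mE; exact: lebesgue_cV_scale.
Qed.

Lemma scales_opp n : scales_lebesgue (fun x : 'cV[R]_n => - x)%R 1.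
Proof.
have := @scales_scale n (- 1)%R; rewrite oppr_eq0 oner_eq0 normrN1 expr1n invr1.
by move=> /(_ isT); under eq_fun do rewrite scaleN1r.
Qed.

Lemma scales_rotation n (r : 'M[R]_n) : r *m r^T = 1%:M ->
  scales_lebesgue (fun x : 'cV[R]_n => r *m x)%R 1.
Proof.
move=> rr; split => //; first by apply: measurable_mulmx.
by move=> E mE; rewrite mul1e; exact: lebesgue_cV_rotation.
Qed.

End substitution.

(** * The scalar Plancherel theorem *)

Section poisson_kernel_line.
Variable R : realType.
Local Notation mu := (@lebesgue_measure R).

Lemma measurable_cos : measurable_fun setT (@cos R).
Proof. by apply: continuous_measurable_fun; exact: continuous_cos. Qed.

Lemma measurable_sin : measurable_fun setT (@sin R).
Proof. by apply: continuous_measurable_fun; exact: continuous_sin. Qed.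

Lemma is_derive_affine (k m x : R) : is_derive x 1 (fun t : R => k * t + m) k.
Proof.
have h : is_derive x 1 (k *: id + cst m : R -> R) (k *: 1 + 0) by typeclasses eauto.
by move: h; rewrite addr0 /GRing.scale/= mulr1.
Qed.

Lemma continuous_affine (k m : R) : continuous (fun t : R => k * t + m).
Proof.
by move=> x; apply: cvgD; [apply: cvgMr; exact: cvg_id|exact: cvg_cst].
Qed.

Lemma expR_decay (e : R) : 0 < e -> expR (- e * x + 0) @[x --> +oo] --> (0 : R).
Proof.
move=> e0.
rewrite (_ : (fun x => _) = (fun x => expR (- x)) \o (fun x => e * x)); last first.
  by apply/funext => x /=; rewrite addr0 mulNr.
apply: cvg_comp; last exact: cvgr_expR.
exact: gt0_cvgMry.
Qed.

(* Adding 1 to the cosine keeps the integrand nonnegative. *)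
Definition half_primitive (e z b x : R) : R :=
  expR (- e * x + 0) * ((z * sin (z * x + b) - e * cos (z * x + b)) / (e ^+ 2 + z ^+ 2) - e^-1).

Lemma is_derive_half_primitive (e z b x : R) : 0 < e ->
  is_derive x 1 (half_primitive e z b) (expR (- e * x + 0) * (1 + cos (z * x + b))).
Proof.
move=> e0.
have D : e ^+ 2 + z ^+ 2 != 0 by rewrite gt_eqF// ltr_wpDr ?sqr_ge0// exprn_gt0.
have dE : is_derive x 1 (expR \o (fun t : R => - e * t + 0)) (expR (- e * x + 0) * - e).
  by apply: is_derive1_comp; exact: is_derive_affine.
have dS : is_derive x 1 (sin \o (fun t : R => z * t + b)) (cos (z * x + b) * z).
  by apply: is_derive1_comp; exact: is_derive_affine.
have dC : is_derive x 1 (cos \o (fun t : R => z * t + b)) (- sin (z * x + b) * z).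
  by apply: is_derive1_comp; exact: is_derive_affine.
pose k := (e ^+ 2 + z ^+ 2)^-1.
have h1 : is_derive x 1 (k *: (z *: (sin \o (fun t : R => z * t + b)) -
     e *: (cos \o (fun t : R => z * t + b))) - cst e^-1 : R -> R)
     (k *: (z *: (cos (z * x + b) * z) - e *: (- sin (z * x + b) * z)) - 0).
  by typeclasses eauto.
have h := @is_deriveM _ _ _ _ x 1 _ _ dE h1.
rewrite (_ : half_primitive e z b = ((expR \o (fun t : R => - e * t + 0)) * (k *: (z *: (sin \o (fun t : R => z * t + b)) -
     e *: (cos \o (fun t : R => z * t + b))) - cst e^-1) : R -> R)); last first.
  apply/funext => t; rewrite /half_primitive [in LHS]mulrC; rewrite -[RHS]/(_ * (_ * (_ * _ - _ * _) - _)) /=.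
  by rewrite /k [in RHS]mulrC; congr ((_ - _) * _); rewrite mulrC.
apply: (is_derive_eq h); rewrite /GRing.scale/=; set G := (X in _ + X * _ = _).
have -> : G = k * (z * sin (z * x + b) - e * cos (z * x + b)) - e^-1 by [].
rewrite /k; field.
by rewrite D gt_eqF.
Qed.

Lemma half_line_integral (e z b : R) : 0 < e ->
  (\int[mu]_(x in `[0%R, +oo[) (expR (- e * x + 0) * (1 + cos (z * x + b)))%:E =
  (e^-1 + (e * cos b - z * sin b) / (e ^+ 2 + z ^+ 2))%:E)%E.
Proof.
move=> e0.
have cf : continuous (fun x : R => expR (- e * x + 0) * (1 + cos (z * x + b))).
  move=> x; apply: cvgM.
    apply: (@continuous_comp _ _ _ (fun t : R => - e * t + 0) expR); first exact: continuous_affine.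
    exact: continuous_expR.
  apply: cvgD; first exact: cvg_cst.
  apply: (@continuous_comp _ _ _ (fun t : R => z * t + b) cos); first exact: continuous_affine.
  exact: continuous_cos.
rewrite (@ge0_continuous_FTC2y _ _ (half_primitive e z b) 0 0).
- rewrite -EFinB /half_primitive !mulr0 !add0r expR0 mul1r; congr EFin.
  by rewrite opprB -mulNr opprB.
- by move=> x _; rewrite mulr_ge0 ?expR_ge0.
- exact: continuous_subspaceT.
(* A bound, uniform in [x], for the trigonometric factor of the primitive; the exponential factor
   then forces the limit 0. *)
- pose M := (`|z| + `|e|) / (e ^+ 2 + z ^+ 2) + e^-1.
  have D : 0 < e ^+ 2 + z ^+ 2 by rewrite ltr_wpDr ?sqr_ge0// exprn_gt0.
  apply/norm_cvg0P.
  apply: (@squeeze_cvgr _ _ _ _ (cst 0) (fun x => expR (- e * x + 0) * M)).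
  + apply: nearW => x; rewrite normr_ge0/= normrM ger0_norm ?expR_ge0//.
    rewrite ler_wpM2l ?expR_ge0//; apply: (le_trans (ler_normB _ _)).
    rewrite [`|e^-1|]ger0_norm ?invr_ge0 ?(ltW e0)// lerD2r normrM.
    rewrite [X in _ * X]ger0_norm ?invr_ge0 ?(ltW D)// ler_wpM2r ?invr_ge0 ?(ltW D)//.
    apply: (le_trans (ler_normB _ _)); rewrite !normrM; apply: lerD.
      by rewrite ler_piMr// ler_norml sin_geN1 sin_le1.
    by rewrite ler_piMr// ler_norml cos_geN1 cos_le1.
  + exact: cvg_cst.
  + rewrite [X in _ --> X](_ : 0 = 0 * M); last by rewrite mul0r.
    by apply: cvgMl; exact: expR_decay.
- by move=> x _; have /@ex_derive := is_derive_half_primitive z b x e0.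
- apply: cvg_at_right_filter; apply: differentiable_continuous.
  by apply/derivable1_diffP; have /@ex_derive := is_derive_half_primitive z b 0 e0.
- by move=> x _; rewrite derive1E; have /@derive_val := is_derive_half_primitive z b x e0.
Qed.

Lemma line_integral1 (e z b : R) : 0 < e ->
  (\int[mu]_x (expR (- (e * `|x|)) * (1 + cos (x * z + b)))%:E =
  (2 / e + 2 * e / (e ^+ 2 + z ^+ 2) * cos b)%:E)%E.
Proof.
move=> e0.
pose f (x : R) := expR (- (e * `|x|)) * (1 + cos (x * z + b)).
have mf : measurable_fun setT (fun x : measurableTypeR R => (f x)%:E).
  apply/measurable_EFinP; apply: measurable_funM.
    apply: measurableT_comp => //; apply: measurableT_comp => //.
    by apply: measurable_funM => //; exact: measurableT_comp.
  apply: measurable_funD => //.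
  apply: (measurableT_comp measurable_cos).
  by apply: measurable_funD => //; apply: measurable_funM.
have f0 x : (0 <= (f x)%:E)%E.
  by rewrite lee_fin mulr_ge0 ?expR_ge0.
have -> : [set: measurableTypeR R] = `]-oo, 0%R[ `|` `[0%R, +oo[.
  apply/seteqP; split => x //= _; rewrite !in_itv/= andbT.
  by case: ltP => _; [left|right].
rewrite ge0_integral_setU//=; first last.
- apply/disj_set2P; apply/seteqP; split => // x [] /=; rewrite !in_itv/= andbT => x0.
  by rewrite leNgt x0.
- exact: measurable_funTS.
rewrite (@integral_itv_bndo_bndc _ _ 0%R); last exact: measurable_funTS.
have := @ge0_integration_by_substitution0 _ (fun x => (f (- x)%R)%:E).
under [in X in _ -> _ -> _ = X]eq_integral do rewrite opprK.
move=> <-; last 2 first.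
- by apply: (measurableT_comp mf).
- by move=> x.
(* The negative half-line is folded onto the positive one with [- z] for [z]; the two sine terms
   will cancel. *)
have -> : (\int[mu]_(x in `[0%R, +oo[) (f (- x)%R)%:E =
    \int[mu]_(x in `[0%R, +oo[) (expR (- e * x + 0) * (1 + cos ((- z) * x + b)))%:E)%E.
  apply: eq_integral => x; rewrite inE/= in_itv/= andbT => x0.
  by rewrite /f normrN ger0_norm// addr0 !mulNr (mulrC x).
have -> : (\int[mu]_(x in `[0%R, +oo[) (expR (- (e * `|x|)) * (1 + cos (x * z + b)))%:E =
    \int[mu]_(x in `[0%R, +oo[) (expR (- e * x + 0) * (1 + cos (z * x + b)))%:E)%E.
  apply: eq_integral => x; rewrite inE/= in_itv/= andbT => x0.
  by rewrite ger0_norm// addr0 !mulNr (mulrC x).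
rewrite !half_line_integral// -EFinD; congr EFin.
rewrite sqrrN; field.
by rewrite !gt_eqF// ltr_wpDr ?sqr_ge0// exprn_gt0.
Qed.

Lemma line_integral_expR (e : R) : 0 < e ->
  (\int[mu]_x (expR (- (e * `|x|)))%:E = (2 / e)%:E)%E.
Proof.
(* At [z = b = 0] the factor [1 + cos] is 2, so twice the integral is known. *)
move=> e0; have := line_integral1 0 0 e0.
under eq_integral do rewrite mulr0 addr0 cos0 (_ : 1 + 1 = 2)// mulrC EFinM.
rewrite ge0_integralZl; [|exact: measurableT| | |]; last 3 first.
- apply/measurable_EFinP; apply: measurableT_comp => //; apply: measurableT_comp => //.
  by apply: measurable_funM => //; exact: measurableT_comp.
- by move=> x _; rewrite lee_fin expR_ge0.
- by rewrite lee_fin.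
rewrite expr0n/= addr0 cos0 mulr1 => h.
have h2 : (2%:E * \int[mu]_x (expR (- (e * `|x|)))%:E = 2%:E * (2 / e)%:E)%E.
  by rewrite h -EFinM; congr EFin; field; rewrite gt_eqF.
have k2 : ((2^-1)%:E * 2%:E = 1 :> \bar R)%E by rewrite -EFinM mulVf.
by rewrite -[LHS]mul1e -k2 -muleA h2 muleA k2 mul1e.
Qed.

Lemma integrable_line_expR (e : R) : 0 < e ->
  mu.-integrable setT (fun x => (expR (- (e * `|x|)))%:E).
Proof.
move=> e0; apply/integrableP; split.
  apply/measurable_EFinP; apply: measurableT_comp => //; apply: measurableT_comp => //.
  by apply: measurable_funM => //; exact: measurableT_comp.
under eq_integral do rewrite gee0_abs ?lee_fin ?expR_ge0//.
by rewrite line_integral_expR// ltry.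
Qed.

Lemma line_integral_cos (e z b : R) : 0 < e ->
  (\int[mu]_x (expR (- (e * `|x|)) * cos (x * z + b))%:E =
  (2 * e / (e ^+ 2 + z ^+ 2) * cos b)%:E)%E.
Proof.
move=> e0; have iE := integrable_line_expR e0.
have i1 : mu.-integrable setT (fun x => (expR (- (e * `|x|)) * (1 + cos (x * z + b)))%:E).
  apply/integrableP; split.
    apply/measurable_EFinP; apply: measurable_funM.
      apply: measurableT_comp => //; apply: measurableT_comp => //.
      by apply: measurable_funM => //; exact: measurableT_comp.
    apply: measurable_funD => //; apply: (measurableT_comp measurable_cos).
    by apply: measurable_funD => //; apply: measurable_funM.
  under eq_integral => x _.
    rewrite gee0_abs; last by rewrite lee_fin mulr_ge0 ?expR_ge0.
    over.
  by rewrite line_integral1// ltry.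
transitivity (\int[mu]_x ((expR (- (e * `|x|)) * (1 + cos (x * z + b)))%:E
   - (expR (- (e * `|x|)))%:E))%E.
  by apply: eq_integral => x _; rewrite -EFinB; congr EFin; ring.
rewrite integralB_EFin// line_integral1// line_integral_expR// -EFinB.
by congr EFin; ring.
Qed.

End poisson_kernel_line.

(** * Fubini's theorem for real integrals *)

Section fubini_real.
Context d1 d2 (T1 : measurableType d1) (T2 : measurableType d2) (R : realType).
Variables (m1 : {sigma_finite_measure set T1 -> \bar R})
          (m2 : {sigma_finite_measure set T2 -> \bar R}).
Implicit Types (h : T1 * T2 -> R).

(** Inner integrals in Fubini's theorem are finite only almost everywhere; taking [fine] alters them
    on a null set. *)
Lemma integrable_fine d (T : measurableType d) (m : {measure set T -> \bar R})
    (f : T -> \bar R) : m.-integrable setT f ->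
  m.-integrable setT (fun x => (fine (f x))%:E) /\
  (\int[m]_x (fine (f x))%:E = \int[m]_x f x)%E.
Proof.
move=> intf; have mf := measurable_int _ intf.
have mff : measurable_fun setT (fun x => (fine (f x))%:E).
  by apply/measurable_EFinP; exact: measurableT_comp.
have aef : ae_eq m setT f (fun x => (fine (f x))%:E).
  have := integrable_ae measurableT intf; apply: filterS => x /(_ I) fx _.
  by rewrite fineK.
split; last by apply/esym; exact: ae_eq_integral.
apply/integrableP; split => //; have /integrableP[_] := intf.
apply: le_lt_trans; apply: ge0_le_integral => //.
- exact: measurableT_comp.
- exact: measurableT_comp.
by move=> x _; case: (f x) => //=; rewrite normr0 leey.
Qed.

Lemma Rfubini h : (m1 \x m2)%E.-integrable setT (EFin \o h) ->
  [/\ m1.-integrable setT (fun x => (\int[m2]_y h (x, y))%:E),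
      m2.-integrable setT (fun y => (\int[m1]_x h (x, y))%:E) &
      \int[m1]_x \int[m2]_y h (x, y) = \int[m2]_y \int[m1]_x h (x, y)].
Proof.
move=> ih.
have [iF eF] := integrable_fine (integrable_fubini_F ih).
have ih' : (m1 \x m2)%E.-integrable setT (EFin \o h) by [].
have iG0 : m2.-integrable setT (fun y => \int[m1]_x (h (x, y))%:E)%E.
  apply/integrableP; split; first exact: (measurable_fubini_G ih).
  have mh := measurable_int _ ih.
  have /(integrable21ltyP _ _ mh) := ih.
  apply: le_lt_trans; apply: ge0_le_integral => //.
  - by apply: measurableT_comp => //; exact: (measurable_fubini_G ih).
  - apply: (measurable_fun_fubini_tonelli_G (m1 := m1) (abse \o (EFin \o h))).
      exact: measurableT_comp.
    by move=> z /=; rewrite lee_fin.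
  by move=> y _; apply: le_abse_integral => //; exact: (measurableT_comp mh (measurable_pair2 _)).
have [iG eG] := integrable_fine iG0.
split => //.
by rewrite /Rintegral; congr fine; rewrite eF eG; exact: (Fubini ih).
Qed.

Lemma integrable_tensor (f : T1 -> R) (g : T2 -> R) :
  m1.-integrable setT (EFin \o f) -> m2.-integrable setT (EFin \o g) ->
  (m1 \x m2)%E.-integrable setT (fun p => (f p.1 * g p.2)%:E).
Proof.
move=> iF iG.
have /measurable_EFinP mf := measurable_int _ iF.
have /measurable_EFinP mg := measurable_int _ iG.
have mfg : measurable_fun setT (fun p : T1 * T2 => (f p.1 * g p.2)%:E).
  apply/measurable_EFinP; apply: measurable_funM.
    exact: (measurableT_comp mf).
  exact: (measurableT_comp mg).
apply/(integrable12ltyP _ _ mfg) => /=.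
have /integrableP[_ fF] := iF; have /integrableP[_ gF] := iG.
under eq_integral => x _.
  under eq_integral do rewrite normrM EFinM.
  rewrite ge0_integralZl//; last first.
    by apply/measurable_EFinP; exact: measurableT_comp.
  over.
rewrite /= ge0_integralZr//.
- rewrite lte_mul_pinfty//.
  + by apply: integral_ge0 => x _; rewrite lee_fin.
  + by rewrite ge0_fin_numE//; apply: integral_ge0 => x _; rewrite lee_fin.
- by apply/measurable_EFinP; exact: measurableT_comp.
- by apply: integral_ge0 => x _; rewrite lee_fin.
Qed.

Lemma integrable_tensor_le h (f : T1 -> R) (g : T2 -> R) :
  measurable_fun setT h -> (forall x y, `|h (x, y)| <= f x * g y) ->
  m1.-integrable setT (EFin \o f) -> m2.-integrable setT (EFin \o g) ->
  (m1 \x m2)%E.-integrable setT (EFin \o h).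
Proof.
move=> mh hfg iF iG; apply: le_integrable (integrable_tensor iF iG) => //.
  exact/measurable_EFinP.
by move=> [x y] _; rewrite lee_fin/= (le_trans (hfg x y))// ler_norm.
Qed.

End fubini_real.

(** * Product damping and its transform on R^n *)

Section poisson_kernel.
Variables (R : realType).
Local Notation leb n := (lebesgue_cV R n).

(** The l^1 norm of [w] in the exponent makes the transform a product of integrals over the line. *)
Definition damp n (e : R) (w : 'cV[R]_n) : R := \prod_i expR (- (e * `|w i ord0|)).

Definition poisson n (e : R) (z : 'cV[R]_n) : R :=
  \prod_i (2 * e / (e ^+ 2 + z i ord0 ^+ 2)).

Lemma damp_ge0 n e (w : 'cV[R]_n) : 0 <= damp e w.
Proof. by apply: prodr_ge0 => i _; exact: expR_ge0. Qed.

Lemma poisson_ge0 n e (z : 'cV[R]_n) : 0 <= e -> 0 <= poisson e z.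
Proof.
move=> e0; apply: prodr_ge0 => i _; apply: mulr_ge0; first exact: mulr_ge0.
by rewrite invr_ge0 addr_ge0 ?sqr_ge0.
Qed.

Lemma poisson_le n e (z : 'cV[R]_n) : 0 < e -> poisson e z <= (2 / e) ^+ n.
Proof.
move=> e0; rewrite -[n in _ ^+ n]card_ord -prodr_const; apply: ler_prod => i _.
apply/andP; split.
  apply: mulr_ge0; first by rewrite mulr_ge0// ltW.
  by rewrite invr_ge0 addr_ge0 ?sqr_ge0.
rewrite ler_pdivrMr ?ltr_wpDr ?sqr_ge0 ?exprn_gt0//.
rewrite -subr_ge0 (_ : _ - _ = 2 / e * z i ord0 ^+ 2).
  by rewrite mulr_ge0 ?sqr_ge0// divr_ge0// ltW.
by field; rewrite gt_eqF.
Qed.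

Lemma measurable_prod_coord d (T : measurableType d) n (g : R -> R) (f : T -> 'cV[R]_n) :
  measurable_fun setT g -> measurable_fun setT f ->
  measurable_fun setT (fun x => \prod_i g (f x i ord0)).
Proof.
move=> mg mf; apply: measurable_prod => i _.
apply: (measurableT_comp mg); exact: measurable_fun_coord.
Qed.

Lemma measurable_damp1 (e : R) : measurable_fun setT (fun x : R => expR (- (e * `|x|))).
Proof.
apply: measurableT_comp => //; apply: measurableT_comp => //.
by apply: measurable_funM => //; exact: measurableT_comp.
Qed.

Lemma measurable_poisson1 (e : R) : 0 < e ->
  measurable_fun setT (fun x : R => 2 * e / (e ^+ 2 + x ^+ 2)).
Proof.
move=> e0; apply: continuous_measurable_fun => x.
apply: cvgM; first exact: cvg_cst.
apply: cvgV; first by rewrite gt_eqF// ltr_wpDr ?sqr_ge0// exprn_gt0.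
apply: cvgD; [exact: cvg_cst|exact: exprn_continuous].
Qed.

Lemma measurable_damp d (T : measurableType d) n (e : R) (f : T -> 'cV[R]_n) :
  measurable_fun setT f -> measurable_fun setT (fun x => damp e (f x)).
Proof. by apply: (measurable_prod_coord (measurable_damp1 e)). Qed.

Lemma measurable_poisson d (T : measurableType d) n (e : R) (f : T -> 'cV[R]_n) :
  0 < e ->
  measurable_fun setT f -> measurable_fun setT (fun x => poisson e (f x)).
Proof. by move=> e0; apply: (measurable_prod_coord (measurable_poisson1 e0)). Qed.

Lemma prod_cons_cV n (g : R -> R) x (v : 'cV[R]_n) :
  \prod_i g (cons_cV (x, v) i ord0) = g x * \prod_i g (v i ord0).
Proof.
rewrite big_ord_recl cons_cVE unlift_none/=; congr (_ * _).
by apply: eq_bigr => i _; rewrite cons_cVE liftK.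
Qed.

Lemma dot_cons_cV n x (v : 'cV[R]_n) (z : 'cV[R]_n.+1) :
  dot (cons_cV (x, v)) z = x * z ord0 ord0 + dot v (uncons_cV z).2.
Proof.
rewrite /dot big_ord_recl cons_cVE unlift_none/=; congr (_ + _).
by apply: eq_bigr => i _; rewrite cons_cVE liftK mxE.
Qed.

Lemma integral_prod_cV n (g : R -> R) (c : R) :
  measurable_fun setT g -> (forall x, 0 <= g x) ->
  (\int[@lebesgue_measure R]_x (g x)%:E = c%:E)%E ->
  (\int[leb n]_x (\prod_i g (x i ord0))%:E = (c ^+ n)%:E)%E.
Proof.
move=> mg g0 gc; elim: n => [|n IHn].
  under eq_integral do rewrite big_ord0.
  by rewrite integral_cst// mul1e expr0/= diracE mem_set.
rewrite integral_lebesgue_cVS; last 2 first.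
- by apply/measurable_EFinP; apply: measurable_prod_coord.
- by move=> x; rewrite lee_fin prodr_ge0.
under eq_integral => x _.
  under eq_integral do rewrite prod_cons_cV EFinM.
  rewrite ge0_integralZl; last 4 first.
  - exact: measurableT.
  - by apply/measurable_EFinP; apply: measurable_prod_coord.
  - by move=> v _; rewrite lee_fin prodr_ge0.
  - by rewrite lee_fin.
  rewrite IHn; over.
rewrite ge0_integralZr; last 4 first.
- exact: measurableT.
- exact/measurable_EFinP.
- by move=> v _; rewrite lee_fin.
- rewrite lee_fin exprn_ge0// -lee_fin -gc; apply: integral_ge0 => x _.
  by rewrite lee_fin.
by rewrite gc -EFinM exprS.
Qed.

Lemma integral_damp n (e : R) : 0 < e ->
  (\int[leb n]_w (damp e w)%:E = ((2 / e) ^+ n)%:E)%E.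
Proof.
move=> e0; apply: (@integral_prod_cV n (fun x => expR (- (e * `|x|)))).
- exact: measurable_damp1.
- by move=> x; exact: expR_ge0.
- exact: line_integral_expR.
Qed.

Lemma integrable_damp n (e : R) : 0 < e -> (leb n).-integrable setT (EFin \o damp e).
Proof.
move=> e0; apply/integrableP; split; first by apply/measurable_EFinP; exact: measurable_damp.
under eq_integral do rewrite /= ger0_norm ?damp_ge0//.
by rewrite integral_damp// ltry.
Qed.

Lemma line_integral_poisson :
  (\int[@lebesgue_measure R]_x (2 * 1 / (1 ^+ 2 + x ^+ 2))%:E = (2 * pi)%:E)%E.
Proof.
have p0 (x : R) : 0 < 1 ^+ 2 + x ^+ 2 by rewrite ltr_wpDr ?sqr_ge0// exprn_gt0.
rewrite ge0_symfun_integralT; last 3 first.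
- by move=> x; rewrite divr_ge0// ltW.
- move=> x; apply: cvgM; first exact: cvg_cst.
  apply: cvgV; first by rewrite gt_eqF.
  apply: cvgD; [exact: cvg_cst|exact: exprn_continuous].
- by move=> x /=; rewrite sqrrN.
rewrite -set_itvcy.
rewrite (_ : (\int[_]_(x in _) _ = 2%:E * \int[lebesgue_measure]_(x in `[0%R, +oo[) (oneDsqr x)^-1%:E)%E); last first.
  rewrite -ge0_integralZl//=.
  - by apply: eq_integral => x _; rewrite -EFinM mulr1 expr1n.
  - apply/measurable_EFinP; apply: measurable_funTS.
    by apply: continuous_measurable_fun; exact: continuous_oneDsqrV.
rewrite integral0y_oneDsqr -!EFinM; congr EFin.
by field.
Qed.

(** The constant of Plancherel's identity arises as the total mass of [poisson 1]. *)
Definition plancherel_const n : R := (2 * pi) ^+ n.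

Lemma plancherel_const_gt0 n : 0 < plancherel_const n.
Proof. by rewrite exprn_gt0// mulr_gt0// pi_gt0. Qed.

Lemma integral_poisson n :
  (\int[leb n]_z (poisson 1 z)%:E = (plancherel_const n)%:E)%E.
Proof.
apply: (@integral_prod_cV n (fun x => 2 * 1 / (1 ^+ 2 + x ^+ 2))).
- exact: measurable_poisson1.
- by move=> x; rewrite divr_ge0// addr_ge0 ?sqr_ge0.
- exact: line_integral_poisson.
Qed.

Lemma measurable_damp_cos d (T : measurableType d) n e (f g : T -> 'cV[R]_n) (b : T -> R) :
  measurable_fun setT f -> measurable_fun setT g -> measurable_fun setT b ->
  measurable_fun setT (fun x => damp e (f x) * cos (dot (f x) (g x) + b x)).
Proof.
move=> mf mg mb; apply: measurable_funM; first exact: measurable_damp.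
apply: (measurableT_comp (@measurable_cos R)); apply: measurable_funD => //.
exact: measurable_dot.
Qed.

Lemma integrable_damp_cos n e (z : 'cV[R]_n) b : 0 < e ->
  (leb n).-integrable setT (fun w => (damp e w * cos (dot w z + b))%:E).
Proof.
move=> e0; apply: (@le_integrable _ _ _ _ _ measurableT _ _ _ _ (integrable_damp n e0)).
  by apply/measurable_EFinP; apply: measurable_damp_cos.
move=> x _; rewrite /= lee_fin normrM (ger0_norm (damp_ge0 e x)).
by rewrite ler_piMr ?damp_ge0// ler_norml cos_geN1 cos_le1.
Qed.

(** The phase [b] carries the induction: when one coordinate is split off, the other contributes to
    the cosine as a phase. *)
Lemma integral_damp_cos n e (z : 'cV[R]_n) b : 0 < e ->
  (\int[leb n]_w (damp e w * cos (dot w z + b))%:E = (poisson e z * cos b)%:E)%E.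
Proof.
move=> e0; elim: n z b => [|n IHn] z b.
  under eq_integral do rewrite /damp /dot !big_ord0 mul1r add0r.
  by rewrite integral_cst// /poisson big_ord0 mul1r /= diracE mem_set// mule1.
have iF := integrable_damp_cos z b e0.
rewrite -[LHS]/(\int[lebesgue_step (leb n)]_w (damp e w * cos (dot w z + b))%:E)%E.
have mcons := @measurable_cons_cV R n.
pose H (w : 'cV[R]_n.+1) := (damp e w * cos (dot w z + b))%:E.
have mH : measurable_fun setT H by exact: (measurable_int _ iF).
have iP : (lebesgue_measure \x leb n)%E.-integrable setT (H \o @cons_cV R n).
  apply/integrableP; split; first exact: measurableT_comp.
  have /integrableP[_] := iF; apply: le_lt_trans.
  rewrite -[X in (_ <= X)%E]/(\int[pushforward (lebesgue_measure \x leb n)%E (@cons_cV R n)]_w `|H w|)%E.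
  rewrite ge0_integral_pushforward//; exact: measurableT_comp.
rewrite -[LHS]/(\int[pushforward (lebesgue_measure \x leb n)%E (@cons_cV R n)]_w H w)%E.
rewrite integral_pushforward//.
rewrite preimage_setT -(integral12_prod_meas1 iP) /fubini_F/=.
under eq_integral => x _.
  under eq_integral => v _.
    rewrite /H dot_cons_cV {1}/damp (prod_cons_cV (fun x => expR (- (e * `|x|)))) -/(damp e v).
    rewrite [_ * _ + _]addrC -addrA -mulrA EFinM; over.
  rewrite integralZl//; last exact: integrable_damp_cos.
  rewrite IHn -EFinM mulrCA EFinM; over.
rewrite integralZl//; last first.
  apply: (@le_integrable _ _ _ _ _ measurableT _ _ _ _ (integrable_line_expR e0)).
    apply/measurable_EFinP; apply: measurable_funM; first exact: measurable_damp1.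
    by apply: (measurableT_comp (@measurable_cos R)); apply: measurable_funD => //; apply: measurable_funM.
  move=> x _; rewrite /= lee_fin normrM (ger0_norm (expR_ge0 _)).
  by rewrite ler_piMr ?expR_ge0// ler_norml cos_geN1 cos_le1.
rewrite line_integral_cos// -EFinM; congr EFin.
rewrite mulrCA mulrA; congr (_ * _).
rewrite [in RHS]/poisson big_ord_recl; congr (_ * _).
by apply: eq_bigr => i _; rewrite mxE.
Qed.

End poisson_kernel.

(** * Vanishing sequences and limits inferior *)

Section vanishing_sequences.
Variable R : realType.
Local Open Scope ereal_scope.
Implicit Types (u v : nat -> \bar R).

(* Only an upper bound: for nonnegative u this is convergence to 0. *)
Definition vanishing u : Prop :=
  forall e : R, (0 < e)%R -> \forall k \near \oo, u k <= e%:E.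

Lemma cvg0_vanishing u : u @ \oo --> 0 -> vanishing u.
Proof.
move=> u0 e e0; have ue : \forall k \near \oo, u k < e%:E.
  by apply: (u0 [set y | y < e%:E]); apply: open_ereal_lt'; rewrite lte_fin.
by apply: filterS ue => k /ltW.
Qed.

Lemma vanishing_le u v : (forall k, u k <= v k) -> vanishing v -> vanishing u.
Proof.
by move=> uv v0 e e0; have := v0 e e0; apply: filterS => k; exact: le_trans.
Qed.

Lemma vanishingD u v : vanishing u -> vanishing v -> vanishing (fun k => u k + v k).
Proof.
move=> u0 v0 e e0; have e20 : (0 < e / 2)%R by rewrite divr_gt0.
near=> k; rewrite [e]splitr EFinD; apply: leeD.
  by near: k; exact: u0.
by near: k; exact: v0.
Unshelve. all: by end_near. Qed.

Lemma vanishingZ u (c : R) : (0 <= c)%R -> (forall k, 0 <= u k) -> vanishing u ->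
  vanishing (fun k => c%:E * u k).
Proof.
move=> c0 u0 vu e e0; have c1 : (0 < c + 1)%R by lra.
have ec : (0 < e / (c + 1))%R by rewrite divr_gt0.
near=> k; have h : u k <= (e / (c + 1))%:E by near: k; exact: vu.
apply: (@le_trans _ _ ((c + 1)%:E * u k)).
  by rewrite lee_wpmul2r// lee_fin lerDl.
apply: (@le_trans _ _ ((c + 1)%:E * (e / (c + 1))%:E)).
  by rewrite lee_wpmul2l// lee_fin ltW.
by rewrite -EFinM lee_fin mulrC divfK// gt_eqF.
Unshelve. all: by end_near. Qed.

Lemma limn_einf_ge u y : (\forall k \near \oo, y <= u k) -> y <= limn_einf u.
Proof.
move=> yu; rewrite limn_einf_lim; apply: lime_ge.
  by apply: ereal_nondecreasing_is_cvgn; exact: nondecreasing_einfs.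
have [N _ NP] := yu; exists N => // k /= Nk.
by apply: le_ereal_inf_tmp => _ [m /= km <-]; apply: NP; exact: (leq_trans Nk).
Qed.

Lemma le_limn_einf u v : (forall k, u k <= v k) -> limn_einf u <= limn_einf v.
Proof.
move=> uv; rewrite !limn_einf_lim; apply: lee_lim.
- by apply: ereal_nondecreasing_is_cvgn; exact: nondecreasing_einfs.
- by apply: ereal_nondecreasing_is_cvgn; exact: nondecreasing_einfs.
apply: nearW => k; apply: le_ereal_inf_tmp => _ [m /= km <-].
by apply: (@le_trans _ _ (u m)) (uv m); apply: ereal_inf_lbound; exists m.
Qed.

Lemma limn_einf_le u y : (forall k, u k <= y) -> limn_einf u <= y.
Proof.
move=> uy; apply: (@le_trans _ _ (limn_einf (fun=> y))); first exact: le_limn_einf.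
by have /cvg_limn_einf_sup[-> _] : (fun=> y) @ \oo --> y by exact: cvg_cst.
Qed.

Lemma le_limn_einf_vanishing (a : \bar R) u v : (forall k, 0 <= v k) ->
  (forall k, a <= u k + v k) -> vanishing v -> a <= limn_einf u.
Proof.
move=> v0 auv vv; apply/lee_addgt0Pr => e e0.
rewrite -leeBlDr//; apply: limn_einf_ge.
near=> k; rewrite leeBlDr//; apply: le_trans (auv k) _.
by rewrite leeD2l//; near: k; exact: vv.
Unshelve. all: by end_near. Qed.

End vanishing_sequences.

(** * Continuity of translations on measurable sets *)

Section translation_continuity.
Variables (R : realType) (n : nat) (z : 'cV[R]_n).
Local Notation leb := (lebesgue_cV R n).
Local Notation t k := (k.+1%:R^-1 *: z).
Implicit Types (E F A : set 'cV[R]_n).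
Local Open Scope ereal_scope.

(** As the shifts [t k] are coordinatewise at most [z] in absolute value, [M] bounds the distortion
    of the weight [damp 1] by all of them at once. *)
Let M : R := \prod_i expR `|z i ord0|.

Let M0 : (0 <= M)%R. Proof. by apply: prodr_ge0 => i _; exact: expR_ge0. Qed.

Let damp_shift k (x : 'cV[R]_n) : (damp 1 (x - t k) <= M * damp 1 x)%R.
Proof.
rewrite /M /damp -big_split/=; apply: ler_prod => i _.
rewrite expR_ge0/= -expRD ler_expR !mul1r !mxE.
have : (`|x i ord0| <= `|x i ord0 - k.+1%:R^-1 * z i ord0| + `|k.+1%:R^-1 * z i ord0|)%R.
  by rewrite -{1}(subrK (k.+1%:R^-1 * z i ord0)%R (x i ord0)) ler_normD.
have : (`|k.+1%:R^-1 * z i ord0| <= `|z i ord0|)%R.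
  by rewrite normrM ger0_norm ?invr_ge0// ler_piMl// invf_le1 ?ler1n.
lra.
Qed.

Let rho A : \bar R := \int[leb]_x (damp 1 x * \1_A x)%:E.

Let measurable_shift k : measurable_fun setT (fun x : 'cV[R]_n => x + t k)%R.
Proof. by apply: measurable_addmx. Qed.

Let mind A d (T : measurableType d) (h : T -> 'cV[R]_n) : measurable A ->
  measurable_fun setT h -> measurable_fun setT (fun x => \1_A (h x) : R).
Proof. by move=> mA mh; exact: (measurableT_comp (measurable_indic mA) mh). Qed.

Let mdind A (h : 'cV[R]_n -> 'cV[R]_n) : measurable A ->
  measurable_fun setT h -> measurable_fun setT (fun x => (damp 1 x * \1_A (h x))%:E).
Proof.
move=> mA mh; apply/measurable_EFinP; apply: measurable_funM; last exact: mind.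
exact: measurable_damp.
Qed.

Let shift_rho A k : measurable A ->
  \int[leb]_x (damp 1 x * \1_A (x + t k)%R)%:E <= M%:E * rho A.
Proof.
move=> mA.
have mD : measurable_fun setT (fun x : 'cV[R]_n => damp 1 (x - t k)%R).
  by apply: measurable_damp; apply: measurable_submx.
have -> : \int[leb]_x (damp 1 x * \1_A (x + t k)%R)%:E =
    \int[leb]_x (damp 1 (x - t k)%R * \1_A x)%:E.
  rewrite -(@integral_cV_shift _ _ (t k) (fun x : 'cV[R]_n => (damp 1 (x - t k)%R * \1_A x)%:E)).
  - by apply: eq_integral => x _; rewrite addrK.
  - by apply/measurable_EFinP; apply: measurable_funM => //; exact: mind.
  - by move=> x; rewrite lee_fin mulr_ge0// damp_ge0.
rewrite /rho -ge0_integralZl_EFin//; last 2 first.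
- by move=> x _; rewrite lee_fin mulr_ge0// damp_ge0.
- exact: mdind.
apply: ge0_le_integral => //.
- by move=> x _; rewrite lee_fin mulr_ge0// damp_ge0.
- by apply/measurable_EFinP; apply: measurable_funM => //; exact: mind.
- by apply: measurable_funeM; exact: mdind.
- by move=> x _; rewrite -EFinM lee_fin mulrA ler_wpM2r.
Qed.

(** The weighted measure of the symmetric difference of [E] and its translate by [- t k]. The weight
    makes it finite even when [E] has infinite measure. *)
Let delta E k : \bar R := \int[leb]_x (damp 1 x * `|\1_E (x + t k)%R - \1_E x|)%:E.

Let delta_ge0 E k : 0 <= delta E k.
Proof. by apply: integral_ge0 => x _; rewrite lee_fin mulr_ge0// damp_ge0. Qed.

Let mdelta E k : measurable E ->
  measurable_fun setT (fun x : 'cV[R]_n => (damp 1 x * `|\1_E (x + t k)%R - \1_E x|)%:E).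
Proof.
move=> mE; apply/measurable_EFinP; apply: measurable_funM.
  exact: measurable_damp.
by apply: measurableT_comp => //; apply: measurable_funB; exact: mind.
Qed.

(* These sets form a sigma-algebra containing the half-spaces x_i > q; the finite
   measure damp 1 dx makes countable unions harmless. *)
Let tcont E := measurable E /\ vanishing (delta E).

Let tcont_C E : tcont E -> tcont (~` E).
Proof.
move=> [mE vE]; split; first exact: measurableC.
rewrite (_ : delta (~` E) = delta E)//; apply/funext => k; apply: eq_integral => x _.
rewrite !indicE !in_setC; case: (_ \in E); case: (_ \in E);
  by rewrite /= ?(subrr, subr0, sub0r, normrN, normr0, normr1).
Qed.

Let tcont_I E F : tcont E -> tcont F -> tcont (E `&` F).
Proof.
move=> [mE vE] [mF vF]; split; first exact: measurableI.
apply: vanishing_le (vanishingD vE vF) => k.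
rewrite /delta -ge0_integralD//; last 4 first.
- by move=> x _; rewrite lee_fin mulr_ge0// damp_ge0.
- exact: mdelta.
- by move=> x _; rewrite lee_fin mulr_ge0// damp_ge0.
- exact: mdelta.
apply: ge0_le_integral => //.
- by move=> x _; rewrite lee_fin mulr_ge0// damp_ge0.
- by apply: mdelta; exact: measurableI.
- by apply: emeasurable_funD; exact: mdelta.
move=> x _; rewrite -EFinD lee_fin -mulrDr ler_wpM2l ?damp_ge0//.
rewrite !indicE !in_setI; set y := (x + _)%R.
by case: (y \in E); case: (y \in F); case: (x \in E); case: (x \in F);
   rewrite /= ?(subrr, subr0, sub0r, normrN, normr0, normr1); lra.
Qed.

Let tcont_0 : tcont set0.
Proof.
split => //; apply: (@vanishing_le _ _ (fun=> 0)) => [k|e e0]; last first.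
  by apply: nearW => k; rewrite lee_fin ltW.
rewrite /delta; under eq_integral do rewrite !indic0 subrr normr0 mulr0.
by rewrite integral0.
Qed.

Let tcont_U E F : tcont E -> tcont F -> tcont (E `|` F).
Proof. by move=> hE hF; rewrite -(setCK (E `|` F)) setCU; apply: tcont_C; apply: tcont_I; exact: tcont_C. Qed.

Let tcont_big (F : nat -> set 'cV[R]_n) N : (forall i, tcont (F i)) -> tcont (\bigcup_(i < N) F i).
Proof.
move=> hF; elim: N => [|N IHN]; first by rewrite bigcup_mkord big_ord0.
by rewrite bigcup_mkord big_ord_recr/= -bigcup_mkord; exact: tcont_U.
Qed.

(** The part [E \ F] is counted once in place and once translated; the translated copy costs the
    factor [M]. *)
Let delta_diff E F k : measurable E -> measurable F -> F `<=` E ->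
  delta E k <= delta F k + (M + 1)%:E * rho (E `\` F).
Proof.
move=> mE mF FE; have mEF : measurable (E `\` F) by exact: measurableD.
apply: (@le_trans _ _ (delta F k + \int[leb]_x (damp 1 x * \1_(E `\` F) (x + t k)%R)%:E
   + rho (E `\` F))); last first.
  rewrite EFinD ge0_muleDl ?lee_fin// mul1e -addeA; apply: leeD; first exact: lexx.
  by apply: leeD; [exact: shift_rho|exact: lexx].
rewrite /delta /rho -ge0_integralD//; last 4 first.
- by move=> x _; rewrite lee_fin mulr_ge0// damp_ge0.
- exact: mdelta.
- by move=> x _; rewrite lee_fin mulr_ge0// damp_ge0.
- exact: mdind.
rewrite -ge0_integralD//; last 4 first.
- by move=> x _; apply: adde_ge0; rewrite lee_fin mulr_ge0// damp_ge0.
- by apply: emeasurable_funD; [exact: mdelta|exact: mdind].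
- by move=> x _; rewrite lee_fin mulr_ge0// damp_ge0.
- exact: mdind.
apply: ge0_le_integral => //.
- by move=> x _; rewrite lee_fin mulr_ge0// damp_ge0.
- exact: mdelta.
- apply: emeasurable_funD; last exact: mdind.
  by apply: emeasurable_funD; [exact: mdelta|exact: mdind].
move=> x _; rewrite -!EFinD lee_fin -!mulrDr ler_wpM2l ?damp_ge0//.
have dE y : \1_E y = (\1_F y + \1_(E `\` F) y)%R :> R.
  rewrite !indicE in_setD; case: (boolP (y \in F)) => [yF|]; last first.
    by rewrite andbT add0r.
  by rewrite andbF addr0 mem_set//; apply: FE; exact/set_mem.
rewrite !dE; set a := \1_F _; set b := \1_(_ `\` _) _; set c := \1_F x.
have b0 : (0 <= b)%R by []. 
have d0 : (0 <= \1_(E `\` F) x :> R)%R by [].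
rewrite (_ : _ - _ = (a - c) + (b - \1_(E `\` F) x))%R; last by ring.
apply: (le_trans (ler_normD _ _)); rewrite -addrA lerD2l.
by apply: (le_trans (ler_normB _ _)); rewrite !ger0_norm.
Qed.

Let tcont_bigcup (F : nat -> set 'cV[R]_n) : (forall i, tcont (F i)) -> tcont (\bigcup_i F i).
Proof.
move=> hF; have mF i := (hF i).1; have mE : measurable (\bigcup_i F i) by exact: bigcup_measurable.
split => // e e0.
(* A finite union approximates the whole one: the rest has small weighted measure, and [delta_diff]
   bounds its contribution uniformly in [k]. *)
pose G N := \bigcup_(i < N) F i.
have mG N : measurable (G N) by exact: (tcont_big N hF).1.
have GE N : G N `<=` \bigcup_i F i by move=> x [i _ Fix]; exists i.
have : vanishing (fun N => (M + 1)%:E * rho ((\bigcup_i F i) `\` G N)).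
  apply: vanishingZ; first by rewrite addr_ge0.
    by move=> k; apply: integral_ge0 => x _; rewrite lee_fin mulr_ge0// damp_ge0.
  apply: cvg0_vanishing.
  have := @dominated_convergence _ _ _ leb setT measurableT
    (fun N x => (damp 1 x * \1_((\bigcup_i F i) `\` G N) x)%:E) (cst 0)
    (EFin \o damp 1).
  case.
  - by move=> N; apply: mdind => //; exact: measurableD.
  - exact: measurable_cst.
  - apply: aeW => x _; apply: cvg_near_cst.
    have [[i _ Fix]|nE] := pselect ((\bigcup_i F i) x).
      exists i.+1 => // N /= iN; rewrite indicE memNset ?mulr0// => -[_]; apply.
      by exists i.
    by apply: nearW => N; rewrite indicE memNset ?mulr0// => -[].
  - exact: integrable_damp.
  - apply: aeW => x N _; rewrite gee0_abs ?lee_fin ?mulr_ge0 ?damp_ge0//=.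
    by rewrite ler_piMr ?damp_ge0// indicE; case: (_ \in _).
  by move=> _ _; rewrite integral0.
have e20 : (0 < e / 2)%R by rewrite divr_gt0.
move=> /(_ _ e20)[N _ /(_ N (leqnn N)) hN].
have := (tcont_big N hF).2 _ e20; apply: filterS => k hk.
apply: le_trans (delta_diff k mE (mG N) (GE N)) _.
apply: (@le_trans _ _ ((e / 2)%:E + (e / 2)%:E)); first exact: leeD.
by rewrite -EFinD -splitr.
Qed.

Let tcont_sigma : sigma_algebra setT tcont.
Proof. by split; [exact: tcont_0|move=> A; rewrite setTD; exact: tcont_C|exact: tcont_bigcup]. Qed.

Lemma hyperplane_null i (q : R) : leb [set x | x i ord0 = q] = 0.
Proof.
pose A j := if j == i then [set q] else [set: R].
rewrite (_ : mkset _ = [set x | forall j, A j (x j ord0)]); last first.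
  apply/seteqP; split => x /=.
    by move=> xq j; rewrite /A; case: eqP => [->|].
  by move=> /(_ i); rewrite /A eqxx.
rewrite lebesgue_cV_box; last by move=> j; rewrite /A; case: ifP.
by rewrite (bigD1 i)//= /A eqxx lebesgue_measure_set1 mul0e.
Qed.

Let tcont_ray i (q : R) : tcont [set x | (q < x i ord0)%R].
Proof.
have mE : measurable [set x : 'cV[R]_n | (q < x i ord0)%R].
  rewrite (_ : mkset _ = (fun x : 'cV[R]_n => x i ord0) @^-1` `]q, +oo[%classic).
    by rewrite -[X in measurable X]setTI; exact: measurable_coord.
  by apply/seteqP; split => x; rewrite /= in_itv/= andbT.
split=> //; apply: cvg0_vanishing.
have := @dominated_convergence _ _ _ leb setT measurableT
    (fun k (x : 'cV[R]_n) => (damp 1 x * `|\1_[set x | (q < x i ord0)%R] (x + t k)%R - \1_[set x | (q < x i ord0)%R] x|)%:E) (cst 0)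
    (EFin \o damp 1).
case.
- by move=> k; exact: mdelta.
- exact: measurable_cst.
(* The exceptional set is the boundary of the half-space. Off it, a small enough shift leaves [x] on
   its side, so the integrand is eventually 0. *)
- exists [set x : 'cV[R]_n | x i ord0 = q]; split.
  + rewrite -[X in measurable X]setTI.
    exact: (@measurable_coord R n 1 i ord0 measurableT _ (measurable_set1 q)).
  + exact: hyperplane_null.
  + move=> x /=; apply: contra_notP => xq _; apply: cvg_near_cst.
    have d0 : (0 < `|x i ord0 - q|)%R by rewrite normr_gt0 subr_eq0; exact/eqP.
    have : (fun k => k.+1%:R^-1 * z i ord0)%R @ \oo --> (0%R : R).
      rewrite -(mul0r (z i ord0)); apply: cvgMl; exact: cvg_harmonic.
    move=> /cvgr0Pnorm_lt/(_ _ d0); apply: filterS => k kd /=.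
    pose E := [set y : 'cV[R]_n | (q < y i ord0)%R].
    have h1 : \1_E (x + t k)%R = \1_E x :> R.
      apply: indic_iff; rewrite /E/= !mxE; move: kd.
      set s := (_ * _)%R; rewrite lter_norml; case: (ltP q (x i ord0)) => h.
        by rewrite ger0_norm ?subr_ge0 1?ltW// => /andP[]; split; lra.
      by rewrite ler0_norm ?subr_le0// => /andP[]; split; lra.
    apply: (etrans (congr1 (fun r : R => (damp 1 x * `|r - \1_E x|)%:E) h1)).
    by rewrite /= subrr normr0 mulr0.
- exact: integrable_damp.
- apply: aeW => x k _; rewrite gee0_abs ?lee_fin ?mulr_ge0 ?damp_ge0//=.
  rewrite ler_piMr ?damp_ge0// !indicE; case: (_ \in _); case: (_ \in _);
   by rewrite /= ?(subrr, subr0, sub0r, normrN, normr0, normr1).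
by move=> _ _; rewrite integral0.
Qed.

Let tcont_measurable E : measurable E -> tcont E.
Proof.
move=> mE; apply: (smallest_sub tcont_sigma _ mE) => _ [i [j [B [mB ->]]]].
rewrite [j]ord1.
have {}mB : (@RGenOInfty.G R).-sigma.-measurable B.
  by rewrite -RGenOInfty.measurableE.
pose H (B : set R) := tcont ((fun x : 'cV[R]_n => x i ord0) @^-1` B).
apply: (@smallest_sub _ _ _ H _ _ B mB).
  split; rewrite /H.
  - by rewrite preimage_set0.
  - by move=> A hA; rewrite setTD preimage_setC; exact: tcont_C.
  - by move=> F hF; rewrite preimage_bigcup; exact: tcont_bigcup.
move=> _ [q ->]; rewrite /H (_ : _ @^-1` _ = [set x : 'cV[R]_n | (q < x i ord0)%R]).
  exact: tcont_ray.
by apply/seteqP; split => x; rewrite /= in_itv/= andbT.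
Qed.

(** [E] may have infinite measure, where only the weighted difference is under control. On the part
    [Q m] where the weight is at least [1 / (m + 1)], removing the weight costs the factor [m + 1],
    and [Q m] increases to [E]. *)
Lemma lebesgue_shift_liminf E : measurable E ->
  \int[leb]_x (\1_E x)%:E <= limn_einf (fun k => \int[leb]_x (\1_E x * \1_E (x + t k)%R)%:E).
Proof.
move=> mE; set L := limn_einf _.
have mw m : measurable [set x : 'cV[R]_n | (m.+1%:R^-1 <= damp 1 x)%R].
  rewrite (_ : mkset _ = damp 1 @^-1` `[m.+1%:R^-1%R, +oo[%classic); last first.
    by apply/seteqP; split => x; rewrite /= in_itv/= andbT.
  by rewrite -[X in measurable X]setTI; exact: (@measurable_damp _ _ _ _ 1%R id).
pose Q m := E `&` [set x : 'cV[R]_n | (m.+1%:R^-1 <= damp 1 x)%R].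
have mQ m : measurable (Q m) by exact: measurableI.
have EQ : E = \bigcup_m Q m.
  apply/seteqP; split => [x Ex|x [m _ []]]//.
  have d0 : (0 < damp 1 x)%R by rewrite /damp prodr_gt0// => i _; exact: expR_gt0.
  exists (Num.trunc (damp 1 x)^-1) => //; split => //=.
  rewrite invf_ple ?posrE//; apply: ltW; exact: truncnS_gt.
apply: (@le_trans _ _ (leb (\bigcup_m Q m))).
  by rewrite -EQ integral_indic// setIT.
have cQ : leb \o Q @ \oo --> leb (\bigcup_m Q m).
  apply: nondecreasing_cvg_mu => //; first exact: bigcup_measurable.
  move=> p m pm; apply/subsetPset => x [Ex /= h]; split => //=; apply: le_trans h.
  by rewrite lef_pV2 ?posrE// ler_nat.
have -> : leb (\bigcup_m Q m) = limn (leb \o Q) by apply/esym/cvg_lim.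
apply: lime_le; first by apply/cvg_ex; eexists; exact: cQ.
apply: nearW => m /=.
apply: (@le_limn_einf_vanishing _ _ _ (fun k => m.+1%:R%:E * delta E k)).
- by move=> k; rewrite mule_ge0// lee_fin.
- move=> k; rewrite -(setIT (Q m)) -integral_indic// /delta -ge0_integralZl_EFin//; last 2 first.
  + by move=> x _; rewrite lee_fin mulr_ge0// damp_ge0.
  + exact: mdelta.
  have mEE : measurable_fun setT (fun x : 'cV[R]_n => (\1_E x * \1_E (x + t k)%R)%:E : \bar R).
    by apply/measurable_EFinP; apply: measurable_funM; exact: mind.
  rewrite -ge0_integralD//; last 2 first.
  + by move=> x _; rewrite -EFinM lee_fin !mulr_ge0// damp_ge0.
  + by apply: measurable_funeM; exact: mdelta.
  apply: ge0_le_integral => //.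
  + by apply/measurable_EFinP; exact: mind.
  + by apply: emeasurable_funD => //; apply: measurable_funeM; exact: mdelta.
  move=> x _; rewrite -EFinM -EFinD lee_fin.
  rewrite indicE; case: (boolP (x \in Q m)) => [/set_mem[Ex /= wx]|_]; last first.
    by rewrite addr_ge0// !mulr_ge0// damp_ge0.
  rewrite [\1_E x]indicE mem_set//= mul1r indicE; case: (_ \in E) => /=.
    by rewrite subrr normr0 mulr0 mulr0 addr0.
  rewrite sub0r normrN normr1 mulr1 add0r.
  have m0 : (0 < m.+1%:R :> R)%R by [].
  by move: wx; rewrite -(ler_pM2l m0) divff// gt_eqF.
- by apply: vanishingZ => //; exact: (tcont_measurable mE).2.
Qed.

End translation_continuity.

Section integrable_real.
Context d (T : measurableType d) (R : realType) (m : {measure set T -> \bar R}).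
Implicit Types (u v : T -> R).

Lemma integrable_measurable u : m.-integrable setT (EFin \o u) -> measurable_fun setT u.
Proof. by move/measurable_int/measurable_EFinP. Qed.

Lemma integrable_le u v : measurable_fun setT u -> (forall x, `|u x| <= `|v x|) ->
  m.-integrable setT (EFin \o v) -> m.-integrable setT (EFin \o u).
Proof.
move=> mu uv; apply: le_integrable => //; first exact/measurable_EFinP.
by move=> x _; rewrite lee_fin.
Qed.

Lemma integrable_mul_le1 u v : m.-integrable setT (EFin \o u) ->
  measurable_fun setT v -> (forall x, `|v x| <= 1) ->
  m.-integrable setT (EFin \o (fun x => u x * v x)).
Proof.
move=> iu mv v1; apply: (integrable_le _ _ iu).
  by apply: measurable_funM => //; exact: integrable_measurable.
by move=> x; rewrite normrM ler_piMr.
Qed.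

Lemma EFin_Rintegral u : m.-integrable setT (EFin \o u) ->
  ((\int[m]_x u x)%:E = \int[m]_x (u x)%:E)%E.
Proof. by move=> iu; rewrite /Rintegral fineK//; exact: integrable_fin_num. Qed.

Lemma integrable_add u v : m.-integrable setT (EFin \o u) ->
  m.-integrable setT (EFin \o v) -> m.-integrable setT (EFin \o (fun x => u x + v x)).
Proof.
move=> iu iv; rewrite (_ : EFin \o _ = (EFin \o u) \+ (EFin \o v))%E.
  exact: integrableD.
by apply/funext => x; rewrite /= EFinD.
Qed.

Lemma integrable_sub u v : m.-integrable setT (EFin \o u) ->
  m.-integrable setT (EFin \o v) -> m.-integrable setT (EFin \o (fun x => u x - v x)).
Proof.
move=> iu iv; rewrite (_ : EFin \o _ = (EFin \o u) \- (EFin \o v))%E.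
  exact: integrableB.
by apply/funext => x; rewrite /= EFinB.
Qed.

Lemma integrable_scale (c : R) u : m.-integrable setT (EFin \o u) ->
  m.-integrable setT (EFin \o (fun x => c * u x)).
Proof.
move=> iu; rewrite (_ : EFin \o _ = (fun x => c%:E * (EFin \o u) x))%E.
  exact: integrableZl.
by apply/funext => x; rewrite /= EFinM.
Qed.

Lemma norm_Rintegral_le u : m.-integrable setT (EFin \o u) ->
  `|\int[m]_x u x| <= \int[m]_x `|u x|.
Proof. by move=> iu; exact: le_normr_Rintegral. Qed.

Lemma ge0_integrableP u : measurable_fun setT u -> (forall x, 0 <= u x) ->
  (\int[m]_x (u x)%:E < +oo)%E -> m.-integrable setT (EFin \o u).
Proof.
move=> mu u0 uoo; apply/integrableP; split; first exact/measurable_EFinP.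
by under eq_integral do rewrite gee0_abs ?lee_fin//=.
Qed.

End integrable_real.

Lemma measurable_Rintegral d1 d2 (T1 : measurableType d1) (T2 : measurableType d2)
    (R : realType) (m2 : {sigma_finite_measure set T2 -> \bar R}) (h : T1 * T2 -> R) :
  measurable_fun setT h -> measurable_fun setT (fun x => \int[m2]_y h (x, y)).
Proof.
move=> mh; have mh' : measurable_fun setT (EFin \o h) by exact/measurable_EFinP.
apply: measurableT_comp => //.
rewrite [X in measurable_fun _ X](_ : _ = fun x =>
  \int[m2]_y ((EFin \o h)^\+ (x, y)) - \int[m2]_y ((EFin \o h)^\- (x, y)))%E; last first.
  apply/funext => x; rewrite integralE; congr (_ - _)%E.
    by apply: eq_integral => y _; rewrite !funeposE.
  by apply: eq_integral => y _; rewrite !funenegE.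
have mp := measurable_funepos mh'; have mn := measurable_funeneg mh'.
apply: emeasurable_funB.
  exact: (measurable_fun_fubini_tonelli_F (m2 := m2) _ mp (fun=> funepos_ge0 _ _)).
exact: (measurable_fun_fubini_tonelli_F (m2 := m2) _ mn (fun=> funeneg_ge0 _ _)).
Qed.

(** * Scalar cosine and sine transforms *)

Section fourier_transform.
Variables (R : realType) (n : nat).
Local Notation leb := (lebesgue_cV R n).
Local Notation Rn := 'cV[R]_n.
Implicit Types (u v : Rn -> R).

Definition fcos u (w : Rn) : R := \int[leb]_x (u x * cos (dot w x)).
Definition fsin u (w : Rn) : R := \int[leb]_x (u x * sin (dot w x)).
Definition fsq u w : R := fcos u w ^+ 2 + fsin u w ^+ 2.

Lemma fsq_ge0 u w : 0 <= fsq u w.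
Proof. by rewrite addr_ge0 ?sqr_ge0. Qed.

Lemma measurable_cos_dot d (T : measurableType d) (f g : T -> Rn) :
  measurable_fun setT f -> measurable_fun setT g ->
  measurable_fun setT (fun t => cos (dot (f t) (g t))).
Proof.
by move=> mf mg; apply: (measurableT_comp (@measurable_cos R)); exact: measurable_dot.
Qed.

Lemma measurable_sin_dot d (T : measurableType d) (f g : T -> Rn) :
  measurable_fun setT f -> measurable_fun setT g ->
  measurable_fun setT (fun t => sin (dot (f t) (g t))).
Proof.
by move=> mf mg; apply: (measurableT_comp (@measurable_sin R)); exact: measurable_dot.
Qed.

Lemma norm_cos_le1 (x : R) : `|cos x| <= 1.
Proof. by rewrite ler_norml cos_geN1 cos_le1. Qed.

Lemma norm_sin_le1 (x : R) : `|sin x| <= 1.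
Proof. by rewrite ler_norml sin_geN1 sin_le1. Qed.

Lemma integrable_mul_cos u w : leb.-integrable setT (EFin \o u) ->
  leb.-integrable setT (EFin \o (fun x => u x * cos (dot w x))).
Proof.
move=> iu; apply: integrable_mul_le1 => // [|x]; last exact: norm_cos_le1.
exact: measurable_cos_dot.
Qed.

Lemma integrable_mul_sin u w : leb.-integrable setT (EFin \o u) ->
  leb.-integrable setT (EFin \o (fun x => u x * sin (dot w x))).
Proof.
move=> iu; apply: integrable_mul_le1 => // [|x]; last exact: norm_sin_le1.
exact: measurable_sin_dot.
Qed.

Lemma measurable_fcos u : measurable_fun setT u -> measurable_fun setT (fcos u).
Proof.
move=> mu; apply: (@measurable_Rintegral _ _ Rn Rn R leb (fun p => u p.2 * cos (dot p.1 p.2))).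
apply: measurable_funM; first exact: (measurableT_comp mu).
exact: measurable_cos_dot.
Qed.

Lemma measurable_fsin u : measurable_fun setT u -> measurable_fun setT (fsin u).
Proof.
move=> mu; apply: (@measurable_Rintegral _ _ Rn Rn R leb (fun p => u p.2 * sin (dot p.1 p.2))).
apply: measurable_funM; first exact: (measurableT_comp mu).
exact: measurable_sin_dot.
Qed.

Lemma measurable_fsq u : measurable_fun setT u -> measurable_fun setT (fsq u).
Proof.
move=> mu; apply: measurable_funD; apply: measurable_funX.
  exact: measurable_fcos.
exact: measurable_fsin.
Qed.

Lemma fcos_le u w : leb.-integrable setT (EFin \o u) ->
  `|fcos u w| <= \int[leb]_x `|u x|.
Proof.
move=> iu; apply: le_trans (norm_Rintegral_le (integrable_mul_cos w iu)) _.
apply: le_Rintegral => //.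
- by apply: integrable_norm; exact: integrable_mul_cos.
- exact: integrable_norm.
by move=> x _; rewrite normrM ler_piMr// norm_cos_le1.
Qed.

Lemma fsin_le u w : leb.-integrable setT (EFin \o u) ->
  `|fsin u w| <= \int[leb]_x `|u x|.
Proof.
move=> iu; apply: le_trans (norm_Rintegral_le (integrable_mul_sin w iu)) _.
apply: le_Rintegral => //.
- by apply: integrable_norm; exact: integrable_mul_sin.
- exact: integrable_norm.
by move=> x _; rewrite normrM ler_piMr// norm_sin_le1.
Qed.

Lemma fcosD u v w : leb.-integrable setT (EFin \o u) -> leb.-integrable setT (EFin \o v) ->
  fcos (fun x => u x + v x) w = fcos u w + fcos v w.
Proof.
move=> iu iv; rewrite /fcos.
rewrite (@eq_Rintegral _ _ R leb setT (fun x => u x * cos (dot w x) + v x * cos (dot w x))); last first.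
  by move=> x _; rewrite mulrDl.
by rewrite RintegralD//; exact: integrable_mul_cos.
Qed.

Lemma fsinD u v w : leb.-integrable setT (EFin \o u) -> leb.-integrable setT (EFin \o v) ->
  fsin (fun x => u x + v x) w = fsin u w + fsin v w.
Proof.
move=> iu iv; rewrite /fsin.
rewrite (@eq_Rintegral _ _ R leb setT (fun x => u x * sin (dot w x) + v x * sin (dot w x))); last first.
  by move=> x _; rewrite mulrDl.
by rewrite RintegralD//; exact: integrable_mul_sin.
Qed.

Lemma fcosZ (c : R) u w : leb.-integrable setT (EFin \o u) ->
  fcos (fun x => c * u x) w = c * fcos u w.
Proof.
move=> iu; rewrite /fcos.
rewrite (@eq_Rintegral _ _ R leb setT (fun x => c * (u x * cos (dot w x)))); last first.
  by move=> x _; rewrite mulrA.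
by rewrite RintegralZl//; exact: integrable_mul_cos.
Qed.

Lemma fsinZ (c : R) u w : leb.-integrable setT (EFin \o u) ->
  fsin (fun x => c * u x) w = c * fsin u w.
Proof.
move=> iu; rewrite /fsin.
rewrite (@eq_Rintegral _ _ R leb setT (fun x => c * (u x * sin (dot w x)))); last first.
  by move=> x _; rewrite mulrA.
by rewrite RintegralZl//; exact: integrable_mul_sin.
Qed.

Lemma dotBr (w x y : Rn) : dot w (x - y) = dot w x - dot w y.
Proof. by rewrite !dotE mulmxBr !mxE. Qed.

(** [fsq u w] is the double integral of [u x * u y * cos (w . (x - y))], and integrating the damped
    cosine over [w] gives the Poisson kernel. The damping supplies the integrability in [w] that
    Fubini requires. *)
Lemma damp_fsq u e : 0 < e -> leb.-integrable setT (EFin \o u) ->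
  [/\ leb.-integrable setT (EFin \o (fun w => damp e w * fsq u w)),
   leb.-integrable setT (EFin \o (fun x => \int[leb]_y (u x * u y * poisson e (x - y)))),
   (forall x, leb.-integrable setT (EFin \o (fun y => u x * u y * poisson e (x - y)))) &
   \int[leb]_w (damp e w * fsq u w) =
   \int[leb]_x (\int[leb]_y (u x * u y * poisson e (x - y)))].
Proof.
move=> e0 iu; have mu := integrable_measurable iu.
have iD := integrable_damp n e0.
have [N [N0 cN sN]] : exists N : R, [/\ 0 <= N, forall w, `|fcos u w| <= N & forall w, `|fsin u w| <= N].
  exists (\int[leb]_x `|u x|); split=> [|w|w]; [exact: Rintegral_ge0|exact: fcos_le|exact: fsin_le].
(* Only one copy of [u] is unfolded; the other stays in [fcos] and [fsin], bounded by [N]. So Fubini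
   on pairs [(w, x)] suffices, with a second use, for fixed [x], on pairs [(w, y)]. *)
pose H (p : Rn * Rn) := damp e p.1 * u p.2 *
  (cos (dot p.1 p.2) * fcos u p.1 + sin (dot p.1 p.2) * fsin u p.1).
have mH : measurable_fun setT H.
  apply: measurable_funM.
    apply: measurable_funM; first exact: measurable_damp.
    exact: (measurableT_comp mu).
  apply: measurable_funD; apply: measurable_funM.
  - exact: measurable_cos_dot.
  - exact: (measurableT_comp (measurable_fcos mu)).
  - exact: measurable_sin_dot.
  - exact: (measurableT_comp (measurable_fsin mu)).
have iN : leb.-integrable setT (EFin \o (fun x => 2 * N * `|u x|)).
  by apply: integrable_scale; exact: integrable_norm.
have iH : (leb \x leb)%E.-integrable setT (EFin \o H).
  apply: (integrable_tensor_le mH _ iD iN) => w x.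
  rewrite /H/= !normrM ger0_norm ?damp_ge0// -mulrA ler_wpM2l ?damp_ge0// mulrC.
  rewrite ler_wpM2r//; apply: (le_trans (ler_normD _ _)).
  rewrite mulr_natl mulr2n !normrM; apply: lerD.
    by rewrite -[leRHS]mul1r ler_pM// ?norm_cos_le1.
  by rewrite -[leRHS]mul1r ler_pM// ?norm_sin_le1.
have HE w : \int[leb]_x H (w, x) = damp e w * fsq u w.
  rewrite /H/= (@eq_Rintegral _ _ R leb setT (fun x => (damp e w * fcos u w) * (u x * cos (dot w x)) +
    (damp e w * fsin u w) * (u x * sin (dot w x)))); last by move=> x _; ring.
  rewrite RintegralD; [|exact: measurableT| |]; last 2 first.
  - by apply: integrable_scale; exact: integrable_mul_cos.
  - by apply: integrable_scale; exact: integrable_mul_sin.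
  rewrite RintegralZl; [|exact: measurableT|exact: integrable_mul_cos].
    rewrite RintegralZl; [|exact: measurableT|exact: integrable_mul_sin].
  by rewrite -/(fcos u w) -/(fsin u w) /fsq; ring.
have GE x : \int[leb]_w H (w, x) = \int[leb]_y (u x * u y * poisson e (x - y)).
  pose G (p : Rn * Rn) := u x * (u p.2 * (damp e p.1 * cos (dot p.1 (x - p.2) + 0))).
  have mG : measurable_fun setT G.
    apply: measurable_funM => //; apply: measurable_funM; first exact: (measurableT_comp mu).
    apply: measurable_damp_cos => //.
    by apply: measurable_submx.
  have iux : leb.-integrable setT (EFin \o (fun y => `|u x| * `|u y|)).
    by apply: integrable_scale; exact: integrable_norm.
  have iG : (leb \x leb)%E.-integrable setT (EFin \o G).
    apply: (integrable_tensor_le mG _ iD iux) => w y.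
    rewrite /G/= !normrM (ger0_norm (damp_ge0 e w)).
    set c := `|cos _|; rewrite (_ : _ * (_ * (_ * c)) = damp e w * (`|u x| * `|u y|) * c); last by ring.
    by rewrite ler_piMr ?norm_cos_le1// !mulr_ge0// damp_ge0.
  have [_ _ GG] := Rfubini iG.
  transitivity (\int[leb]_w \int[leb]_y G (w, y)).
    apply: eq_Rintegral => w _; apply/esym; rewrite /G/=.
    rewrite (@eq_Rintegral _ _ R leb setT (fun y =>
      (damp e w * u x * cos (dot w x)) * (u y * cos (dot w y)) +
      (damp e w * u x * sin (dot w x)) * (u y * sin (dot w y)))); last first.
      by move=> y _; rewrite addr0 dotBr cosB; ring.
    rewrite RintegralD; [|exact: measurableT| |]; last 2 first.
    - by apply: integrable_scale; exact: integrable_mul_cos.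
    - by apply: integrable_scale; exact: integrable_mul_sin.
    rewrite RintegralZl; [|exact: measurableT|exact: integrable_mul_cos].
    rewrite RintegralZl; [|exact: measurableT|exact: integrable_mul_sin].
    by rewrite -/(fcos u w) -/(fsin u w) /H/=; ring.
  rewrite GG; apply: eq_Rintegral => y _; rewrite /G/=.
  rewrite RintegralZl; [|exact: measurableT|by apply: integrable_scale; exact: integrable_damp_cos].
  rewrite RintegralZl; [|exact: measurableT|exact: integrable_damp_cos].
  have -> : \int[leb]_w (damp e w * cos (dot w (x - y) + 0)) = poisson e (x - y).
    by rewrite /Rintegral (integral_damp_cos _ _ e0) cos0 mulr1.
  by rewrite mulrA.
have [iF1 iF2 FF] := Rfubini iH.
split.
- suff -> : EFin \o (fun w => damp e w * fsq u w) = fun w => (\int[leb]_x H (w, x))%:E by exact: iF1.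
  by apply/funext => w; rewrite HE.
- suff -> : EFin \o (fun x => \int[leb]_y (u x * u y * poisson e (x - y))) =
    fun x => (\int[leb]_w H (w, x))%:E by exact: iF2.
  by apply/funext => x; rewrite GE.
- move=> x; apply: (integrable_le _ _ (integrable_scale (`|u x| * (2 / e) ^+ n) iu)).
    apply: measurable_funM; first exact: measurable_funM.
    by apply: (@measurable_poisson R _ Rn n e (fun y : Rn => x - y) e0); apply: measurable_submx.
  move=> y; rewrite /= !normrM (ger0_norm (poisson_ge0 _ (ltW e0))) normr_id.
  have hp : poisson e (x - y) <= `|(2 / e) ^+ n|.
    exact: le_trans (poisson_le _ e0) (ler_norm _).
  rewrite [leRHS]mulrAC; apply: ler_wpM2l hp; exact: mulr_ge0.
transitivity (\int[leb]_w \int[leb]_x H (w, x)).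
  by apply: eq_Rintegral => w _; rewrite HE.
by rewrite FF; apply: eq_Rintegral => x _; rewrite GE.
Qed.

End fourier_transform.

(** * Damped energy as an average of autocorrelations *)

Section plancherel.
Variables (R : realType) (n : nat).
Local Notation leb := (lebesgue_cV R n).
Local Notation Rn := 'cV[R]_n.
Implicit Types (u v : Rn -> R).
Local Open Scope ereal_scope.

Definition autocorr u (t : Rn) : \bar R := \int[leb]_x (u x * u (x + t)%R)%:E.

Lemma measurable_shifted u (t : Rn) : measurable_fun setT u ->
  measurable_fun setT (fun x : Rn => u (x + t)%R).
Proof.
by move=> mu; apply: (measurableT_comp mu); apply: measurable_addmx.
Qed.

Lemma poisson_scale (e : R) (z : Rn) : (0 < e)%R ->
  (e ^+ n * poisson e (e *: z) = poisson 1 z)%R.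
Proof.
move=> e0; rewrite -[n in (_ ^+ n)%R]card_ord -prodr_const -big_split/=.
apply: eq_bigr => i _; rewrite mxE; field.
have h : (0 < 1 + z i ord0 ^+ 2)%R by rewrite ltr_wpDr ?sqr_ge0.
rewrite gt_eqF//=; first by rewrite exprMn -[X in (X + _)%R]mulr1 -mulrDr gt_eqF// mulr_gt0// exprn_gt0.
Qed.

Lemma poissonN (e : R) (z : Rn) : poisson e (- z)%R = poisson e z.
Proof. by apply: eq_bigr => i _; rewrite mxE sqrrN. Qed.

(** The substitution [y = x + e z] moves [e] from the kernel into the argument of [u]. The kernel is
    then fixed as [e] tends to 0, which suits Fatou's lemma. *)
Lemma poisson_substitution u x (e : R) : (0 < e)%R -> measurable_fun setT u ->
  (forall y, 0 <= u y)%R ->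
  \int[leb]_y (u x * u y * poisson e (x - y)%R)%:E =
  \int[leb]_z (u x * u (x + e *: z)%R * poisson 1 z)%:E.
Proof.
move=> e0 mu u0.
pose F (y : Rn) := (u x * u y * poisson e (x - y)%R)%:E.
have mF : measurable_fun setT F.
  apply/measurable_EFinP; apply: measurable_funM; first exact: measurable_funM.
  by apply: (@measurable_poisson R _ Rn n e (fun y : Rn => x - y)%R e0); apply: measurable_submx.
have F0 y : 0 <= F y by rewrite lee_fin !mulr_ge0// poisson_ge0// ltW.
have en0 : (0 < e ^+ n)%R by rewrite exprn_gt0.
have sc := scales_lebesgue_comp (scales_shift x) (scales_scale n (lt0r_neq0 e0)).
have h := ge0_integral_scales sc mF F0.
transitivity ((e ^+ n)%:E * ((e ^- n)%:E * \int[leb]_y F y)).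
  by rewrite muleA -EFinM divff ?gt_eqF// mul1e.
move: h; rewrite mul1r gtr0_norm// => <-.
rewrite -ge0_integralZl_EFin; last 4 first.
- exact: measurableT.
- by move=> z _; exact: F0.
- by have [mphi _ _] := sc; exact: (measurableT_comp mF mphi).
- exact: ltW.
apply: eq_integral => z _; rewrite /F /= -EFinM; congr EFin.
rewrite -(poisson_scale z e0) (_ : x - (e *: z + x) = - (e *: z))%R; last first.
  by rewrite opprD addrCA subrr addr0.
by rewrite poissonN [(e *: z + x)%R]addrC; ring.
Qed.

Lemma integral_damp_fsq u (e : R) : (0 < e)%R -> leb.-integrable setT (EFin \o u) ->
  (forall y, 0 <= u y)%R ->
  \int[leb]_w (damp e w * fsq u w)%:E =
  \int[leb]_z ((poisson 1 z)%:E * autocorr u (e *: z)%R).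
Proof.
move=> e0 iu u0; have mu := integrable_measurable iu.
have [i1 i2 i3 E] := damp_fsq e0 iu.
rewrite -EFin_Rintegral// E (EFin_Rintegral i2).
transitivity (\int[leb]_x \int[leb]_z (u x * u (x + e *: z)%R * poisson 1 z)%:E).
  apply: eq_integral => x _; rewrite (EFin_Rintegral (i3 x)).
  exact: poisson_substitution.
rewrite (fubini_tonelli (m1 := leb) (m2 := leb)
  (fun p : Rn * Rn => (u p.1 * u (p.1 + e *: p.2)%R * poisson 1 p.2)%:E)); last 2 first.
- apply/measurable_EFinP; apply: measurable_funM; last exact: measurable_poisson.
  apply: measurable_funM; first exact: (measurableT_comp mu).
  apply: (measurableT_comp mu); apply: measurable_addmx => //.
  exact: measurable_scalemx.
- by move=> p; rewrite lee_fin !mulr_ge0// poisson_ge0.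
apply: eq_integral => z _ /=.
rewrite /autocorr -ge0_integralZl_EFin; last 4 first.
- exact: measurableT.
- by move=> x _; rewrite lee_fin mulr_ge0.
- by apply/measurable_EFinP; apply: measurable_funM => //; exact: measurable_shifted.
- exact: poisson_ge0.
by apply: eq_integral => x _; rewrite -EFinM mulrC.
Qed.

Lemma autocorr_le u t : measurable_fun setT u ->
  (forall y, 0 <= u y)%R -> autocorr u t <= \int[leb]_x (u x ^+ 2)%:E.
Proof.
move=> mu u0; have mut := measurable_shifted t mu.
have m2 v : measurable_fun setT v -> measurable_fun setT (fun x => (v x ^+ 2)%:E).
  by move=> mv; apply/measurable_EFinP; exact: measurable_funX.
have h : \int[leb]_x (u (x + t)%R ^+ 2)%:E = \int[leb]_x (u x ^+ 2)%:E.
  by rewrite (integral_cV_shift t (m2 _ mu))// => x; rewrite lee_fin sqr_ge0.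
apply: (@le_trans _ _ (\int[leb]_x (2^-1%:E * ((u x ^+ 2)%:E + (u (x + t)%R ^+ 2)%:E)))).
  apply: ge0_le_integral => //.
  - by move=> x _; rewrite lee_fin mulr_ge0.
  - by apply/measurable_EFinP; apply: measurable_funM.
  - by apply: measurable_funeM; apply: emeasurable_funD; exact: m2.
  move=> x _; rewrite -EFinD -EFinM lee_fin.
  by have := sqr_ge0 (u x - u (x + t))%R; rewrite sqrrB; lra.
rewrite ge0_integralZl_EFin//; last 2 first.
- by move=> x _; rewrite -EFinD lee_fin addr_ge0// sqr_ge0.
- by apply: emeasurable_funD; exact: m2.
rewrite ge0_integralD//; last 4 first.
- by move=> x _; rewrite lee_fin sqr_ge0.
- exact: m2.
- by move=> x _; rewrite lee_fin sqr_ge0.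
- exact: m2.
rewrite h; set I := \int[leb]_x (u x ^+ 2)%:E.
have I0 : 0 <= I by apply: integral_ge0 => x _; rewrite lee_fin sqr_ge0.
rewrite ge0_muleDr// -ge0_muleDl ?lee_fin// -EFinD (_ : 2^-1 + 2^-1 = 1)%R; last by lra.
by rewrite mul1e.
Qed.

End plancherel.

Lemma measurable_limn_einf d (T : measurableType d) (R : realType)
    (f : nat -> T -> \bar R) : (forall k, measurable_fun setT (f k)) ->
  measurable_fun setT (fun x => limn_einf (f ^~ x)).
Proof.
move=> mf; rewrite /limn_einf; apply: measurableT_comp => //.
by apply: measurable_fun_limn_esup => k; exact: measurableT_comp.
Qed.

(** * From sets to functions by layers *)

Section layer_cake.
Variables (R : realType) (n : nat).
Local Notation leb := (lebesgue_cV R n).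
Local Notation Rn := 'cV[R]_n.
Implicit Types (u v : Rn -> R).
Local Open Scope ereal_scope.

Let below v : set (measurableTypeR R * Rn) := [set p | (0 <= p.1 < v p.2)%R].

Let measurable_below v : measurable_fun setT v -> measurable (below v).
Proof.
move=> mv.
have -> : below v = ((fun p => v p.2 - p.1)%R @^-1` `]0%R, +oo[) `&` (fst @^-1` `[0%R, +oo[).
  apply/seteqP; split => -[s x]; rewrite /below/= !in_itv/= !andbT subr_gt0.
    by move=> /andP[].
  by move=> [-> ->].
apply: measurableI; rewrite -[X in measurable X]setTI; last exact: measurable_fst.
have mm : measurable_fun setT (fun p : measurableTypeR R * Rn => v p.2 - p.1)%R.
  by apply: measurable_funB; [exact: (measurableT_comp mv)|exact: measurable_fst].
exact: mm.
Qed.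

Let integral_below v x y :
  (0 <= v x)%R -> (0 <= v y)%R ->
  \int[@lebesgue_measure R]_s (\1_(below v) (s, x) * \1_(below v) (s, y))%:E =
  (Num.min (v x) (v y))%:E.
Proof.
move=> vx0 vy0; set m := Num.min _ _.
have m0 : (0 <= m)%R by rewrite le_min vx0.
transitivity (\int[@lebesgue_measure R]_s (\1_(`[0%R, m[%classic) s)%:E).
  have memB y' s : ((s, y') \in below v) = (0 <= s < v y')%R.
    by apply/idP/idP => [/set_mem|h]//; exact/mem_set.
  apply: eq_integral => s _; congr EFin; rewrite !indicE -natrM mulnb !memB.
  congr ((nat_of_bool _)%:R)%R.
  by rewrite mem_setE in_itv/= lt_min; case: (0 <= s)%R.
have -> : \int[@lebesgue_measure R]_s (\1_(`[0%R, m[%classic) s)%:E =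
    lebesgue_measure (`[0%R, m[%classic : set R).
  by rewrite integral_indic ?setIT//; exact: measurable_itv.
rewrite lebesgue_measure_itv/= lte_fin.
case: ltP => [_|m0']; first by rewrite oppr0 adde0.
by congr EFin; apply/eqP; rewrite eq_le m0 m0'.
Qed.

(** [lebesgue_shift_liminf] applies to each superlevel set of [u ^+ 2], and Fatou integrates over
    the levels [s]. This gives the minimum of the squares at [x] and at its translate, which is at
    most the product of the two values of [u]. *)
Lemma autocorr_liminf u z : measurable_fun setT u -> (forall y, 0 <= u y)%R ->
  \int[leb]_x (u x ^+ 2)%:E <= limn_einf (fun k => autocorr u (k.+1%:R^-1 *: z)%R).
Proof.
move=> mu u0; pose v x := (u x ^+ 2)%R.
have v0 x : (0 <= v x)%R by exact: sqr_ge0.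
have mv : measurable_fun setT v by exact: measurable_funX.
have mB := measurable_below mv.
have mI (h : Rn -> Rn) : measurable_fun setT h -> measurable_fun setT
    (fun p : measurableTypeR R * Rn => \1_(below v) (p.1, h p.2) : R).
  move=> mh; apply: (measurableT_comp (measurable_indic mB)).
  apply: measurable_fun_pair => //; exact: (measurableT_comp mh).
have msh k : measurable_fun setT (fun x : Rn => x + k.+1%:R^-1 *: z)%R.
  by apply: measurable_addmx.
pose f k (s : R) := \int[leb]_x (\1_(below v) (s, x) * \1_(below v) (s, x + k.+1%:R^-1 *: z)%R)%:E.
have mf2 k : measurable_fun setT (fun p : measurableTypeR R * Rn =>
    (\1_(below v) (p.1, p.2) * \1_(below v) (p.1, p.2 + k.+1%:R^-1 *: z)%R)%:E : \bar R).
  apply/measurable_EFinP; apply: measurable_funM; first exact: (mI id).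
  exact: (mI (fun x : Rn => x + k.+1%:R^-1 *: z)%R).
have mf1 : measurable_fun setT (fun p : measurableTypeR R * Rn =>
    (\1_(below v) (p.1, p.2))%:E : \bar R).
  by apply/measurable_EFinP; exact: (mI id).
have f0 k s : (setT : set (measurableTypeR R)) s -> 0 <= f k s.
  by move=> _; apply: integral_ge0 => x _; rewrite lee_fin mulr_ge0.
have mf k : measurable_fun setT (f k : measurableTypeR R -> \bar R).
  apply: (measurable_fun_fubini_tonelli_F (m2 := leb) _ (mf2 k)) => p.
  by rewrite lee_fin mulr_ge0.
have below_eq s x : \1_(below v) (s, x) = \1_[set y | below v (s, y)] x :> R.
  exact: indic_iff.
have mbelow (s : measurableTypeR R) : measurable [set y : Rn | below v (s, y)].
  have := @measurable_pair1 _ _ (measurableTypeR R) Rn s measurableT _ mB.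
  by rewrite setTI.
apply: (@le_trans _ _ (\int[@lebesgue_measure R]_s limn_einf (f ^~ s))).
  apply: (@le_trans _ _ (\int[@lebesgue_measure R]_s \int[leb]_x (\1_(below v) (s, x))%:E)).
    rewrite (fubini_tonelli (m1 := @lebesgue_measure R) (m2 := leb)
      (fun p => (\1_(below v) p)%:E)); last 2 first.
    - by apply/measurable_EFinP; exact: measurable_indic.
    - by move=> p; rewrite lee_fin.
    rewrite le_eqVlt; apply/orP; left; apply/eqP; apply: eq_integral => x _.
    have := integral_below (v0 x) (v0 x); rewrite minxx => <-.
    by apply: eq_integral => s _; rewrite !indicE -natrM mulnb andbb.
  apply: ge0_le_integral.
  - exact: measurableT.
  - by move=> s _; apply: integral_ge0 => x _; rewrite lee_fin.
  - exact: (measurable_fun_fubini_tonelli_F (m2 := leb) _ mf1 (fun=> _)).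
  - exact: measurable_limn_einf.
  move=> s _.
  have := lebesgue_shift_liminf z (mbelow s).
  under eq_integral do rewrite -below_eq; move/le_trans; apply.
  by apply: le_limn_einf => k; rewrite /f; under eq_integral do rewrite -!below_eq.
apply: le_trans (fatou _ _ _ _) _.
- exact: measurableT.
- exact: mf.
- exact: f0.
apply: le_limn_einf => k; rewrite /f.
rewrite (fubini_tonelli (m1 := @lebesgue_measure R) (m2 := leb)
    (fun p => (\1_(below v) (p.1, p.2) * \1_(below v) (p.1, p.2 + k.+1%:R^-1 *: z)%R)%:E)); last 2 first.
- exact: mf2.
- by move=> p; rewrite lee_fin mulr_ge0.
apply: ge0_le_integral.
- exact: measurableT.
- by move=> x _; apply: integral_ge0 => s _; rewrite lee_fin mulr_ge0.
- by apply: (measurable_fun_fubini_tonelli_G (m1 := @lebesgue_measure R) _ (mf2 k)) => p; rewrite lee_fin mulr_ge0.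
- by apply/measurable_EFinP; apply: measurable_funM => //; exact: measurable_shifted.
move=> x _ /=; rewrite integral_below// lee_fin /v.
case: (leP (u x) (u (x + k.+1%:R^-1 *: z))%R) => h.
  by rewrite ge_min; apply/orP; left; rewrite expr2 ler_wpM2l.
by rewrite ge_min; apply/orP; right; rewrite expr2 ler_wpM2r// ltW.
Qed.

End layer_cake.

(** * Plancherel's identity for integrable functions *)

Section plancherel_theorem.
Variables (R : realType) (n : nat).
Local Notation leb := (lebesgue_cV R n).
Local Notation Rn := 'cV[R]_n.
Local Notation cst_n := (plancherel_const R n).
Implicit Types (u v : Rn -> R).
Local Open Scope ereal_scope.

Lemma limn_einf_scale (p : R) (a : nat -> \bar R) : (0 <= p)%R ->
  p%:E * limn_einf a <= limn_einf (fun k => p%:E * a k).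
Proof.
move=> p0; rewrite !limn_einf_lim.
have ca : einfs a @ \oo --> limn (einfs a).
  by apply: ereal_nondecreasing_is_cvgn; exact: nondecreasing_einfs.
have cpa : (fun k => p%:E * einfs a k) @ \oo --> p%:E * limn (einfs a).
  by apply: cvgeZl.
rewrite -(cvg_lim _ cpa)//; apply: lee_lim.
- by apply/cvg_ex; eexists; exact: cpa.
- by apply: ereal_nondecreasing_is_cvgn; exact: nondecreasing_einfs.
apply: nearW => k; apply: le_ereal_inf_tmp => _ [m /= km <-].
by apply: lee_wpmul2l; rewrite ?lee_fin//; apply: ereal_inf_lbound; exists m.
Qed.

Lemma dampE (e : R) (w : Rn) : damp e w = expR (- (e * \sum_i `|w i ord0|))%R.
Proof. by rewrite /damp -expR_sum sumrN mulr_sumr. Qed.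

Lemma damp_le1 (e : R) (w : Rn) : (0 <= e)%R -> (damp e w <= 1)%R.
Proof.
move=> e0; rewrite dampE -expR0 ler_expR oppr_le0 mulr_ge0//.
by apply: sumr_ge0 => i _.
Qed.

Lemma cvg_damp (w : Rn) : (fun k => damp k.+1%:R^-1 w) @ \oo --> (1%R : R).
Proof.
pose S : R := (- \sum_i `|w i ord0|)%R.
have h : (fun k => expR (k.+1%:R^-1 * S)%R) @ \oo --> expR (0 * S)%R.
  apply: continuous_cvg; first exact: continuous_expR.
  by apply: cvgMl; exact: cvg_harmonic.
rewrite (_ : (fun k => _) = (fun k => expR (k.+1%:R^-1 * S)%R)); last first.
  by apply/funext => k; rewrite dampE -mulrN.
by move: h; rewrite mul0r expR0.
Qed.

Lemma plancherel_ge0 u : leb.-integrable setT (EFin \o u) -> (forall y, 0 <= u y)%R ->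
  \int[leb]_w (fsq u w)%:E = cst_n%:E * \int[leb]_x (u x ^+ 2)%:E.
Proof.
move=> iu u0; have mu := integrable_measurable iu.
have c0 : (0 <= cst_n)%R by apply: ltW; exact: plancherel_const_gt0.
have e0 k : (0 < k.+1%:R^-1 :> R)%R by rewrite invr_gt0.
have mfs := measurable_fsq mu.
have mdf k : measurable_fun setT (fun w : Rn => (damp k.+1%:R^-1 w * fsq u w)%:E).
  by apply/measurable_EFinP; apply: measurable_funM => //; exact: measurable_damp.
have df0 k (w : Rn) : 0 <= (damp k.+1%:R^-1 w * fsq u w)%:E.
  by rewrite lee_fin mulr_ge0 ?damp_ge0 ?fsq_ge0.
have mac k : measurable_fun setT (fun z : Rn => autocorr u (k.+1%:R^-1 *: z)%R).
  apply: (measurable_fun_fubini_tonelli_F (m2 := leb)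
     (fun p : Rn * Rn => (u p.2 * u (p.2 + k.+1%:R^-1 *: p.1)%R)%:E)).
    apply/measurable_EFinP; apply: measurable_funM; first exact: (measurableT_comp mu).
    apply: (measurableT_comp mu); apply: measurable_addmx => //.
    exact: measurable_scalemx.
  by move=> p; rewrite lee_fin mulr_ge0.
have ac0 k (z : Rn) : 0 <= autocorr u (k.+1%:R^-1 *: z)%R.
  by apply: integral_ge0 => x _; rewrite lee_fin mulr_ge0.
have mpac k : measurable_fun setT (fun z : Rn => (poisson 1 z)%:E * autocorr u (k.+1%:R^-1 *: z)%R).
  apply: emeasurable_funM => //; apply/measurable_EFinP; exact: measurable_poisson.
have pac0 k (z : Rn) : 0 <= (poisson 1 z)%:E * autocorr u (k.+1%:R^-1 *: z)%R.
  by rewrite mule_ge0// lee_fin poisson_ge0.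
have mp : measurable_fun setT (fun z : Rn => (poisson 1 z)%:E).
  by apply/measurable_EFinP; exact: measurable_poisson.
have U0 : 0 <= \int[leb]_x (u x ^+ 2)%:E.
  by apply: integral_ge0 => x _; rewrite lee_fin sqr_ge0.
have intc : \int[leb]_z ((poisson 1 z)%:E * \int[leb]_x (u x ^+ 2)%:E) =
    cst_n%:E * \int[leb]_x (u x ^+ 2)%:E.
  rewrite ge0_integralZr.
  - by rewrite integral_poisson.
  - exact: measurableT.
  - exact: mp.
  - by move=> z _; rewrite lee_fin poisson_ge0.
  - exact: U0.
apply/eqP; rewrite eq_le; apply/andP; split.
(* Fatou removes the damping, and each damped integral is already bounded, since no autocorrelation
   exceeds the integral of [u ^+ 2]. *)
- apply: (@le_trans _ _ (\int[leb]_w limn_einf (fun k => (damp k.+1%:R^-1 w * fsq u w)%:E))).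
    apply: ge0_le_integral.
    + exact: measurableT.
    + by move=> w _; rewrite lee_fin fsq_ge0.
    + by apply/measurable_EFinP.
    + exact: (measurable_limn_einf mdf).
    + move=> w _.
      have /cvg_limn_einf_sup[-> _] // :
          (fun k => (damp k.+1%:R^-1 w * fsq u w)%:E) @ \oo --> (fsq u w)%:E.
      apply: cvg_EFin; first by apply: nearW.
      rewrite -[X in _ --> X](mul1r (fsq u w)).
      by apply: cvgMl; exact: cvg_damp.
  apply: le_trans (fatou _ _ _ _) _.
  + exact: measurableT.
  + exact: mdf.
  + by move=> k w _; exact: df0.
  apply: limn_einf_le => k; rewrite (integral_damp_fsq (e0 k) iu u0) -intc.
  apply: ge0_le_integral.
  + exact: measurableT.
  + by move=> z _; exact: pac0.
  + exact: mpac.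
  + by apply: emeasurable_funM => //.
  + move=> z _; apply: lee_wpmul2l; first by rewrite lee_fin poisson_ge0.
    exact: autocorr_le.
rewrite -intc.
(* Fatou is now applied in [z], to the autocorrelations under the fixed kernel; the damped integrals
   obtained are below the undamped one because [damp] is at most 1. *)
apply: (@le_trans _ _ (\int[leb]_z limn_einf (fun k => (poisson 1 z)%:E * autocorr u (k.+1%:R^-1 *: z)%R))).
  apply: ge0_le_integral.
  + exact: measurableT.
  + by move=> z _; rewrite mule_ge0// lee_fin poisson_ge0.
  + by apply: emeasurable_funM => //.
  + exact: (measurable_limn_einf mpac).
  + move=> z _; apply: le_trans (limn_einf_scale _ (poisson_ge0 _ ler01)).
    apply: lee_wpmul2l; first by rewrite lee_fin poisson_ge0.
    exact: autocorr_liminf.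
apply: le_trans (fatou _ _ _ _) _.
- exact: measurableT.
- exact: mpac.
- by move=> k z _; exact: pac0.
apply: limn_einf_le => k; rewrite -(integral_damp_fsq (e0 k) iu u0).
apply: ge0_le_integral.
- exact: measurableT.
- by move=> w _; exact: df0.
- exact: mdf.
- by apply/measurable_EFinP.
- by move=> w _; rewrite lee_fin ler_piMl ?fsq_ge0// damp_le1// ltW.
Qed.

(** The nonnegative case covers the positive part [a], the negative part [b] and their sum [s], the
    absolute value of [u]. The parallelogram law for the transforms of [a + b] and [a - b] then
    gives [u], as [a b = 0] makes the squares of [u] and [s] agree. *)
Lemma plancherel u : leb.-integrable setT (EFin \o u) ->
  \int[leb]_x (u x ^+ 2)%:E < +oo ->
  \int[leb]_w (fsq u w)%:E = cst_n%:E * \int[leb]_x (u x ^+ 2)%:E.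
Proof.
move=> iu uoo; have mu := integrable_measurable iu.
pose a x : R := Num.max (u x) 0%R; pose b x : R := Num.max (- u x)%R 0%R.
have a0 x : (0 <= a x)%R by rewrite le_max lexx orbT.
have b0 x : (0 <= b x)%R by rewrite le_max lexx orbT.
have uab x : (u x = a x + (- 1) * b x)%R.
  by rewrite /a /b; case: (leP (u x) 0%R) => h1; case: (leP (- u x)%R 0%R) => h2; lra.
have ia : leb.-integrable setT (EFin \o a).
  apply: (integrable_le _ _ iu); first exact: measurable_maxr.
  move=> x; rewrite ger0_norm// /a; case: (leP (u x) 0%R) => // h.
  exact: ler_norm.
have ib : leb.-integrable setT (EFin \o b).
  apply: (integrable_le _ _ iu).
    by apply: measurable_maxr => //; exact: measurableT_comp.
  move=> x; rewrite ger0_norm// /b; case: (leP (- u x)%R 0%R) => // h.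
  by rewrite -normrN ler_norm.
pose s x := (a x + b x)%R.
have s0 x : (0 <= s x)%R by exact: addr_ge0.
have is_ : leb.-integrable setT (EFin \o s) by exact: integrable_add.
have ab0 x : (a x * b x = 0)%R.
  rewrite /a /b; case: (leP (u x) 0%R) => h1; rewrite ?mul0r//.
  by case: (leP (- u x)%R 0%R) => h2; rewrite ?mulr0//; move: h1 h2; rewrite oppr_gt0 => /lt_trans/[apply]; rewrite ltxx.
have inb : leb.-integrable setT (EFin \o (fun x => (- 1) * b x)%R) by exact: integrable_scale.
have fsqE w : (fsq u w + fsq s w = 2 * fsq a w + 2 * fsq b w)%R.
  have -> : u = (fun x => a x + (- 1) * b x)%R by apply/funext.
  by rewrite /fsq fcosD// fsinD// fcosZ// fsinZ// fcosD// fsinD//; ring.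
have PS := plancherel_ge0 is_ s0.
have PA := plancherel_ge0 ia a0.
have PB := plancherel_ge0 ib b0.
have uu x : (u x ^+ 2 = s x ^+ 2)%R.
  rewrite uab /s; have := ab0 x; move: (a x) (b x) => p q pq.
  have -> : ((p + -1 * q) ^+ 2 = (p + q) ^+ 2 - 4 * (p * q))%R by ring.
  by rewrite pq mulr0 subr0.
have uab2 x : (u x ^+ 2 = a x ^+ 2 + b x ^+ 2)%R.
  by rewrite uu /s sqrrD (ab0 x) mul0rn addr0.
have mfsq v : leb.-integrable setT (EFin \o v) -> measurable_fun setT (fun w => (fsq v w)%:E).
  move=> iv; apply/measurable_EFinP; apply: measurable_fsq; exact: (integrable_measurable iv).
have msq v : leb.-integrable setT (EFin \o v) -> measurable_fun setT (fun w => (v w ^+ 2)%:E).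
  move=> iv; apply/measurable_EFinP; apply: measurable_funX; exact: (integrable_measurable iv).
have sumE : \int[leb]_w (fsq u w)%:E + \int[leb]_w (fsq s w)%:E =
    2%:E * \int[leb]_w (fsq a w)%:E + 2%:E * \int[leb]_w (fsq b w)%:E.
  rewrite -ge0_integralD; last 5 first.
  - exact: measurableT.
  - by move=> w _; rewrite lee_fin fsq_ge0.
  - exact: mfsq.
  - by move=> w _; rewrite lee_fin fsq_ge0.
  - exact: mfsq.
  rewrite -ge0_integralZl_EFin; last 4 first.
  - exact: measurableT.
  - by move=> w _; rewrite lee_fin fsq_ge0.
  - exact: mfsq.
  - by [].
  rewrite -ge0_integralZl_EFin; last 4 first.
  - exact: measurableT.
  - by move=> w _; rewrite lee_fin fsq_ge0.
  - exact: mfsq.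
  - by [].
  rewrite -ge0_integralD; last 5 first.
  - exact: measurableT.
  - by move=> w _; rewrite -EFinM lee_fin mulr_ge0// fsq_ge0.
  - by apply: measurable_funeM; exact: mfsq.
  - by move=> w _; rewrite -EFinM lee_fin mulr_ge0// fsq_ge0.
  - by apply: measurable_funeM; exact: mfsq.
  by apply: eq_integral => w _; rewrite -!EFinM -!EFinD fsqE.
have sq_sum : \int[leb]_x (u x ^+ 2)%:E = \int[leb]_x (a x ^+ 2)%:E + \int[leb]_x (b x ^+ 2)%:E.
  rewrite -ge0_integralD; last 5 first.
  - exact: measurableT.
  - by move=> w _; rewrite lee_fin sqr_ge0.
  - exact: msq.
  - by move=> w _; rewrite lee_fin sqr_ge0.
  - exact: msq.
  by apply: eq_integral => x _; rewrite -EFinD uab2.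
have sq_s : \int[leb]_x (s x ^+ 2)%:E = \int[leb]_x (u x ^+ 2)%:E.
  by apply: eq_integral => x _; rewrite uu.
move: sumE; rewrite PS PA PB sq_s; move: sq_sum uoo.
have : 0 <= \int[leb]_x (a x ^+ 2)%:E by apply: integral_ge0 => x _; rewrite lee_fin sqr_ge0.
have : 0 <= \int[leb]_x (b x ^+ 2)%:E by apply: integral_ge0 => x _; rewrite lee_fin sqr_ge0.
move: (\int[leb]_x (a x ^+ 2)%:E) (\int[leb]_x (b x ^+ 2)%:E) (\int[leb]_x (u x ^+ 2)%:E).
move: (\int[leb]_w (fsq u w)%:E).
(* Finiteness of the integral of [u ^+ 2] is what allows the term of [s] to be subtracted. *)
move=> [X| |] [A| |] [B| |] [U| |] //= _ _ [] UE _; rewrite -!EFinM -?EFinD => -[] XE.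
by congr EFin; rewrite UE in XE *; lra.
Qed.

End plancherel_theorem.

(** * Clifford-valued functions *)

Section clifford_measurable.
Context d (T : measurableType d) (R : realType) (n : nat).
Local Notation Cl := (clifford R n).
Implicit Types f g : T -> Cl.

Definition cl_measurable f : Prop := forall A, measurable_fun setT (fun x => f x A).

Lemma cl_measurable_cst (M : Cl) : cl_measurable (fun=> M).
Proof. by move=> A; exact: measurable_cst. Qed.

Lemma cl_measurableD f g : cl_measurable f -> cl_measurable g ->
  cl_measurable (fun x => f x + g x).
Proof.
move=> mf mg A; under eq_fun do rewrite cl_addE.
by apply: measurable_funD; [exact: mf|exact: mg].
Qed.

Lemma cl_measurableB f g : cl_measurable f -> cl_measurable g ->
  cl_measurable (fun x => f x - g x).
Proof.
move=> mf mg A; under eq_fun do rewrite cl_subE.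
by apply: measurable_funB; [exact: mf|exact: mg].
Qed.

Lemma cl_measurableZ (a : T -> R) f : measurable_fun setT a -> cl_measurable f ->
  cl_measurable (fun x => a x *: f x).
Proof.
move=> ma mf A; under eq_fun do rewrite cl_scaleE.
by apply: measurable_funM => //; exact: mf.
Qed.

Lemma cl_measurableM f g : cl_measurable f -> cl_measurable g ->
  cl_measurable (fun x => f x * g x).
Proof.
move=> mf mg C; under eq_fun do rewrite cl_coefM.
apply: measurable_sum => A; apply: measurable_funM; last exact: mg.
by apply: measurable_funM => //; exact: mf.
Qed.

Lemma cl_measurable_rev f : cl_measurable f -> cl_measurable (fun x => cl_rev (f x)).
Proof.
move=> mf A; under eq_fun do rewrite cl_rev_coef.
by apply: measurable_funM => //; exact: mf.
Qed.

Lemma measurable_cl_scalar f : cl_measurable f -> measurable_fun setT (fun x => cl_scalar (f x)).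
Proof. by move=> mf; exact: mf. Qed.

Lemma measurable_cl_sqnorm f : cl_measurable f -> measurable_fun setT (fun x => cl_sqnorm (f x)).
Proof.
move=> mf; under eq_fun do rewrite cl_sqnormE.
by apply: measurable_sum => A; apply: measurable_funX; exact: mf.
Qed.

Lemma cl_measurable_comp d' (T' : measurableType d') (phi : T' -> T) f :
  measurable_fun setT phi -> cl_measurable f ->
  forall A, measurable_fun setT (fun x => f (phi x) A).
Proof. by move=> mphi mf A; exact: (measurableT_comp (mf A) mphi). Qed.

End clifford_measurable.

Section clifford_integral.
Context d (T : measurableType d) (R : realType) (n : nat).
Variable mu : {measure set T -> \bar R}.
Local Notation Cl := (clifford R n).
Implicit Types (f g : T -> Cl) (M N : Cl).

Lemma cl_integrable_measurable f : cl_integrable mu f -> cl_measurable f.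
Proof. by move=> fi A; exact: integrable_measurable (fi A). Qed.

Lemma cl_integrableB f g : cl_integrable mu f -> cl_integrable mu g ->
  cl_integrable mu (fun x => f x - g x).
Proof.
move=> fi gi A; have := integrable_sub (fi A) (gi A).
by congr (mu.-integrable _ _); apply/funext => x /=; rewrite cl_subE.
Qed.

Lemma integrable_sum_real (I : finType) (F : I -> T -> R) :
  (forall i, mu.-integrable setT (EFin \o F i)) ->
  mu.-integrable setT (EFin \o (fun x => \sum_i F i x)).
Proof.
move=> iF; rewrite (_ : _ \o _ = (fun x => \sum_(i <- index_enum I) (EFin \o F i) x)%E).
  by apply: integrable_sum => // i _; exact: iF.
by apply/funext => x; rewrite /= sumEFin.
Qed.

Lemma Rintegral_sum (I : finType) (F : I -> T -> R) :
  (forall i, mu.-integrable setT (EFin \o F i)) ->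
  \int[mu]_x (\sum_i F i x) = \sum_i \int[mu]_x F i x.
Proof.
move=> iF; apply: EFin_inj; rewrite EFin_Rintegral; last exact: integrable_sum_real.
rewrite -sumEFin; under eq_integral do rewrite -sumEFin.
rewrite integral_sum//; first by apply: eq_bigr => i _; rewrite EFin_Rintegral.
Qed.

Lemma cl_integrable_mul M f N : cl_integrable mu f ->
  cl_integrable mu (fun x => M * f x * N).
Proof.
have mulr (g : T -> Cl) P : cl_integrable mu g -> cl_integrable mu (fun x => g x * P).
  move=> gi C; rewrite (_ : (fun x => _) = (EFin \o (fun x => \sum_A
      (cl_sign R A (symd A C) * P (symd A C)) * g x A))).
    by apply: integrable_sum_real => A; apply: integrable_scale; exact: gi.
  by apply/funext => x /=; rewrite cl_coefM; congr EFin; apply: eq_bigr => A _; ring.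
have mull (g : T -> Cl) P : cl_integrable mu g -> cl_integrable mu (fun x => P * g x).
  move=> gi C; rewrite (_ : (fun x => _) = (EFin \o (fun x => \sum_A
      (cl_sign R A (symd A C) * P A) * g x (symd A C)))).
    by apply: integrable_sum_real => A; apply: integrable_scale; exact: gi.
  by apply/funext => x /=; rewrite cl_coefM.
by move=> fi; apply: mulr; exact: mull.
Qed.

Lemma cl_integral_mul M f N : cl_integrable mu f ->
  cl_integral mu (fun x => M * f x * N) = M * cl_integral mu f * N.
Proof.
have mulr (g : T -> Cl) P : cl_integrable mu g ->
    cl_integral mu (fun x => g x * P) = cl_integral mu g * P.
  move=> gi; apply/ffunP => C; rewrite cl_coefM ffunE.
  rewrite (@eq_Rintegral _ _ R mu setT (fun x => \sum_A
      (cl_sign R A (symd A C) * P (symd A C)) * g x A)); last first.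
    by move=> x _; rewrite cl_coefM; apply: eq_bigr => A _; ring.
  rewrite Rintegral_sum; last by move=> A; apply: integrable_scale; exact: gi.
  apply: eq_bigr => A _; rewrite RintegralZl//; last exact: gi.
  by rewrite [in RHS]ffunE; ring.
have mull (g : T -> Cl) P : cl_integrable mu g ->
    cl_integral mu (fun x => P * g x) = P * cl_integral mu g.
  move=> gi; apply/ffunP => C; rewrite cl_coefM ffunE.
  rewrite (@eq_Rintegral _ _ R mu setT (fun x => \sum_A
      (cl_sign R A (symd A C) * P A) * g x (symd A C))); last first.
    by move=> x _; rewrite cl_coefM.
  rewrite Rintegral_sum; last by move=> A; apply: integrable_scale; exact: gi.
  apply: eq_bigr => A _; rewrite RintegralZl//; last exact: gi.
  by rewrite [in RHS]ffunE.
move=> fi; rewrite mulr ?mull//.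
have := cl_integrable_mul M 1 fi; congr (cl_integrable mu _).
by apply/funext => x; rewrite mulr1.
Qed.

Lemma cl_integrableMr f N : cl_integrable mu f -> cl_integrable mu (fun x => f x * N).
Proof.
move=> /(cl_integrable_mul 1 N); congr (cl_integrable mu _).
by apply/funext => x; rewrite mul1r.
Qed.

Lemma cl_integralMr f N : cl_integrable mu f ->
  cl_integral mu (fun x => f x * N) = cl_integral mu f * N.
Proof.
move=> /(cl_integral_mul 1 N); rewrite mul1r => <-; congr (cl_integral mu _).
by apply/funext => x; rewrite mul1r.
Qed.

Lemma cl_integralD f g : cl_integrable mu f -> cl_integrable mu g ->
  cl_integral mu (fun x => f x + g x) = cl_integral mu f + cl_integral mu g.
Proof.
move=> fi gi; apply/ffunP => A; rewrite cl_addE !ffunE.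
rewrite (@eq_Rintegral _ _ R mu setT (fun x => f x A + g x A)); last first.
  by move=> x _; rewrite cl_addE.
by rewrite RintegralD//; [exact: fi|exact: gi].
Qed.

Lemma cl_integralB f g : cl_integrable mu f -> cl_integrable mu g ->
  cl_integral mu (fun x => f x - g x) = cl_integral mu f - cl_integral mu g.
Proof.
move=> fi gi; apply/ffunP => A; rewrite cl_subE !ffunE.
rewrite (@eq_Rintegral _ _ R mu setT (fun x => f x A - g x A)); last first.
  by move=> x _; rewrite cl_subE.
by rewrite RintegralB//; [exact: fi|exact: gi].
Qed.

Lemma cl_integral_rev f : cl_integrable mu f ->
  cl_integral mu (fun x => cl_rev (f x)) = cl_rev (cl_integral mu f).
Proof.
move=> fi; apply/ffunP => A; rewrite cl_rev_coef !ffunE.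
rewrite (@eq_Rintegral _ _ R mu setT (fun x => cl_sign R A A * f x A)); last first.
  by move=> x _; rewrite cl_rev_coef.
by rewrite RintegralZl//; exact: fi.
Qed.

End clifford_integral.

(** * Square-integrable Clifford-valued functions *)

Section clifford_L2.
Context d (T : measurableType d) (R : realType) (n : nat).
Variable mu : {measure set T -> \bar R}.
Local Notation Cl := (clifford R n).
Implicit Types (f g : T -> Cl) (M N : Cl).
Local Open Scope ereal_scope.

Lemma measurable_sqnormE f : cl_measurable f ->
  measurable_fun setT (fun x => (cl_sqnorm (f x))%:E).
Proof. by move=> mf; apply/measurable_EFinP; exact: measurable_cl_sqnorm. Qed.

Lemma cl_normL2_ge0 f : 0 <= cl_normL2 mu f.
Proof. by apply: integral_ge0 => x _; rewrite lee_fin cl_sqnorm_ge0. Qed.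

Lemma cl_normL2_le (k : R) f g : (0 <= k)%R -> cl_measurable f -> cl_measurable g ->
  (forall x, cl_sqnorm (f x) <= k * cl_sqnorm (g x))%R ->
  cl_normL2 mu f <= k%:E * cl_normL2 mu g.
Proof.
move=> k0 mf mg fg; rewrite /cl_normL2 -ge0_integralZl_EFin//; last 2 first.
- by move=> x _; rewrite lee_fin cl_sqnorm_ge0.
- exact: measurable_sqnormE.
apply: ge0_le_integral => //.
- by move=> x _; rewrite lee_fin cl_sqnorm_ge0.
- exact: measurable_sqnormE.
- by apply: measurable_funeM; exact: measurable_sqnormE.
- by move=> x _; rewrite -EFinM lee_fin.
Qed.

Lemma cl_normL2D_le (k l : R) f g (h : T -> Cl) : (0 <= k)%R -> (0 <= l)%R ->
  cl_measurable f -> cl_measurable g -> cl_measurable h ->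
  (forall x, cl_sqnorm (h x) <= k * cl_sqnorm (f x) + l * cl_sqnorm (g x))%R ->
  cl_normL2 mu h <= k%:E * cl_normL2 mu f + l%:E * cl_normL2 mu g.
Proof.
move=> k0 l0 mf mg mh hfg.
rewrite /cl_normL2 -ge0_integralZl_EFin//; last 2 first.
- by move=> x _; rewrite lee_fin cl_sqnorm_ge0.
- exact: measurable_sqnormE.
rewrite -ge0_integralZl_EFin//; last 2 first.
- by move=> x _; rewrite lee_fin cl_sqnorm_ge0.
- exact: measurable_sqnormE.
rewrite -ge0_integralD//; last 4 first.
- by move=> x _; rewrite -EFinM lee_fin mulr_ge0// cl_sqnorm_ge0.
- by apply: measurable_funeM; exact: measurable_sqnormE.
- by move=> x _; rewrite -EFinM lee_fin mulr_ge0// cl_sqnorm_ge0.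
- by apply: measurable_funeM; exact: measurable_sqnormE.
apply: ge0_le_integral => //.
- by move=> x _; rewrite lee_fin cl_sqnorm_ge0.
- exact: measurable_sqnormE.
- by apply: emeasurable_funD; apply: measurable_funeM; exact: measurable_sqnormE.
- by move=> x _; rewrite -!EFinM -EFinD lee_fin.
Qed.

Lemma cl_sqnormD_le2 M N :
  (cl_sqnorm (M + N) <= 2 * cl_sqnorm M + 2 * cl_sqnorm N)%R.
Proof. by have := @cl_sqnormD_le R n M N 1 ltr01; rewrite invr1. Qed.

Lemma cl_sqnormB_le2 M N :
  (cl_sqnorm (M - N) <= 2 * cl_sqnorm M + 2 * cl_sqnorm N)%R.
Proof. by rewrite -[cl_sqnorm N]cl_sqnormN; exact: cl_sqnormD_le2. Qed.

Lemma cl_L2D f g : cl_L2 mu f -> cl_L2 mu g -> cl_L2 mu (fun x => f x + g x)%R.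
Proof.
move=> [mf fo] [mg go]; have mfg := cl_measurableD mf mg; split; first exact: mfg.
have two : (0 <= 2 :> R)%R by [].
apply: (le_lt_trans (@cl_normL2D_le 2%R 2%R f g _ two two mf mg mfg _)).
  by move=> x; exact: cl_sqnormD_le2.
apply: lte_add_pinfty; apply: lte_mul_pinfty; [exact: two|by []|exact: fo|exact: two|by []|exact: go].
Qed.

Lemma cl_L2B f g : cl_L2 mu f -> cl_L2 mu g -> cl_L2 mu (fun x => f x - g x)%R.
Proof.
move=> [mf fo] [mg go]; have mfg := cl_measurableB mf mg; split; first exact: mfg.
have two : (0 <= 2 :> R)%R by [].
apply: (le_lt_trans (@cl_normL2D_le 2%R 2%R f g _ two two mf mg mfg _)).
  by move=> x; exact: cl_sqnormB_le2.
apply: lte_add_pinfty; apply: lte_mul_pinfty; [exact: two|by []|exact: fo|exact: two|by []|exact: go].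
Qed.

Lemma cl_L2_mul M f N : cl_L2 mu f -> cl_L2 mu (fun x => M * f x * N)%R.
Proof.
move=> [mf fo].
have mMfN : cl_measurable (fun x => M * f x * N)%R.
  by apply: cl_measurableM; [apply: cl_measurableM => //|]; exact: cl_measurable_cst.
split; first exact: mMfN.
have [K K0 KM] : exists2 K : R, (0 <= K)%R & forall P Q : Cl, (cl_sqnorm (P * Q) <= K * cl_sqnorm P * cl_sqnorm Q)%R.
  by exists (#|{set 'I_n}|%:R)%R => // P Q; exact: cl_sqnormM_le.
have k0 : (0 <= K * (K * cl_sqnorm M) * cl_sqnorm N)%R.
  by rewrite !mulr_ge0 ?cl_sqnorm_ge0.
apply: (le_lt_trans (@cl_normL2_le (K * (K * cl_sqnorm M) * cl_sqnorm N)%R _ f k0 mMfN mf _)).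
  move=> x; apply: (le_trans (KM _ _)); rewrite [leRHS]mulrAC ler_wpM2r ?cl_sqnorm_ge0//.
  by rewrite -!mulrA ler_wpM2l// mulrA KM.
apply: lte_mul_pinfty; [by rewrite lee_fin|by []|exact: fo].
Qed.

Lemma integrable_mul_L2 (u v : T -> R) : measurable_fun setT u -> measurable_fun setT v ->
  \int[mu]_x (u x ^+ 2)%:E < +oo -> \int[mu]_x (v x ^+ 2)%:E < +oo ->
  mu.-integrable setT (EFin \o (fun x => u x * v x)%R).
Proof.
move=> mu_ mv u2 v2.
have iu : mu.-integrable setT (EFin \o (fun x => u x ^+ 2)%R).
  by apply: ge0_integrableP => //; [exact: measurable_funX|move=> x; exact: sqr_ge0].
have iv : mu.-integrable setT (EFin \o (fun x => v x ^+ 2)%R).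
  by apply: ge0_integrableP => //; [exact: measurable_funX|move=> x; exact: sqr_ge0].
apply: (integrable_le _ _ (integrable_add iu iv)); first exact: measurable_funM.
move=> x; rewrite [leRHS]ger0_norm ?addr_ge0 ?sqr_ge0// normrM.
rewrite -[(u x ^+ 2)%R]real_normK ?num_real// -[(v x ^+ 2)%R]real_normK ?num_real//.
have := sqr_ge0 (`|u x| - `|v x|)%R; have := mulr_ge0 (normr_ge0 (u x)) (normr_ge0 (v x)).
by rewrite sqrrB; lra.
Qed.

Lemma cl_L2_coef f A : cl_L2 mu f -> \int[mu]_x (f x A ^+ 2)%:E < +oo.
Proof.
move=> [mf]; apply: le_lt_trans; apply: ge0_le_integral => //.
- by move=> x _; rewrite lee_fin sqr_ge0.
- by apply/measurable_EFinP; apply: measurable_funX; exact: mf.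
- exact: measurable_sqnormE.
- by move=> x _; rewrite lee_fin cl_sqnorm_coef.
Qed.

Lemma cl_L2_of_coef f : cl_measurable f ->
  (forall A, \int[mu]_x (f x A ^+ 2)%:E < +oo) -> cl_L2 mu f.
Proof.
move=> mf f2; split => //; rewrite /cl_normL2.
under eq_integral do rewrite cl_sqnormE -sumEFin.
rewrite ge0_integral_sum//.
- by apply: lte_sum_pinfty => A _; exact: f2.
- by move=> A; apply/measurable_EFinP; apply: measurable_funX; exact: mf.
- by move=> A x _; rewrite lee_fin sqr_ge0.
Qed.

Lemma cl_L2_rev f : cl_L2 mu f -> cl_L2 mu (fun x => cl_rev (f x)).
Proof.
move=> [mf fo]; split; first exact: cl_measurable_rev.
by rewrite /cl_normL2; under eq_integral do rewrite cl_sqnorm_rev.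
Qed.

Lemma cl_integrableM_L2 f g : cl_L2 mu f -> cl_L2 mu g ->
  cl_integrable mu (fun x => f x * g x)%R.
Proof.
move=> fL gL C; rewrite (_ : (fun x => _) = EFin \o (fun x => \sum_A
   (cl_sign R A (symd A C) * (f x A * g x (symd A C))))%R).
  apply: integrable_sum_real => A; apply: integrable_scale.
  by apply: integrable_mul_L2; [exact: fL.1|exact: gL.1|exact: cl_L2_coef|exact: cl_L2_coef].
by apply/funext => x /=; rewrite cl_coefM; congr EFin; apply: eq_bigr => A _; rewrite mulrA.
Qed.

Lemma cl_normL2_ae (f g : T -> Cl) : cl_measurable f -> cl_measurable g ->
  {ae mu, forall x, f x = g x} -> cl_normL2 mu f = cl_normL2 mu g.
Proof.
move=> mf mg fg; apply: ge0_ae_eq_integral => //.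
- exact: measurable_sqnormE.
- exact: measurable_sqnormE.
- by move=> x _; rewrite lee_fin cl_sqnorm_ge0.
- by move=> x _; rewrite lee_fin cl_sqnorm_ge0.
- by apply: filterS fg => x -> _.
Qed.

Lemma cl_normL2_eq0 f : cl_measurable f -> cl_normL2 mu f = 0 ->
  {ae mu, forall x, f x = 0%R}.
Proof.
move=> mf f0.
have /(ae_eq_integral_abs mu measurableT (measurable_sqnormE mf)) : 
    \int[mu]_x `|(cl_sqnorm (f x))%:E| = 0.
  by rewrite -[RHS]f0; apply: eq_integral => x _; rewrite gee0_abs// lee_fin cl_sqnorm_ge0.
by apply: filterS => x /(_ I)[]; exact: cl_sqnorm_eq0.
Qed.

(* By |x|^2 <= (1 + t) |y|^2 + (1 + 1/t) |x - y|^2 and its symmetric form. *)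
Lemma cl_normL2_near (f_ : nat -> T -> Cl) f :
  (forall k, cl_measurable (f_ k)) -> cl_L2 mu f ->
  vanishing (fun k => cl_normL2 mu (fun x => f_ k x - f x)%R) ->
  forall e : R, (0 < e)%R -> \forall k \near \oo,
    cl_normL2 mu (f_ k) <= cl_normL2 mu f + e%:E /\
    cl_normL2 mu f <= cl_normL2 mu (f_ k) + e%:E.
Proof.
move=> mf_ [mf fo] vf e e0.
set N := cl_normL2 mu f in fo *.
have N0 : 0 <= N by exact: cl_normL2_ge0.
have [r rE] : exists r : R, N = r%:E by exists (fine N); rewrite fineK// ge0_fin_numE.
have r0 : (0 <= r)%R by move: N0; rewrite rE lee_fin.
(* Chosen so that [t * (r + e) <= e / 2]: the bound [r + e] holds for the norm of [f] and, by the
   first inequality, for that of [f_ k]. *)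
pose t := (e / 2 / (r + e + 1))%R.
have r1 : (0 < r + e + 1)%R by lra.
have t0 : (0 < t)%R by rewrite !divr_gt0.
have tr : (t * (r + e) <= e / 2)%R.
  by rewrite /t mulrAC ler_pdivrMr// ler_wpM2l ?divr_ge0// ?ltW//; lra.
have tr' : (t * r <= e / 2)%R by apply: le_trans tr; rewrite ler_wpM2l ?(ltW t0)//; lra.
have s0 : (0 < e / 2 / (1 + t^-1))%R by rewrite !divr_gt0// addr_gt0// invr_gt0.
have := vf _ s0; apply: filterS => k Dk.
have st : (1 + t^-1)%:E * cl_normL2 mu (fun x => f_ k x - f x)%R <= (e / 2)%:E.
  apply: (@le_trans _ _ ((1 + t^-1)%:E * (e / 2 / (1 + t^-1))%:E)).
    by apply: lee_wpmul2l => //; rewrite lee_fin addr_ge0// invr_ge0 ltW.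
  by rewrite -EFinM lee_fin mulrC divfK// gt_eqF// addr_gt0// invr_gt0.
have mD := cl_measurableB (mf_ k) mf.
have h1 : cl_normL2 mu (f_ k) <= N + e%:E.
  have h : cl_normL2 mu (f_ k) <= (1 + t)%:E * N +
      (1 + t^-1)%:E * cl_normL2 mu (fun x => f_ k x - f x)%R.
    apply: cl_normL2D_le; [by rewrite addr_ge0// ltW|by rewrite addr_ge0// invr_ge0 ltW|exact: mf|exact: mD|exact: mf_|].
    - move=> x; have := @cl_sqnormD_le R n (f x) (f_ k x - f x)%R _ t0.
      by rewrite addrC subrK.
  apply: (le_trans h); rewrite rE -EFinM.
  apply: (@le_trans _ _ (((1 + t) * r)%:E + (e / 2)%:E)); first exact: leeD2l.
  by rewrite -!EFinD lee_fin; lra.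
split; [exact: h1|].
have h : N <= (1 + t)%:E * cl_normL2 mu (f_ k) +
    (1 + t^-1)%:E * cl_normL2 mu (fun x => f_ k x - f x)%R.
  apply: cl_normL2D_le; [by rewrite addr_ge0// ltW|by rewrite addr_ge0// invr_ge0 ltW|exact: mf_|exact: mD|exact: mf|].
  - move=> x; have := @cl_sqnormD_le R n (f_ k x) (- (f_ k x - f x))%R _ t0.
    by rewrite cl_sqnormN opprB addrCA subrr addr0.
apply: (le_trans h).
have [q qE] : exists q : R, cl_normL2 mu (f_ k) = q%:E.
  exists (fine (cl_normL2 mu (f_ k))); rewrite fineK// ge0_fin_numE; last exact: cl_normL2_ge0.
  by apply: (le_lt_trans h1); rewrite rE -EFinD ltry.
apply: (@le_trans _ _ ((1 + t)%:E * cl_normL2 mu (f_ k) + (e / 2)%:E)); first exact: leeD2l.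
move: h1; rewrite qE rE -EFinD lee_fin => qr.
rewrite -EFinM -!EFinD lee_fin.
have : (t * q <= t * (r + e))%R by rewrite ler_wpM2l// ltW.
lra.
Qed.

End clifford_L2.

Section clifford_L2_limit.
Context d (T : measurableType d) d' (T' : measurableType d') (R : realType) (n : nat).
Variables (mu : {measure set T -> \bar R}) (mu' : {measure set T' -> \bar R}).
Local Notation Cl := (clifford R n).
Local Open Scope ereal_scope.

(** An inequality between norms on two spaces survives [L^2] limits on both sides; used in both
    directions it carries over an isometry. *)
Lemma cl_normL2_limit_le (c c' : R) (X_ : nat -> T -> Cl) (X : T -> Cl)
    (Y_ : nat -> T' -> Cl) (Y : T' -> Cl) : (0 <= c)%R -> (0 <= c')%R ->
  (forall k, cl_measurable (X_ k)) -> (forall k, cl_measurable (Y_ k)) ->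
  cl_L2 mu X -> cl_L2 mu' Y ->
  vanishing (fun k => cl_normL2 mu (fun x => X_ k x - X x)%R) ->
  vanishing (fun k => cl_normL2 mu' (fun x => Y_ k x - Y x)%R) ->
  (forall k, c%:E * cl_normL2 mu (X_ k) <= c'%:E * cl_normL2 mu' (Y_ k)) ->
  c%:E * cl_normL2 mu X <= c'%:E * cl_normL2 mu' Y.
Proof.
move=> c0 c'0 mX mY X2 Y2 vX vY XY; apply/lee_addgt0Pr => e e0.
have s0 : (0 < c + c' + 1)%R by lra.
(* The errors on the two sides sum to [(c + c') * t]; the added 1 covers [c = c' = 0]. *)
have t0 : (0 < e / (c + c' + 1))%R by rewrite divr_gt0.
set t := (e / _)%R in t0.
have [N1 _ N1P] := cl_normL2_near mX X2 vX t0.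
have [N2 _ N2P] := cl_normL2_near mY Y2 vY t0.
have [_ hX] := N1P (maxn N1 N2) (leq_maxl _ _).
have [hY _] := N2P (maxn N1 N2) (leq_maxr _ _).
have {XY} := XY (maxn N1 N2).
have := cl_normL2_ge0 mu (X_ (maxn N1 N2)); have := cl_normL2_ge0 mu' Y.
move: (cl_normL2 mu X) (cl_normL2 mu (X_ _)) (cl_normL2 mu' (Y_ _)) (cl_normL2 mu' Y) hX hY.
move=> x xk yk y hX hY y0 xk0 h.
apply: (@le_trans _ _ (c%:E * xk + (c * t)%:E)).
  apply: (@le_trans _ _ (c%:E * (xk + t%:E))); first by apply: lee_wpmul2l; rewrite ?lee_fin.
  by rewrite ge0_muleDr// lee_fin ltW.
apply: (@le_trans _ _ (c'%:E * yk + (c * t)%:E)); first exact: leeD2r.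
apply: (@le_trans _ _ (c'%:E * (y + t%:E) + (c * t)%:E)).
  by apply: leeD2r; apply: lee_wpmul2l; rewrite ?lee_fin.
rewrite ge0_muleDr//; last by rewrite lee_fin ltW.
rewrite -addeA leeD2l// -EFinM -EFinD lee_fin.
rewrite (_ : e = (c + c' + 1) * t)%R; first by rewrite !mulrDl; lra.
by rewrite /t mulrC divfK// gt_eqF.
Qed.

End clifford_L2_limit.

(** * Cosine and sine transforms *)

(** The kernels are real, so constants come out on either side, which fails for [cl_fourier]; the
    order of factors matters only when the transform is reassembled with [i_n]. *)
HB.lock Definition cfc (R : realType) n (f : 'cV[R]_n -> clifford R n) (w : 'cV[R]_n) :
  clifford R n := cl_integral (lebesgue_cV R n) (fun x => cos (dot w x) *: f x).
HB.lock Definition cfs (R : realType) n (f : 'cV[R]_n -> clifford R n) (w : 'cV[R]_n) :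
  clifford R n := cl_integral (lebesgue_cV R n) (fun x => sin (dot w x) *: f x).

Section clifford_fourier_theory.
Variables (R : realType) (n : nat).
Local Notation Cl := (clifford R n).
Local Notation Rn := 'cV[R]_n.
Local Notation leb := (lebesgue_cV R n).
Implicit Types (f g : Rn -> Cl) (M N : Cl).

Lemma cfcE f w : cfc f w = cl_integral leb (fun x => cos (dot w x) *: f x).
Proof. by rewrite cfc.unlock. Qed.

Lemma cfsE f w : cfs f w = cl_integral leb (fun x => sin (dot w x) *: f x).
Proof. by rewrite cfs.unlock. Qed.

Lemma cfc_coef f w A : cfc f w A = fcos (fun x => f x A) w.
Proof.
rewrite cfcE ffunE; apply: eq_Rintegral => x _.
by rewrite cl_scaleE mulrC.
Qed.

Lemma cfs_coef f w A : cfs f w A = fsin (fun x => f x A) w.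
Proof.
rewrite cfsE ffunE; apply: eq_Rintegral => x _.
by rewrite cl_scaleE mulrC.
Qed.

Lemma cl_measurable_cfc f : cl_measurable f -> cl_measurable (cfc f).
Proof. by move=> mf A; under eq_fun do rewrite cfc_coef; exact: measurable_fcos. Qed.

Lemma cl_measurable_cfs f : cl_measurable f -> cl_measurable (cfs f).
Proof. by move=> mf A; under eq_fun do rewrite cfs_coef; exact: measurable_fsin. Qed.

Lemma cl_integrable_cos f w : cl_integrable leb f ->
  cl_integrable leb (fun x => cos (dot w x) *: f x).
Proof.
move=> fi A; have := integrable_mul_cos w (fi A).
by congr (integrable _ _ _); apply/funext => x /=; rewrite cl_scaleE mulrC.
Qed.

Lemma cl_integrable_sin f w : cl_integrable leb f ->
  cl_integrable leb (fun x => sin (dot w x) *: f x).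
Proof.
move=> fi A; have := integrable_mul_sin w (fi A).
by congr (integrable _ _ _); apply/funext => x /=; rewrite cl_scaleE mulrC.
Qed.

Lemma cfc_mul M f N w : cl_integrable leb f ->
  cfc (fun x => M * f x * N) w = M * cfc f w * N.
Proof.
move=> fi; rewrite !cfcE -(cl_integral_mul M N (cl_integrable_cos w fi)).
by congr (cl_integral leb _); apply/funext => x; rewrite -scalerAr -scalerAl.
Qed.

Lemma cfs_mul M f N w : cl_integrable leb f ->
  cfs (fun x => M * f x * N) w = M * cfs f w * N.
Proof.
move=> fi; rewrite !cfsE -(cl_integral_mul M N (cl_integrable_sin w fi)).
by congr (cl_integral leb _); apply/funext => x; rewrite -scalerAr -scalerAl.
Qed.

Lemma cfcB f g w : cl_integrable leb f -> cl_integrable leb g ->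
  cfc (fun x => f x - g x) w = cfc f w - cfc g w.
Proof.
move=> fi gi; rewrite !cfcE -cl_integralB; [|exact: cl_integrable_cos..].
by congr (cl_integral leb _); apply/funext => x; rewrite scalerBr.
Qed.

Lemma cfsB f g w : cl_integrable leb f -> cl_integrable leb g ->
  cfs (fun x => f x - g x) w = cfs f w - cfs g w.
Proof.
move=> fi gi; rewrite !cfsE -cl_integralB; [|exact: cl_integrable_sin..].
by congr (cl_integral leb _); apply/funext => x; rewrite scalerBr.
Qed.

Lemma cfc_rev f w : cl_integrable leb f -> cfc (fun x => cl_rev (f x)) w = cl_rev (cfc f w).
Proof.
move=> fi; rewrite !cfcE -cl_integral_rev; last exact: cl_integrable_cos.
by congr (cl_integral leb _); apply/funext => x; rewrite cl_revZ.
Qed.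

Lemma cfs_rev f w : cl_integrable leb f -> cfs (fun x => cl_rev (f x)) w = cl_rev (cfs f w).
Proof.
move=> fi; rewrite !cfsE -cl_integral_rev; last exact: cl_integrable_sin.
by congr (cl_integral leb _); apply/funext => x; rewrite cl_revZ.
Qed.

Lemma dotNl (w x : Rn) : dot (- w) x = - dot w x.
Proof. by rewrite /dot -sumrN; apply: eq_bigr => i _; rewrite mxE mulNr. Qed.

Lemma cfcN f w : cfc f (- w) = cfc f w.
Proof.
by rewrite !cfcE; congr (cl_integral leb _); apply/funext => x; rewrite dotNl cosN.
Qed.

Lemma cfsN f w : cl_integrable leb f -> cfs f (- w) = - cfs f w.
Proof.
move=> fi; apply/ffunP => A.
rewrite cl_oppE.
rewrite (cfs_coef f (- w) A).
rewrite (cfs_coef f w A).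
rewrite /fsin.
rewrite (@eq_Rintegral _ _ R leb setT (fun x => (- 1) * (f x A * sin (dot w x)))); last first.
  by move=> x _; rewrite dotNl sinN mulrN mulN1r.
rewrite RintegralZl; [by rewrite mulN1r|exact: measurableT|].
exact: (integrable_mul_sin w (fi A)).
Qed.

Lemma cl_parseval f : cl_integrable leb f -> cl_L2 leb f ->
  (\int[leb]_w (cl_sqnorm (cfc f w) + cl_sqnorm (cfs f w))%:E =
   (plancherel_const R n)%:E * cl_normL2 leb f)%E.
Proof.
move=> fi fL; have mf := cl_integrable_measurable fi.
transitivity (\int[leb]_w \sum_(A <- index_enum {set 'I_n}) (fsq (fun x => f x A) w)%:E)%E.
  apply: eq_integral => w _.
rewrite (cl_sqnormE (cfc f w)).
rewrite (cl_sqnormE (cfs f w)).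
  rewrite -big_split/= -sumEFin.
  apply: eq_bigr => A _.
  by rewrite (cfc_coef f w A) (cfs_coef f w A).
rewrite (@ge0_integral_sum _ _ R leb setT measurableT _ (fun A w => (fsq (fun x => f x A) w)%:E)); last 2 first.
- by move=> A; apply/measurable_EFinP; apply: measurable_fsq.
- by move=> A w _; rewrite lee_fin fsq_ge0.
transitivity (\sum_(A <- index_enum {set 'I_n})
    (plancherel_const R n)%:E * \int[leb]_x (f x A ^+ 2)%:E)%E.
  apply: eq_bigr => A _; apply: plancherel; first exact: fi.
  exact: cl_L2_coef.
rewrite -ge0_sume_distrr; last first.
  by move=> A _; apply: integral_ge0 => x _; rewrite lee_fin sqr_ge0.
congr (_ * _)%E; rewrite -(@ge0_integral_sum _ _ R leb setT measurableT _ (fun A x => (f x A ^+ 2)%:E)); last 2 first.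
- by move=> A; apply/measurable_EFinP; apply: measurable_funX.
- by move=> A w _; rewrite lee_fin sqr_ge0.
by apply: eq_integral => x _; rewrite cl_sqnormE -sumEFin.
Qed.

(** [F] has the same integral as its average with its reflection, and in the uses below that average
    has lost the cross terms. Nonnegativity admits the value [+oo]. *)
Lemma integral_reflect (F G : Rn -> R) :
  measurable_fun setT F -> measurable_fun setT G ->
  (forall w, 0 <= F w) -> (forall w, 0 <= G w) ->
  (forall w, F w + F (- w) = 2 * G w) ->
  (\int[leb]_w (F w)%:E = \int[leb]_w (G w)%:E)%E.
Proof.
move=> mF mG F0 G0 FG.
have mFE : measurable_fun setT (EFin \o F) by exact/measurable_EFinP.
have mGE : measurable_fun setT (EFin \o G) by exact/measurable_EFinP.
have [mN _ _] := scales_opp R n.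
have mFN : measurable_fun setT (fun w : Rn => (F (- w))%:E) by exact: (measurableT_comp mFE mN).
have hN : (\int[leb]_w (F (- w))%:E = \int[leb]_w (F w)%:E)%E.
  rewrite (ge0_integral_scales (F := EFin \o F) (scales_opp R n)); [|exact: mFE|].
    by rewrite mul1e.
  by move=> x; rewrite lee_fin.
have h2 : (\int[leb]_w (F w)%:E + \int[leb]_w (F w)%:E = 2%:E * \int[leb]_w (G w)%:E)%E.
  rewrite -[X in (_ + X)%E]hN -ge0_integralD; last 5 first.
  - exact: measurableT.
  - by move=> w _; rewrite lee_fin.
  - exact: mFE.
  - by move=> w _; rewrite lee_fin.
  - exact: mFN.
  rewrite -ge0_integralZl_EFin; last 4 first.
  - exact: measurableT.
  - by move=> w _; rewrite lee_fin.
  - exact: mGE.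
  - by [].
  by apply: eq_integral => w _; rewrite -EFinD FG EFinM.
have I0 : (0 <= \int[leb]_w (F w)%:E)%E by apply: integral_ge0 => w _; rewrite lee_fin.
have J0 : (0 <= \int[leb]_w (G w)%:E)%E by apply: integral_ge0 => w _; rewrite lee_fin.
move: h2 I0 J0; move: (\int[leb]_w (F w)%:E)%E (\int[leb]_w (G w)%:E)%E.
move=> [x| |] [y| |] h //= _ _; move: h.
- by rewrite -EFinD -EFinM => -[] xy; congr EFin; lra.
- by rewrite gt0_muley ?lte_fin.
Qed.

Section mod4.
Hypothesis n_mod4 : (n %% 4 = 2)%N \/ (n %% 4 = 3)%N.
Local Notation i_n := (cl_pseudoscalar : Cl).

Lemma cl_fourierE f w : cl_integrable leb f ->
  cl_fourier f w = cfc f w - cfs f w * i_n.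
Proof.
move=> fi; rewrite cfcE cfsE -cl_integralMr; last exact: cl_integrable_sin.
rewrite -cl_integralB; last 2 first.
- exact: cl_integrable_cos.
- by apply: cl_integrableMr; exact: cl_integrable_sin.
congr (cl_integral leb _); apply/funext => x.
rewrite (cl_exp_i n_mod4) cosN sinN mulrDr -!scalerAr mulr1 scaleNr.
by rewrite scalerAl.
Qed.

Lemma cl_sqnorm_reflect (s : R) M N : s ^+ 2 = 1 ->
  cl_sqnorm (M - s *: (N * i_n)) + cl_sqnorm (M - s *: (- N * i_n)) =
  2 * (cl_sqnorm M + cl_sqnorm N).
Proof.
move=> s1; rewrite mulNr scalerN opprK addrC cl_sqnorm_parallelogram.
by rewrite cl_sqnormZ s1 mul1r cl_sqnorm_mul_i mulrDr.
Qed.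

(** With [s = 1] this is Plancherel for [cl_fourier]. The value [s = -1] occurs for correlations
    with an odd wavelet. Since [cfs f] is odd in [w], the parallelogram law removes the cross terms
    for either sign. *)
Lemma cl_plancherel_sign (s : R) f : s ^+ 2 = 1 ->
  cl_integrable leb f -> cl_L2 leb f ->
  (cl_normL2 leb (fun w => cfc f w - s *: (cfs f w * i_n))%R =
   (plancherel_const R n)%:E * cl_normL2 leb f)%E.
Proof.
move=> s1 fi fL; rewrite -cl_parseval//; have mf := cl_integrable_measurable fi.
have mc := cl_measurable_cfc mf; have ms := cl_measurable_cfs mf.
apply: integral_reflect.
- apply: measurable_cl_sqnorm; apply: cl_measurableB => //.
  by apply: cl_measurableZ => //; apply: cl_measurableM => //; exact: cl_measurable_cst.
- by apply: measurable_funD; exact: measurable_cl_sqnorm.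
- by move=> w; exact: cl_sqnorm_ge0.
- by move=> w; rewrite addr_ge0 ?cl_sqnorm_ge0.
- by move=> w; rewrite cfcN (cfsN _ fi) cl_sqnorm_reflect.
Qed.

Lemma cl_plancherel f : cl_integrable leb f -> cl_L2 leb f ->
  (cl_normL2 leb (cl_fourier f) = (plancherel_const R n)%:E * cl_normL2 leb f)%E.
Proof.
move=> fi fL; rewrite -(cl_plancherel_sign (expr1n R 2) fi fL).
by congr (cl_normL2 leb _); apply/funext => w; rewrite (cl_fourierE _ fi) scale1r.
Qed.

Lemma cl_measurable_fourier f : cl_integrable leb f -> cl_measurable (cl_fourier f).
Proof.
move=> fi; have mf := cl_integrable_measurable fi.
rewrite (_ : cl_fourier f = fun w => cfc f w - cfs f w * i_n); last first.
  by apply/funext => w; exact: cl_fourierE.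
apply: cl_measurableB; first exact: cl_measurable_cfc.
apply: cl_measurableM; first exact: cl_measurable_cfs.
exact: cl_measurable_cst.
Qed.

Lemma cl_fourier_bounded f : cl_integrable leb f ->
  exists2 N : R, 0 <= N & forall w, cl_sqnorm (cl_fourier f w) <= N.
Proof.
move=> fi; pose N := \sum_(A : {set 'I_n}) (\int[leb]_x `|f x A|) ^+ 2.
have N0 : 0 <= N by apply: sumr_ge0 => A _; exact: sqr_ge0.
have hc w : cl_sqnorm (cfc f w) <= N.
  rewrite cl_sqnormE; apply: ler_sum => A _; rewrite (cfc_coef f w A).
  rewrite -[_ ^+ 2 in leLHS]real_normK ?num_real// lerXn2r ?nnegrE//.
    by apply: Rintegral_ge0.
  exact: (fcos_le w (fi A)).
have hs w : cl_sqnorm (cfs f w) <= N.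
  rewrite cl_sqnormE; apply: ler_sum => A _; rewrite (cfs_coef f w A).
  rewrite -[_ ^+ 2 in leLHS]real_normK ?num_real// lerXn2r ?nnegrE//.
    by apply: Rintegral_ge0.
  exact: (fsin_le w (fi A)).
exists (2 * N + 2 * N); first by rewrite addr_ge0 ?mulr_ge0.
move=> w; rewrite cl_fourierE//; apply: le_trans (cl_sqnormB_le2 _ _) _.
by rewrite cl_sqnorm_mul_i lerD// ler_wpM2l.
Qed.

End mod4.

End clifford_fourier_theory.

(** * Correlations *)

HB.lock Definition xcorr (R : realType) n (u v : 'cV[R]_n -> R) (b : 'cV[R]_n) : R :=
  \int[lebesgue_cV R n]_x (u x * v (x - b)).

Section correlation.
Variables (R : realType) (n : nat).
Local Notation Rn := 'cV[R]_n.
Local Notation leb := (lebesgue_cV R n).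
Implicit Types (u v : Rn -> R).

Lemma xcorrE u v b : xcorr u v b = \int[leb]_x (u x * v (x - b)).
Proof. by rewrite xcorr.unlock. Qed.

Lemma measurable_sub_pair : measurable_fun setT (fun p : Rn * Rn => p.1 - p.2).
Proof. by apply: measurable_submx. Qed.

Lemma measurable_xcorr u v : measurable_fun setT u -> measurable_fun setT v ->
  measurable_fun setT (xcorr u v).
Proof.
move=> mu mv.
rewrite (_ : xcorr u v = fun b => \int[leb]_x (u x * v (x - b))); last first.
  by apply/funext => b; exact: xcorrE.
apply: (@measurable_Rintegral _ _ Rn Rn R leb (fun p => u p.2 * v (p.2 - p.1))).
apply: measurable_funM; first exact: (measurableT_comp mu).
by apply: (measurableT_comp mv); apply: measurable_submx.
Qed.

Lemma scales_reflect_shift (x : Rn) : scales_lebesgue (fun y : Rn => x - y) 1.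
Proof.
have := scales_lebesgue_comp (scales_shift x) (scales_opp R n).
rewrite mulr1; congr (scales_lebesgue _ _).
by apply/funext => y /=; rewrite addrC.
Qed.

Lemma Rintegral_reflect_shift (x : Rn) (G : Rn -> R) : leb.-integrable setT (EFin \o G) ->
  \int[leb]_b G b = \int[leb]_y G (x - y).
Proof.
move=> iG; rewrite /Rintegral; congr fine.
by rewrite (integral_scales (F := EFin \o G) (scales_reflect_shift x) iG) mul1e.
Qed.

(** Fubini with the substitution [y = x - b]. Taking [phi] to be 1, a cosine or a sine gives
    integrability of the correlation and its two transforms. *)
Lemma xcorr_test u v (phi : Rn -> R) :
  leb.-integrable setT (EFin \o u) -> leb.-integrable setT (EFin \o v) ->
  (forall b, leb.-integrable setT (EFin \o (fun x => u x * v (x - b)))) ->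
  measurable_fun setT phi -> (forall b, `|phi b| <= 1) ->
  leb.-integrable setT (EFin \o (fun b => xcorr u v b * phi b)) /\
  \int[leb]_b (xcorr u v b * phi b) =
  \int[leb]_x (u x * \int[leb]_y (v y * phi (x - y))).
Proof.
move=> iu iv iuv mphi phi1.
have mu := integrable_measurable iu; have mv := integrable_measurable iv.
pose H (p : Rn * Rn) := u p.1 * v (p.1 - p.2) * phi p.2.
have mH : measurable_fun setT H.
  apply: measurable_funM; last exact: (measurableT_comp mphi).
  apply: measurable_funM; first exact: (measurableT_comp mu).
  exact: (measurableT_comp mv measurable_sub_pair).
have mv1 x : measurable_fun setT (fun b : Rn => v (x - b)).
  by apply: (measurableT_comp mv); apply: measurable_submx.
have ivx x : leb.-integrable setT (EFin \o (fun b => v (x - b))).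
  exact: (integrable_scales (scales_reflect_shift x) iv).
have mHE : measurable_fun setT (EFin \o H) by exact/measurable_EFinP.
have iH : (leb \x leb)%E.-integrable setT (EFin \o H).
  apply/(integrable12ltyP _ _ mHE).
  have /integrableP[_ uoo] := iu; have /integrableP[_ voo] := iv.
  apply: (@le_lt_trans _ _ (\int[leb]_x (`|(u x)%:E| * \int[leb]_y `|(v y)%:E|))%E).
    apply: ge0_le_integral.
    - exact: measurableT.
    - by move=> x _; apply: integral_ge0 => b _.
    - apply: (measurable_fun_fubini_tonelli_F (m2 := leb) (abse \o (EFin \o H))).
        exact: measurableT_comp.
      by move=> p; exact: abse_ge0.
    - apply: emeasurable_funM; last exact: measurable_cst.
      by apply: measurableT_comp => //; exact/measurable_EFinP.
    move=> x _.
    rewrite -[X in (_ <= _ * X)%E]mul1e.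
    rewrite -(ge0_integral_scales (F := fun y => `|(v y)%:E|)%E (scales_reflect_shift x)); last 2 first.
    - by apply: measurableT_comp => //; exact/measurable_EFinP.
    - by move=> y; exact: abse_ge0.
    rewrite -ge0_integralZl; last 4 first.
    - exact: measurableT.
    - by apply: measurableT_comp => //; apply/measurable_EFinP; exact: mv1.
    - by move=> b _; exact: abse_ge0.
    - exact: abse_ge0.
    apply: ge0_le_integral.
    - exact: measurableT.
    - by move=> b _; exact: abse_ge0.
    - apply: (measurableT_comp (f := abse) (g := (EFin \o H) \o pair x)) => //.
      exact: (measurableT_comp mHE (measurable_pair1 _)).
    - apply: emeasurable_funM; first exact: measurable_cst.
      by apply: measurableT_comp => //; apply/measurable_EFinP; exact: mv1.
    by move=> b _; rewrite -abseM lee_fin /H/= normrM ler_piMr.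
  rewrite ge0_integralZr; last 4 first.
  - exact: measurableT.
  - by apply: measurableT_comp => //; exact/measurable_EFinP.
  - by move=> b _; exact: abse_ge0.
  - by apply: integral_ge0 => y _; exact: abse_ge0.
  apply: lte_mul_pinfty; last exact: voo.
  - by apply: integral_ge0 => y _; exact: abse_ge0.
  - rewrite ge0_fin_numE; first exact: uoo.
    by apply: integral_ge0 => y _; exact: abse_ge0.
have [_ i2 FF] := Rfubini iH.
have E1 b : xcorr u v b * phi b = \int[leb]_x H (x, b).
  rewrite /H/= xcorrE.
  by rewrite RintegralZr; [|exact: measurableT|exact: iuv].
have E2 x : \int[leb]_b H (x, b) = u x * \int[leb]_y (v y * phi (x - y)).
  rewrite /H/= (@eq_Rintegral _ _ R leb setT (fun b => u x * (v (x - b) * phi b))); last first.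
    by move=> b _; rewrite mulrA.
  rewrite RintegralZl; [|exact: measurableT|exact: (integrable_mul_le1 (ivx x) mphi phi1)].
  congr (_ * _); rewrite (@Rintegral_reflect_shift x (fun b => v (x - b) * phi b)).
    by apply: eq_Rintegral => y _; rewrite subKr.
  exact: (integrable_mul_le1 (ivx x) mphi phi1).
split.
  suff -> : EFin \o (fun b => xcorr u v b * phi b) = fun b => (\int[leb]_x H (x, b))%:E by exact: i2.
  by apply/funext => b; rewrite /= E1.
transitivity (\int[leb]_b \int[leb]_x H (x, b)); first by apply: eq_Rintegral => b _; exact: E1.
by rewrite -FF; apply: eq_Rintegral => x _; exact: E2.
Qed.

(** Cauchy-Schwarz for the measure of density [|u|]: the integrated form of [2 t |v| <= t^2 + v^2]
    is optimized in [t]. *)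
Lemma sqr_Rintegral_le u v (N : R) : 0 < N -> leb.-integrable setT (EFin \o u) ->
  measurable_fun setT v -> leb.-integrable setT (EFin \o (fun x => u x * v x)) ->
  \int[leb]_x `|u x| <= N ->
  (((\int[leb]_x (u x * v x)) ^+ 2)%:E <= N%:E * \int[leb]_x (`|u x| * v x ^+ 2)%:E)%E.
Proof.
move=> N0 iu mv iuv uN; have mu := integrable_measurable iu.
have m2 : measurable_fun setT (fun x => `|u x| * v x ^+ 2).
  by apply: measurable_funM; [exact: measurableT_comp|exact: measurable_funX].
have [Soo|] := ltP (\int[leb]_x (`|u x| * v x ^+ 2)%:E)%E (+oo)%E; last first.
  by rewrite leye_eq => /eqP ->; rewrite gt0_muley ?lte_fin ?leey.
have iS : leb.-integrable setT (EFin \o (fun x => `|u x| * v x ^+ 2)).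
  by apply: ge0_integrableP => // x; rewrite mulr_ge0 ?sqr_ge0.
rewrite -(EFin_Rintegral iS) -EFinM lee_fin.
have iau := integrable_norm iu.
have key (t : R) : 0 < t ->
    2 * `|\int[leb]_x (u x * v x)| * t <= t ^+ 2 * N + \int[leb]_x (`|u x| * v x ^+ 2).
  move=> t0.
  have h1 : `|\int[leb]_x (u x * v x)| <= \int[leb]_x ((t / 2) * `|u x| + (2 * t)^-1 * (`|u x| * v x ^+ 2)).
    apply: (le_trans (norm_Rintegral_le iuv)); apply: le_Rintegral.
    - exact: measurableT.
    - exact: (integrable_norm iuv).
    - by apply: integrable_add; apply: integrable_scale.
    move=> x _; rewrite normrM.
    rewrite [leRHS](_ : _ = `|u x| * (t / 2 + (2 * t)^-1 * v x ^+ 2)); last by ring.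
    rewrite ler_wpM2l//.
    rewrite -[v x ^+ 2]real_normK ?num_real//; move: `|v x| (normr_ge0 (v x)) => y y0.
    rewrite -subr_ge0 (_ : _ - _ = (2 * t)^-1 * (t - y) ^+ 2).
      by rewrite mulr_ge0 ?sqr_ge0// invr_ge0 mulr_ge0// ltW.
    by field; rewrite gt_eqF.
  move: h1; rewrite RintegralD; [|exact: measurableT|by apply: integrable_scale|by apply: integrable_scale].
  rewrite RintegralZl; [|exact: measurableT|exact: iau].
  rewrite RintegralZl; [|exact: measurableT|exact: iS].
  move: uN; move: (\int[leb]_x `|u x|) `|\int[leb]_x (u x * v x)| (\int[leb]_x (`|u x| * v x ^+ 2)).
  move=> P I S PN IS.
  have : 2 * t * I <= 2 * t * (t / 2 * P + (2 * t)^-1 * S) by rewrite ler_wpM2l// mulr_ge0// ltW.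
  rewrite (_ : 2 * t * (t / 2 * P + (2 * t)^-1 * S) = t ^+ 2 * P + S); last by field; rewrite gt_eqF.
  have : t ^+ 2 * P <= t ^+ 2 * N by rewrite ler_wpM2l// sqr_ge0.
  by rewrite mulrAC; lra.
rewrite -real_normK ?num_real//.
have S0 : 0 <= \int[leb]_x (`|u x| * v x ^+ 2).
  by apply: Rintegral_ge0 => x _; rewrite mulr_ge0 ?sqr_ge0.
move: key S0 (normr_ge0 (\int[leb]_x (u x * v x))).
move: `|\int[leb]_x (u x * v x)| (\int[leb]_x (`|u x| * v x ^+ 2)) => I S key S0 I0.
have [->|In0] := eqVneq I 0; first by rewrite expr0n mulr_ge0// ltW.
have Ip : 0 < I by rewrite lt_neqAle eq_sym In0.
(* The value [t = I / N] minimizes [t^2 N - 2 I t]. *)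
have := key _ (divr_gt0 Ip N0).
rewrite (_ : 2 * I * (I / N) = 2 * (I ^+ 2 / N)); last by field; rewrite gt_eqF.
rewrite (_ : (I / N) ^+ 2 * N = I ^+ 2 / N); last by field; rewrite gt_eqF.
move=> h; have : I ^+ 2 / N <= S by lra.
by rewrite ler_pdivrMr// mulrC.
Qed.

End correlation.

(** * Young's inequality and transforms of correlations *)

Section correlation_L2.
Variables (R : realType) (n : nat).
Local Notation Rn := 'cV[R]_n.
Local Notation leb := (lebesgue_cV R n).
Implicit Types (u v : Rn -> R).

Definition sq_integrable u : Prop :=
  measurable_fun setT u /\ (\int[leb]_x (u x ^+ 2)%:E < +oo)%E.

Lemma sq_integrable_shift v b : sq_integrable v -> sq_integrable (fun x => v (x - b)).
Proof.
move=> [mv v2]; have mv2 : measurable_fun setT (fun x => (v x ^+ 2)%:E).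
  by apply/measurable_EFinP; exact: measurable_funX.
split; first by apply: (measurableT_comp mv); apply: measurable_submx.
rewrite (ge0_integral_scales (F := fun x => (v x ^+ 2)%:E) (scales_shift (- b)) mv2).
  by rewrite mul1e; exact: v2.
by move=> x; rewrite lee_fin sqr_ge0.
Qed.

Lemma integrable_mul_sq u v : sq_integrable u -> sq_integrable v ->
  leb.-integrable setT (EFin \o (fun x => u x * v x)).
Proof. by move=> [mu u2] [mv v2]; exact: integrable_mul_L2. Qed.

Lemma integrable_xcorr_term u v b : sq_integrable u -> sq_integrable v ->
  leb.-integrable setT (EFin \o (fun x => u x * v (x - b))).
Proof. by move=> u2 v2; apply: integrable_mul_sq => //; exact: sq_integrable_shift. Qed.

Lemma xcorr_young u : leb.-integrable setT (EFin \o u) -> sq_integrable u ->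
  exists2 N : R, 0 <= N & forall v, sq_integrable v ->
    (\int[leb]_b (xcorr u v b ^+ 2)%:E <= N%:E * \int[leb]_x (v x ^+ 2)%:E)%E.
Proof.
move=> iu u2; have [mu _] := u2.
have [P [P0 uP]] : exists P : R, 0 <= P /\ \int[leb]_x `|u x| = P.
  by exists (\int[leb]_x `|u x|); split => //; apply: Rintegral_ge0.
have P1 : 0 < P + 1 by lra.
(* Young's constant would be [P ^+ 2]; one factor is enlarged because [sqr_Rintegral_le] asks for a
   positive bound and [P] may be 0. *)
exists ((P + 1) * P); first by rewrite mulr_ge0// ltW.
move=> v v2; have [mv _] := v2.
have uP1 : \int[leb]_x `|u x| <= P + 1 by rewrite uP lerDl.
have mv2 : measurable_fun setT (fun x => (v x ^+ 2)%:E).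
  by apply/measurable_EFinP; exact: measurable_funX.
have v20 x : (0 <= (v x ^+ 2)%:E)%E by rewrite lee_fin sqr_ge0.
pose K (p : Rn * Rn) := (`|u p.2| * v (p.2 - p.1) ^+ 2)%:E.
have mK : measurable_fun setT K.
  apply/measurable_EFinP; apply: measurable_funM.
    by apply: measurableT_comp => //; exact: (measurableT_comp mu).
  apply: measurable_funX; apply: (measurableT_comp mv).
  by apply: measurable_submx.
have K0 p : (0 <= K p)%E by rewrite lee_fin mulr_ge0// sqr_ge0.
have mKb b : measurable_fun setT (fun x => K (b, x)).
  exact: (measurableT_comp mK (measurable_pair1 _)).
have mF := measurable_fun_fubini_tonelli_F (m2 := leb) K mK K0.
apply: (@le_trans _ _ (\int[leb]_b ((P + 1)%:E * \int[leb]_x K (b, x)))%E).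
  apply: ge0_le_integral.
  - exact: measurableT.
  - by move=> b _; rewrite lee_fin sqr_ge0.
  - by apply/measurable_EFinP; apply: measurable_funX; exact: measurable_xcorr.
  - by apply: measurable_funeM; exact: mF.
  move=> b _; rewrite xcorrE.
  have [mvb _] := sq_integrable_shift b v2.
  exact: (sqr_Rintegral_le P1 iu mvb (integrable_xcorr_term b u2 v2) uP1).
rewrite ge0_integralZl_EFin; last 4 first.
- exact: measurableT.
- by move=> b _; apply: integral_ge0 => x _; exact: K0.
- exact: mF.
- exact: ltW.
rewrite EFinM -muleA; apply: lee_wpmul2l; first by rewrite lee_fin ltW.
rewrite (fubini_tonelli (m1 := leb) (m2 := leb) K mK K0).
apply: (@le_trans _ _ (\int[leb]_x (`|u x|%:E * \int[leb]_y (v y ^+ 2)%:E))%E).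
  apply: ge0_le_integral.
  - exact: measurableT.
  - by move=> x _; apply: integral_ge0 => b _; exact: K0.
  - exact: (measurable_fun_fubini_tonelli_G (m1 := leb) K mK K0).
  - apply: emeasurable_funM; last exact: measurable_cst.
    by apply/measurable_EFinP; exact: measurableT_comp.
  move=> x _; rewrite -[X in (_ <= _ * X)%E]mul1e.
  rewrite -(ge0_integral_scales (scales_reflect_shift x) mv2 v20).
  rewrite -ge0_integralZl_EFin; last 4 first.
  - exact: measurableT.
  - by move=> y _; exact: v20.
  - by have [m _ _] := scales_reflect_shift x; exact: (measurableT_comp mv2 m).
  - exact: normr_ge0.
  by rewrite le_eqVlt; apply/orP; left; apply/eqP; apply: eq_integral => b _.
rewrite ge0_integralZr; last 4 first.
- exact: measurableT.
- by apply/measurable_EFinP; exact: measurableT_comp.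
- by move=> x _; rewrite lee_fin.
- by apply: integral_ge0 => y _; exact: v20.
apply: lee_wpmul2r; first by apply: integral_ge0 => y _; exact: v20.
by rewrite -uP (EFin_Rintegral (integrable_norm iu)).
Qed.

Lemma fcos_xcorr u v w : leb.-integrable setT (EFin \o u) -> sq_integrable u ->
  leb.-integrable setT (EFin \o v) -> sq_integrable v ->
  fcos (xcorr u v) w = fcos u w * fcos v w + fsin u w * fsin v w.
Proof.
move=> iu u2 iv v2.
have m1 : measurable_fun setT (fun b : Rn => cos (dot w b)) by exact: measurable_cos_dot.
have [_ E] := xcorr_test (phi := fun b => cos (dot w b)) iu iv
  (fun b => integrable_xcorr_term b u2 v2) m1
  (fun b => norm_cos_le1 _).
rewrite /fcos [LHS]E.
rewrite (@eq_Rintegral _ _ R leb setT (fun x => (u x * cos (dot w x)) * fcos v w +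
    (u x * sin (dot w x)) * fsin v w)); last first.
  move=> x _; rewrite -!mulrA -mulrDr; congr (_ * _).
  rewrite (@eq_Rintegral _ _ R leb setT (fun y => cos (dot w x) * (v y * cos (dot w y)) +
    sin (dot w x) * (v y * sin (dot w y)))); last first.
    by move=> y _; rewrite dotBr cosB; ring.
  rewrite RintegralD; [|exact: measurableT| |]; last 2 first.
  - by apply: integrable_scale; exact: integrable_mul_cos.
  - by apply: integrable_scale; exact: integrable_mul_sin.
  rewrite RintegralZl; [|exact: measurableT|exact: integrable_mul_cos].
  by rewrite RintegralZl; [|exact: measurableT|exact: integrable_mul_sin].
have i1 := integrable_mul_cos w iu; have i2 := integrable_mul_sin w iu.
have i3 : leb.-integrable setT (EFin \o (fun x => u x * cos (dot w x) * fcos v w)).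
  by have := integrable_scale (fcos v w) i1; congr (integrable _ _ _); apply/funext => x /=; rewrite mulrC.
have i4 : leb.-integrable setT (EFin \o (fun x => u x * sin (dot w x) * fsin v w)).
  by have := integrable_scale (fsin v w) i2; congr (integrable _ _ _); apply/funext => x /=; rewrite mulrC.
rewrite RintegralD; [|exact: measurableT|exact: i3|exact: i4].
rewrite RintegralZr; [|exact: measurableT|exact: i1].
by rewrite RintegralZr; [|exact: measurableT|exact: i2].
Qed.

Lemma fsin_xcorr u v w : leb.-integrable setT (EFin \o u) -> sq_integrable u ->
  leb.-integrable setT (EFin \o v) -> sq_integrable v ->
  fsin (xcorr u v) w = fsin u w * fcos v w - fcos u w * fsin v w.
Proof.
move=> iu u2 iv v2.
have m1 : measurable_fun setT (fun b : Rn => sin (dot w b)) by exact: measurable_sin_dot.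
have [_ E] := xcorr_test (phi := fun b => sin (dot w b)) iu iv
  (fun b => integrable_xcorr_term b u2 v2) m1
  (fun b => norm_sin_le1 _).
rewrite /fsin [LHS]E -mulrN.
rewrite (@eq_Rintegral _ _ R leb setT (fun x => (u x * sin (dot w x)) * fcos v w +
    (u x * cos (dot w x)) * - fsin v w)); last first.
  move=> x _; rewrite -!mulrA -mulrDr; congr (_ * _).
  rewrite (@eq_Rintegral _ _ R leb setT (fun y => sin (dot w x) * (v y * cos (dot w y)) +
    - cos (dot w x) * (v y * sin (dot w y)))); last first.
    by move=> y _; rewrite dotBr sinB; ring.
  rewrite RintegralD; [|exact: measurableT| |]; last 2 first.
  - by apply: integrable_scale; exact: integrable_mul_cos.
  - by apply: integrable_scale; exact: integrable_mul_sin.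
  rewrite RintegralZl; [|exact: measurableT|exact: integrable_mul_cos].
  by rewrite RintegralZl; [rewrite mulNr mulrN|exact: measurableT|exact: integrable_mul_sin].
have i1 := integrable_mul_cos w iu; have i2 := integrable_mul_sin w iu.
have i3 : leb.-integrable setT (EFin \o (fun x => u x * sin (dot w x) * fcos v w)).
  by have := integrable_scale (fcos v w) i2; congr (integrable _ _ _); apply/funext => x /=; rewrite mulrC.
have i4 : leb.-integrable setT (EFin \o (fun x => u x * cos (dot w x) * - fsin v w)).
  by have := integrable_scale (- fsin v w) i1; congr (integrable _ _ _); apply/funext => x /=; rewrite mulrC.
rewrite RintegralD; [|exact: measurableT|exact: i3|exact: i4].
rewrite RintegralZr; [|exact: measurableT|exact: i2].
by rewrite RintegralZr; [|exact: measurableT|exact: i1].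
Qed.

Lemma integrable_xcorr u v : leb.-integrable setT (EFin \o u) -> sq_integrable u ->
  leb.-integrable setT (EFin \o v) -> sq_integrable v ->
  leb.-integrable setT (EFin \o xcorr u v).
Proof.
move=> iu u2 iv v2.
have [i _] := xcorr_test (phi := fun=> 1) iu iv (fun b => integrable_xcorr_term b u2 v2)
  (measurable_cst _) (fun b => eq_ind_r (fun r => is_true (r <= 1 :> R)) (lexx 1) (normr1 R)).
by move: i; congr (integrable _ _ _); apply/funext => b /=; rewrite mulr1.
Qed.

End correlation_L2.

HB.lock Definition cl_xcorr (R : realType) n (f k : 'cV[R]_n -> clifford R n) (b : 'cV[R]_n) :
  clifford R n := cl_integral (lebesgue_cV R n) (fun x => f x * k (x - b)).

Section clifford_correlation.
Variables (R : realType) (n : nat).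
Local Notation Cl := (clifford R n).
Local Notation Rn := 'cV[R]_n.
Local Notation leb := (lebesgue_cV R n).
Implicit Types (f k : Rn -> Cl).

Lemma cl_xcorrE f k b : cl_xcorr f k b = cl_integral leb (fun x => f x * k (x - b)).
Proof. by rewrite cl_xcorr.unlock. Qed.

Lemma cl_L2_sq f A : cl_L2 leb f -> sq_integrable (fun x => f x A).
Proof. by move=> fL; split; [exact: fL.1|exact: cl_L2_coef]. Qed.

Lemma cl_L2_shift k b : cl_L2 leb k -> cl_L2 leb (fun x => k (x - b)).
Proof.
move=> kL; apply: cl_L2_of_coef.
- move=> A; exact: (sq_integrable_shift b (cl_L2_sq A kL)).1.
- move=> A; exact: (sq_integrable_shift b (cl_L2_sq A kL)).2.
Qed.

Lemma cl_xcorrB f k1 k2 b : cl_L2 leb f -> cl_L2 leb k1 -> cl_L2 leb k2 ->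
  cl_xcorr f (fun x => k1 x - k2 x) b = cl_xcorr f k1 b - cl_xcorr f k2 b.
Proof.
move=> fL k1L k2L; rewrite !cl_xcorrE -cl_integralB; last 2 first.
- exact: cl_integrableM_L2 fL (cl_L2_shift b k1L).
- exact: cl_integrableM_L2 fL (cl_L2_shift b k2L).
by congr (cl_integral leb _); apply/funext => x; rewrite mulrBr.
Qed.

Lemma cl_xcorr_coef f k b C : cl_L2 leb f -> cl_L2 leb k ->
  cl_xcorr f k b C = \sum_A cl_sign R A (symd A C) *
    xcorr (fun x => f x A) (fun x => k x (symd A C)) b.
Proof.
move=> fL kL; rewrite cl_xcorrE ffunE.
have i1 A : leb.-integrable setT (EFin \o (fun x => f x A * k (x - b) (symd A C))).
  exact: (integrable_xcorr_term b (cl_L2_sq A fL) (cl_L2_sq (symd A C) kL)).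
rewrite (@eq_Rintegral _ _ R leb setT (fun x => \sum_A cl_sign R A (symd A C) *
    (f x A * k (x - b) (symd A C)))); last first.
  by move=> x _; rewrite cl_coefM; apply: eq_bigr => A _; rewrite mulrA.
rewrite Rintegral_sum; last by move=> A; exact: integrable_scale.
apply: eq_bigr => A _; rewrite RintegralZl; [|exact: measurableT|exact: i1].
by rewrite xcorrE.
Qed.

Lemma cl_measurable_xcorr f k : cl_L2 leb f -> cl_L2 leb k -> cl_measurable (cl_xcorr f k).
Proof.
move=> fL kL C; under eq_fun do rewrite (cl_xcorr_coef _ _ fL kL).
apply: measurable_sum => A; apply: measurable_funM; first exact: measurable_cst.
by apply: measurable_xcorr; [exact: fL.1|exact: kL.1].
Qed.

Lemma cl_integrable_xcorr f k : cl_integrable leb f -> cl_L2 leb f ->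
  cl_integrable leb k -> cl_L2 leb k -> cl_integrable leb (cl_xcorr f k).
Proof.
move=> fi fL ki kL C; rewrite (_ : (fun x => _) = EFin \o (fun b => \sum_A
    cl_sign R A (symd A C) * xcorr (fun x => f x A) (fun x => k x (symd A C)) b)).
  apply: integrable_sum_real => A; apply: integrable_scale; apply: integrable_xcorr.
  - exact: fi.
  - exact: cl_L2_sq.
  - exact: ki.
  - exact: cl_L2_sq.
by apply/funext => b /=; rewrite cl_xcorr_coef.
Qed.

Lemma cfc_xcorr f k w : cl_integrable leb f -> cl_L2 leb f ->
  cl_integrable leb k -> cl_L2 leb k ->
  cfc (cl_xcorr f k) w = cfc f w * cfc k w + cfs f w * cfs k w.
Proof.
move=> fi fL ki kL; apply/ffunP => C; rewrite cl_addE !cl_coefM -big_split /= cfc_coef.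
rewrite /fcos (@eq_Rintegral _ _ R leb setT (fun b => \sum_A cl_sign R A (symd A C) *
   (xcorr (fun x => f x A) (fun x => k x (symd A C)) b * cos (dot w b)))); last first.
  move=> b _; rewrite (cl_xcorr_coef _ _ fL kL) mulr_suml.
  by apply: eq_bigr => A _; rewrite mulrA.
have i1 A : leb.-integrable setT (EFin \o (fun b =>
    xcorr (fun x => f x A) (fun x => k x (symd A C)) b * cos (dot w b))).
  by apply: integrable_mul_cos; apply: integrable_xcorr;
    [exact: fi|exact: cl_L2_sq|exact: ki|exact: cl_L2_sq].
rewrite Rintegral_sum; last by move=> A; exact: integrable_scale.
apply: eq_bigr => A _; rewrite RintegralZl; [|exact: measurableT|exact: i1].
have := fcos_xcorr w (fi A) (cl_L2_sq A fL) (ki (symd A C)) (cl_L2_sq (symd A C) kL).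
by rewrite {1}/fcos => ->; rewrite !cfc_coef !cfs_coef mulrDr !mulrA.
Qed.

Lemma cfs_xcorr f k w : cl_integrable leb f -> cl_L2 leb f ->
  cl_integrable leb k -> cl_L2 leb k ->
  cfs (cl_xcorr f k) w = cfs f w * cfc k w - cfc f w * cfs k w.
Proof.
move=> fi fL ki kL; apply/ffunP => C; rewrite cl_subE !cl_coefM -sumrB cfs_coef.
rewrite /fsin (@eq_Rintegral _ _ R leb setT (fun b => \sum_A cl_sign R A (symd A C) *
   (xcorr (fun x => f x A) (fun x => k x (symd A C)) b * sin (dot w b)))); last first.
  move=> b _; rewrite (cl_xcorr_coef _ _ fL kL) mulr_suml.
  by apply: eq_bigr => A _; rewrite mulrA.
have i1 A : leb.-integrable setT (EFin \o (fun b =>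
    xcorr (fun x => f x A) (fun x => k x (symd A C)) b * sin (dot w b))).
  by apply: integrable_mul_sin; apply: integrable_xcorr;
    [exact: fi|exact: cl_L2_sq|exact: ki|exact: cl_L2_sq].
rewrite Rintegral_sum; last by move=> A; exact: integrable_scale.
apply: eq_bigr => A _; rewrite RintegralZl; [|exact: measurableT|exact: i1].
have := fsin_xcorr w (fi A) (cl_L2_sq A fL) (ki (symd A C)) (cl_L2_sq (symd A C) kL).
by rewrite {1}/fsin => ->; rewrite !cfc_coef !cfs_coef mulrBr !mulrA.
Qed.

Lemma cl_xcorr_young f : cl_integrable leb f -> cl_L2 leb f ->
  exists2 N : R, 0 <= N & forall k, cl_L2 leb k ->
    (cl_normL2 leb (cl_xcorr f k) <= N%:E * cl_normL2 leb k)%E.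
Proof.
move=> fi fL.
have /choice[N NP] : forall A, exists N : R, 0 <= N /\ forall v, sq_integrable v ->
    (\int[leb]_b (xcorr (fun x => f x A) v b ^+ 2)%:E <= N%:E * \int[leb]_x (v x ^+ 2)%:E)%E.
  by move=> A; have [N N0 NP] := xcorr_young (fi A) (cl_L2_sq A fL); exists N.
pose m : R := #|{set 'I_n}|%:R.
(* One [m] comes from Cauchy-Schwarz over the blades [A] of [f], the other counts the coefficients
   [C] of the result. *)
exists (m * m * \sum_A N A).
  by rewrite mulr_ge0 ?mulr_ge0 ?ler0n// sumr_ge0// => A _; exact: (NP A).1.
move=> k kL.
have m1 A C : measurable_fun setT (fun b => (xcorr (fun x => f x A) (fun x => k x (symd A C)) b ^+ 2)%:E).
  apply/measurable_EFinP; apply: measurable_funX.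
  by apply: measurable_xcorr; [exact: fL.1|exact: kL.1].
have p1 (a : R) : (0 <= (a ^+ 2)%:E)%E by rewrite lee_fin sqr_ge0.
have n0 := cl_normL2_ge0 leb k.
have kC B : (\int[leb]_x (k x B ^+ 2)%:E <= cl_normL2 leb k)%E.
  apply: ge0_le_integral.
  - exact: measurableT.
  - by move=> x _; exact: p1.
  - by apply/measurable_EFinP; apply: measurable_funX; exact: kL.1.
  - exact: measurable_sqnormE kL.1.
  - by move=> x _; rewrite lee_fin cl_sqnorm_coef.
apply: (@le_trans _ _ (\int[leb]_b (m%:E * \sum_C \sum_A
    (xcorr (fun x => f x A) (fun x => k x (symd A C)) b ^+ 2)%:E))%E).
  apply: ge0_le_integral.
  - exact: measurableT.
  - by move=> b _; rewrite lee_fin cl_sqnorm_ge0.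
  - exact: measurable_sqnormE (cl_measurable_xcorr fL kL).
  - apply: measurable_funeM; apply: emeasurable_sum => C; apply: emeasurable_sum => A.
    exact: m1.
  - move=> b _; under eq_bigr do rewrite sumEFin.
    rewrite sumEFin -EFinM lee_fin cl_sqnormE mulr_sumr; apply: ler_sum => C _.
    rewrite (cl_xcorr_coef _ _ fL kL); apply: le_trans (sqr_sum_le _) _.
    rewrite ler_wpM2l ?ler0n//; apply: ler_sum => A _.
    by rewrite exprMn expr2 cl_sign_sqr mul1r.
rewrite ge0_integralZl_EFin; last 4 first.
- exact: measurableT.
- by move=> b _; apply: sume_ge0 => C _; apply: sume_ge0 => A _; exact: p1.
- by apply: emeasurable_sum => C; apply: emeasurable_sum => A; exact: m1.
- exact: ler0n.
rewrite -mulrA EFinM -muleA; apply: lee_wpmul2l; first by rewrite lee_fin ler0n.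
rewrite ge0_integral_sum; last 3 first.
- exact: measurableT.
- by move=> C; apply: emeasurable_sum => A; exact: m1.
- by move=> C b _; apply: sume_ge0 => A _; exact: p1.
apply: (@le_trans _ _ (\sum_(C : {set 'I_n}) ((\sum_A N A)%:E * cl_normL2 leb k))%E).
  apply: lee_sum => C _; rewrite ge0_integral_sum; last 3 first.
  - exact: measurableT.
  - by move=> A; exact: m1.
  - by move=> A b _; exact: p1.
  rewrite -sumEFin ge0_sume_distrl; last by move=> A _; rewrite lee_fin (NP A).1.
  apply: lee_sum => A _.
  apply: (le_trans ((NP A).2 _ (cl_L2_sq (symd A C) kL))).
  by apply: lee_wpmul2l; [rewrite lee_fin (NP A).1|exact: kC].
have [r ->] : exists r : R, cl_normL2 leb k = r%:E.
  by exists (fine (cl_normL2 leb k)); rewrite fineK ?ge0_fin_numE//; exact: kL.2.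
rewrite -EFinM sumEFin -EFinM lee_fin sumr_const -[X in X <= _]mulr_natl.
by rewrite mulrA.
Qed.

Lemma cl_L2_xcorr f k : cl_integrable leb f -> cl_L2 leb f -> cl_L2 leb k ->
  cl_L2 leb (cl_xcorr f k).
Proof.
move=> fi fL kL; split; first exact: cl_measurable_xcorr.
have [N N0 NP] := cl_xcorr_young fi fL.
apply: (le_lt_trans (NP _ kL)).
by apply: lte_mul_pinfty; [rewrite lee_fin|by []|exact: kL.2].
Qed.

End clifford_correlation.

(** * Fourier transform of a correlation *)

Section sign_type.
Variables (R : realType) (n : nat).
Hypothesis n_mod4 : (n %% 4 = 2)%N \/ (n %% 4 = 3)%N.
Local Notation Cl := (clifford R n).
Local Notation Rn := 'cV[R]_n.
Local Notation leb := (lebesgue_cV R n).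
Local Notation i_n := (@cl_pseudoscalar R n).
Implicit Types (M N : Cl) (f h : Rn -> Cl).

(* s is 1 or -1, according to n mod 4 and the grades of the mother wavelet. *)
Definition i_commutes (s : R) M : Prop := i_n * M = s *: (M * i_n).

Lemma cl_sqnorm_i_mul M : cl_sqnorm (i_n * M) = cl_sqnorm M.
Proof.
by rewrite -cl_sqnorm_rev cl_revM (cl_rev_i R n_mod4) mulrN cl_sqnormN cl_sqnorm_mul_i cl_sqnorm_rev.
Qed.

Lemma i_commutes_rev s M : i_commutes s M -> s ^+ 2 = 1 -> i_commutes s (cl_rev M).
Proof.
rewrite /i_commutes => /(congr1 (@cl_rev R n)) + s1.
rewrite cl_revZ !cl_revM (cl_rev_i R n_mod4) mulrN mulNr scalerN => /oppr_inj ->.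
by rewrite scalerA -expr2 s1 scale1r.
Qed.

(* The projection onto the elements M with i_n M = s M i_n. *)
Definition cl_proj (s : R) M : Cl := 2^-1 *: (M + s *: (i_n * M * cl_rev i_n)).

Lemma cl_projE s M : cl_proj s M = 2^-1 *: M - (2^-1 * s) *: (i_n * M * i_n).
Proof. by rewrite /cl_proj (cl_rev_i R n_mod4) mulrN scalerN scalerBr scalerA. Qed.

Lemma cl_projB s M N : cl_proj s (M - N) = cl_proj s M - cl_proj s N.
Proof.
by rewrite !cl_projE mulrBr mulrBl !scalerBr !opprD addrACA.
Qed.

Lemma cl_proj_commutes s M : s ^+ 2 = 1 -> i_commutes s (cl_proj s M).
Proof.
move=> s1; rewrite /i_commutes cl_projE mulrBr mulrBl scalerBr -!scalerAr -!scalerAl !scalerA.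
rewrite !mulrA (cl_i_sqr R n_mod4) mulN1r mulNr -!mulrA (cl_i_sqr R n_mod4) !mulrN !mulr1.
rewrite !scalerN !opprK addrC mulrCA -expr2 s1 mulr1; congr (_ *: _ + _ *: _).
exact: mulrC.
Qed.

Lemma cl_proj_id s M : s ^+ 2 = 1 -> i_commutes s M -> cl_proj s M = M.
Proof.
move=> s1 iM; rewrite cl_projE iM -scalerAl -mulrA (cl_i_sqr R n_mod4) mulrN mulr1 !scalerN.
rewrite opprK scalerA -mulrA -expr2 s1 mulr1 -scalerDl (_ : 2^-1 + 2^-1 = 1) ?scale1r//.
by lra.
Qed.

Lemma cl_sqnorm_proj s M : s ^+ 2 = 1 -> cl_sqnorm (cl_proj s M) <= cl_sqnorm M.
Proof.
move=> s1; rewrite cl_projE; apply: (le_trans (cl_sqnormB_le2 _ _)).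
rewrite !cl_sqnormZ cl_sqnorm_mul_i cl_sqnorm_i_mul exprMn s1 mulr1 -mulr2n.
by rewrite mulrA -mulrnAl ler_piMl ?cl_sqnorm_ge0//; lra.
Qed.

Lemma cl_integrable_proj s f : cl_integrable leb f -> cl_integrable leb (fun x => cl_proj s (f x)).
Proof.
move=> fi; rewrite (_ : (fun x => _) = (fun x =>
    (2^-1)%:A * f x * 1 - ((2^-1 * s) *: i_n) * f x * i_n)).
  by apply: cl_integrableB; exact: cl_integrable_mul.
by apply/funext => x; rewrite cl_projE mulr1 -!scalerAl mul1r.
Qed.

Lemma cl_measurable_proj s f : cl_measurable f -> cl_measurable (fun x => cl_proj s (f x)).
Proof.
move=> mf; rewrite (_ : (fun x => _) = (fun x =>
    2^-1 *: f x - (2^-1 * s) *: (i_n * f x * i_n))).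
  apply: cl_measurableB; apply: cl_measurableZ; [exact: measurable_cst|exact: mf|exact: measurable_cst|].
  by apply: cl_measurableM; [apply: cl_measurableM => //|]; exact: cl_measurable_cst.
by apply/funext => x; rewrite cl_projE.
Qed.

Lemma cl_normL2_proj s f : s ^+ 2 = 1 -> cl_measurable f ->
  (cl_normL2 leb (fun x => cl_proj s (f x)) <= cl_normL2 leb f)%E.
Proof.
move=> s1 mf; rewrite -[X in (_ <= X)%E]mul1e; apply: cl_normL2_le.
- exact: ler01.
- exact: cl_measurable_proj.
- exact: mf.
- by move=> x; rewrite mul1r; exact: cl_sqnorm_proj.
Qed.

Lemma cl_L2_proj s f : s ^+ 2 = 1 -> cl_L2 leb f -> cl_L2 leb (fun x => cl_proj s (f x)).
Proof.
move=> s1 [mf fo]; split; first exact: cl_measurable_proj.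
exact: (le_lt_trans (cl_normL2_proj s1 mf) fo).
Qed.

Lemma cfc_proj s f w : cl_integrable leb f -> cfc (fun x => cl_proj s (f x)) w = cl_proj s (cfc f w).
Proof.
move=> fi; rewrite (_ : (fun x => _) = (fun x =>
    (2^-1)%:A * f x * 1 - ((2^-1 * s) *: i_n) * f x * i_n)); last first.
  by apply/funext => x; rewrite cl_projE mulr1 -!scalerAl mul1r.
rewrite cfcB; [|exact: cl_integrable_mul..].
by rewrite !cfc_mul// cl_projE mulr1 -!scalerAl mul1r.
Qed.

Lemma cfs_proj s f w : cl_integrable leb f -> cfs (fun x => cl_proj s (f x)) w = cl_proj s (cfs f w).
Proof.
move=> fi; rewrite (_ : (fun x => _) = (fun x =>
    (2^-1)%:A * f x * 1 - ((2^-1 * s) *: i_n) * f x * i_n)); last first.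
  by apply/funext => x; rewrite cl_projE mulr1 -!scalerAl mul1r.
rewrite cfsB; [|exact: cl_integrable_mul..].
by rewrite !cfs_mul// cl_projE mulr1 -!scalerAl mul1r.
Qed.

(** The values of [h] are fixed by the linear projection [cl_proj s], which passes through the
    integral. *)
Lemma cfc_commutes s h w : s ^+ 2 = 1 -> cl_integrable leb h -> (forall x, i_commutes s (h x)) ->
  i_commutes s (cfc h w).
Proof.
move=> s1 hi hs; rewrite (_ : h = fun x => cl_proj s (h x)); last first.
  by apply/funext => x; rewrite cl_proj_id.
by rewrite cfc_proj//; exact: cl_proj_commutes.
Qed.

Lemma cfs_commutes s h w : s ^+ 2 = 1 -> cl_integrable leb h -> (forall x, i_commutes s (h x)) ->
  i_commutes s (cfs h w).
Proof.
move=> s1 hi hs; rewrite (_ : h = fun x => cl_proj s (h x)); last first.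
  by apply/funext => x; rewrite cl_proj_id.
by rewrite cfs_proj//; exact: cl_proj_commutes.
Qed.

Lemma fourier_commutes s h w : s ^+ 2 = 1 -> cl_integrable leb h -> (forall x, i_commutes s (h x)) ->
  i_commutes s (cl_fourier h w).
Proof.
move=> s1 hi hs; rewrite (cl_fourierE n_mod4 _ hi).
have := cfc_commutes w s1 hi hs; have := cfs_commutes w s1 hi hs.
rewrite /i_commutes => hS hC.
by rewrite mulrBr mulrBl scalerBr hC mulrA hS -scalerAl.
Qed.

(** Reversal puts an [i_n] between the transforms of [f] and [h]. Moving it to the far right, past
    the transform of [h], is possible only up to the sign [s]. *)
Lemma fourier_mul_rev_fourier f h w s : s ^+ 2 = 1 ->
  cl_integrable leb f -> cl_L2 leb f -> cl_integrable leb h -> cl_L2 leb h ->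
  (forall x, i_commutes s (h x)) ->
  cl_fourier f w * cl_rev (cl_fourier h w) =
    cfc (cl_xcorr f (fun x => cl_rev (h x))) w -
    s *: (cfs (cl_xcorr f (fun x => cl_rev (h x))) w * i_n).
Proof.
move=> s1 fi fL hi hL hs.
have kL := cl_L2_rev hL.
have ki : cl_integrable leb (fun x => cl_rev (h x)).
  move=> A; have := integrable_scale (cl_sign R A A) (hi A).
  by congr (integrable _ _ _); apply/funext => x /=; rewrite cl_rev_coef.
rewrite (cfc_xcorr w fi fL ki kL) (cfs_xcorr w fi fL ki kL).
rewrite !(cfc_rev w hi) !(cfs_rev w hi).
rewrite (cl_fourierE n_mod4 _ fi) (cl_fourierE n_mod4 _ hi).
have := i_commutes_rev (cfc_commutes w s1 hi hs) s1.
have := i_commutes_rev (cfs_commutes w s1 hi hs) s1.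
rewrite cl_revB cl_revM (cl_rev_i R n_mod4) mulNr opprK /i_commutes.
(* What remains is [(a - b i)(u + i v) = (a u + b v) - s (b u - a v) i]. *)
move: (cfc f w) (cfs f w) (cl_rev (cfc h w)) (cl_rev (cfs h w)) => a b u v hv hu.
have biv : b * i_n * (i_n * v) = - (b * v).
  by rewrite mulrA -(mulrA b) (cl_i_sqr R n_mod4) mulrN mulr1 mulNr.
have biu : b * i_n * u = s *: (b * u * i_n) by rewrite -mulrA hu -scalerAr mulrA.
have aiv : a * (i_n * v) = s *: (a * v * i_n) by rewrite hv -scalerAr mulrA.
rewrite mulrDr !mulrBl biv biu aiv scalerBr opprK opprB.
rewrite -!addrA; congr (_ + _).
by rewrite addrC (addrC (s *: (a * v * i_n))) -addrA.
Qed.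

End sign_type.

(** * Fourier transforms defined as limits in L^2 *)

Section fourier_approximation.
Variables (R : realType) (n : nat).
Hypothesis n_mod4 : (n %% 4 = 2)%N \/ (n %% 4 = 3)%N.
Local Notation Cl := (clifford R n).
Local Notation Rn := 'cV[R]_n.
Local Notation leb := (lebesgue_cV R n).
Local Notation i_n := (@cl_pseudoscalar R n).
Implicit Types (f h hh : Rn -> Cl).

Lemma cl_normL2_pair s f h : s ^+ 2 = 1 ->
  cl_integrable leb f -> cl_L2 leb f -> cl_integrable leb h -> cl_L2 leb h ->
  (forall x, i_commutes s (h x)) ->
  (cl_normL2 leb (fun w => (cl_fourier f w * cl_rev (cl_fourier h w))%R) =
   (plancherel_const R n)%:E * cl_normL2 leb (cl_xcorr f (fun x => cl_rev (h x))))%E.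
Proof.
move=> s1 fi fL hi hL hs.
have ki : cl_integrable leb (fun x => cl_rev (h x)).
  move=> A; have := integrable_scale (cl_sign R A A) (hi A).
  by congr (integrable _ _ _); apply/funext => x /=; rewrite cl_rev_coef.
rewrite -(cl_plancherel_sign s1 (cl_integrable_xcorr fi fL ki (cl_L2_rev hL))
  (cl_L2_xcorr fi fL (cl_L2_rev hL))).
congr (cl_normL2 leb _); apply/funext => w.
exact: (fourier_mul_rev_fourier n_mod4 w s1 fi fL hi hL hs).
Qed.

Lemma cl_fourierB f h w : cl_integrable leb f -> cl_integrable leb h ->
  cl_fourier (fun x => f x - h x) w = cl_fourier f w - cl_fourier h w.
Proof.
move=> fi hi; rewrite (cl_fourierE n_mod4 _ (cl_integrableB fi hi)).
rewrite (cl_fourierE n_mod4 _ fi) (cl_fourierE n_mod4 _ hi).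
by rewrite (cfcB w fi hi) (cfsB w fi hi) mulrBl !opprD addrACA.
Qed.

(** Beyond [is_cl_fourierL2], the approximants have the sign [s] at every point, so that
    [fourier_mul_rev_fourier] applies to each of them. *)
Definition fourier_approx (s : R) h hh : Prop :=
  [/\ cl_L2 leb h, cl_L2 leb hh & exists e : nat -> Rn -> Cl,
    [/\ forall k, cl_integrable leb (e k) /\ cl_L2 leb (e k),
        forall k x, i_commutes s (e k x),
        vanishing (fun k => cl_normL2 leb (fun x => e k x - h x)) &
        vanishing (fun k => cl_normL2 leb (fun w => cl_fourier (e k) w - hh w))]].

(** The given approximants are replaced by their projections. The projection is a contraction fixing
    [h] almost everywhere, so they still converge to [h]. *)
Lemma fourier_approx_of s h hh : s ^+ 2 = 1 -> cl_L2 leb h -> is_cl_fourierL2 h hh ->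
  {ae leb, forall x, i_commutes s (h x)} -> fourier_approx s h hh.
Proof.
move=> s1 hL [hhL [u [uP uh uhh]]] hs; split; [exact: hL|exact: hhL|].
have vu := cvg0_vanishing uh; have vuu := cvg0_vanishing uhh.
exists (fun k x => cl_proj s (u k x)).
have eP k : cl_integrable leb (fun x => cl_proj s (u k x)) /\ cl_L2 leb (fun x => cl_proj s (u k x)).
  by split; [apply: cl_integrable_proj; [exact: n_mod4|exact: (uP k).2]
            |apply: cl_L2_proj; [exact: n_mod4|exact: s1|exact: (uP k).1]].
have mD k : cl_measurable (fun x => u k x - h x).
  by apply: cl_measurableB; [exact: (uP k).1.1|exact: hL.1].
have mE k : cl_measurable (fun x => cl_proj s (u k x) - h x).
  by apply: cl_measurableB; [exact: (eP k).2.1|exact: hL.1].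
have ve : vanishing (fun k => cl_normL2 leb (fun x => cl_proj s (u k x) - h x)).
  apply: vanishing_le vu => k.
  rewrite (_ : cl_normL2 leb (fun x => cl_proj s (u k x) - h x) =
               cl_normL2 leb (fun x => cl_proj s (u k x - h x))).
    exact: (cl_normL2_proj n_mod4 s1 (mD k)).
  apply: cl_normL2_ae.
  - exact: mE.
  - exact: (cl_measurable_proj n_mod4 s (mD k)).
  - by apply: filterS hs => x hx; rewrite (cl_projB n_mod4) (cl_proj_id n_mod4 s1 hx).
split; [exact: eP|by move=> k x; exact: (cl_proj_commutes n_mod4)|exact: ve|].
have c0 := ltW (plancherel_const_gt0 R n).
have two : 0 <= 2 :> R by [].
have Dn k : (0 <= cl_normL2 leb (fun x => cl_proj s (u k x) - h x)%R)%E by exact: cl_normL2_ge0.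
have Un k : (0 <= cl_normL2 leb (fun x => u k x - h x)%R)%E by exact: cl_normL2_ge0.
(* The change made by projecting tends to 0, hence by Plancherel so does its transform, and the
   limit [hh] is unaffected. *)
have veu : vanishing (fun k => cl_normL2 leb (fun x => cl_proj s (u k x) - u k x)).
  apply: (@vanishing_le _ _ (fun k => 2%:E * cl_normL2 leb (fun x => cl_proj s (u k x) - h x)%R +
     2%:E * cl_normL2 leb (fun x => u k x - h x)%R)%E); last first.
    exact: (vanishingD (vanishingZ two Dn ve) (vanishingZ two Un vu)).
  move=> k; apply: cl_normL2D_le; [exact: two|exact: two|exact: mE|exact: mD| |].
    by apply: cl_measurableB; [exact: (eP k).2.1|exact: (uP k).1.1].
  move=> x; apply: le_trans (cl_sqnormB_le2 _ _).
  by rewrite opprB addrA subrK.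
have mF k : cl_measurable (cl_fourier (u k)).
  exact: (cl_measurable_fourier n_mod4 (uP k).2).
have mFe k : cl_measurable (cl_fourier (fun x => cl_proj s (u k x))).
  exact: (cl_measurable_fourier n_mod4 (eP k).1).
apply: (@vanishing_le _ _ (fun k => 2%:E * ((plancherel_const R n)%:E *
    cl_normL2 leb (fun x => cl_proj s (u k x) - u k x)%R) +
    2%:E * cl_normL2 leb (fun w => cl_fourier (u k) w - hh w)%R)%E); last first.
  apply: vanishingD; last first.
    by apply: vanishingZ; [exact: two|move=> k; exact: cl_normL2_ge0|exact: vuu].
  apply: vanishingZ; [exact: two| |].
    by move=> k; apply: mule_ge0; [rewrite lee_fin|exact: cl_normL2_ge0].
  by apply: vanishingZ; [exact: c0|move=> k; exact: cl_normL2_ge0|exact: veu].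
move=> k.
rewrite -(cl_plancherel n_mod4 (cl_integrableB (eP k).1 (uP k).2) (cl_L2B (eP k).2 (uP k).1)).
apply: cl_normL2D_le; [exact: two|exact: two| | | |].
- exact: (cl_measurable_fourier n_mod4 (cl_integrableB (eP k).1 (uP k).2)).
- by apply: cl_measurableB; [exact: mF|exact: hhL.1].
- by apply: cl_measurableB; [exact: mFe|exact: hhL.1].
move=> w; rewrite (cl_fourierB w (eP k).1 (uP k).2).
by apply: le_trans (cl_sqnormD_le2 _ _); rewrite addrA subrK.
Qed.

Lemma vanishing_bound (a : \bar R) (v : nat -> \bar R) :
  (forall k, (a <= v k)%E) -> vanishing v -> (a <= 0)%E.
Proof.
move=> av vv; apply/lee_addgt0Pr => e e0; rewrite add0e.
by have [N _ /(_ N (leqnn N))] := vv _ e0; exact: le_trans (av _).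
Qed.

Lemma fourier_approx_commutes s h hh : s ^+ 2 = 1 -> fourier_approx s h hh ->
  {ae leb, forall w, i_commutes s (hh w)}.
Proof.
move=> s1 [hL hhL [e [eP es _ ve]]].
pose D w := i_n * hh w - s *: (hh w * i_n).
have mD : cl_measurable D.
  apply: cl_measurableB.
    by apply: cl_measurableM; [exact: cl_measurable_cst|exact: hhL.1].
  apply: cl_measurableZ; first exact: measurable_cst.
  by apply: cl_measurableM; [exact: hhL.1|exact: cl_measurable_cst].
have D0 : cl_normL2 leb D = 0%E.
  apply/eqP; rewrite eq_le cl_normL2_ge0 andbT.
  (* The defect [D] vanishes on the approximating transforms, so it is linear in the error; its two
     terms contribute 2 each. *)
  apply: (@vanishing_bound _ (fun k => 4%:E * cl_normL2 leb (fun w => cl_fourier (e k) w - hh w)%R)%E).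
    move=> k; apply: cl_normL2_le; [by []|exact: mD| |].
      apply: cl_measurableB; last exact: hhL.1.
      exact: (cl_measurable_fourier n_mod4 (eP k).1).
    move=> w; have := fourier_commutes n_mod4 w s1 (eP k).1 (es k).
    rewrite /D /i_commutes; move: (cl_fourier _ w) => E hE.
    have -> : i_n * hh w - s *: (hh w * i_n) =
        s *: ((E - hh w) * i_n) - i_n * (E - hh w).
      by rewrite mulrBl mulrBr hE scalerBr opprB [RHS]addrC addrA subrK.
    apply: (le_trans (cl_sqnormB_le2 _ _)).
    by rewrite cl_sqnormZ s1 mul1r cl_sqnorm_mul_i (cl_sqnorm_i_mul n_mod4); lra.
  by apply: vanishingZ; [by []|move=> k; exact: cl_normL2_ge0|exact: ve].
have := cl_normL2_eq0 mD D0; apply: filterS => w /eqP.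
by rewrite subr_eq0 => /eqP.
Qed.

(** Both sides are continuous in [h] for [L^2] because [f] is integrable: its transform is bounded,
    and Young's inequality controls the correlation. *)
Lemma fourier_approx_xcorr s f h hh : s ^+ 2 = 1 -> fourier_approx s h hh ->
  cl_integrable leb f -> cl_L2 leb f ->
  cl_L2 leb (fun w => cl_fourier f w * cl_rev (hh w)) /\
  (cl_normL2 leb (fun w => cl_fourier f w * cl_rev (hh w))%R =
   (plancherel_const R n)%:E * cl_normL2 leb (cl_xcorr f (fun x => cl_rev (h x))))%E.
Proof.
move=> s1 [hL hhL [e [eP es ve vee]]] fi fL.
have [N N0 NP] := cl_fourier_bounded n_mod4 fi.
have [K K0 KP] := cl_xcorr_young fi fL.
have c0 := ltW (plancherel_const_gt0 R n).
have mff := cl_measurable_fourier n_mod4 fi.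
pose m : R := #|{set 'I_n}|%:R.
have m0 : 0 <= m * N by rewrite mulr_ge0.
have bound hh1 : cl_measurable hh1 -> (cl_normL2 leb (fun w => cl_fourier f w * cl_rev (hh1 w))%R <=
    (m * N)%:E * cl_normL2 leb hh1)%E.
  move=> mh; apply: cl_normL2_le; [exact: m0| |exact: mh|].
    by apply: cl_measurableM; [exact: mff|exact: cl_measurable_rev].
  move=> w; apply: (le_trans (cl_sqnormM_le _ _)); rewrite cl_sqnorm_rev.
  by rewrite ler_wpM2r ?cl_sqnorm_ge0// ler_wpM2l.
have YL : cl_L2 leb (fun w => cl_fourier f w * cl_rev (hh w)).
  split; first by apply: cl_measurableM; [exact: mff|exact: (cl_measurable_rev hhL.1)].
  apply: (le_lt_trans (bound _ hhL.1)).
  by apply: lte_mul_pinfty; [rewrite lee_fin|by []|exact: hhL.2].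
have XL := cl_L2_xcorr fi fL (cl_L2_rev hL).
pose Xk k := cl_xcorr f (fun x => cl_rev (e k x)).
pose Yk k := fun w => cl_fourier f w * cl_rev (cl_fourier (e k) w).
have mXk k : cl_measurable (Xk k) by exact: (cl_L2_xcorr fi fL (cl_L2_rev (eP k).2)).1.
have mYk k : cl_measurable (Yk k).
  apply: cl_measurableM; [exact: mff|].
  by apply: cl_measurable_rev; exact: (cl_measurable_fourier n_mod4 (eP k).1).
have vX : vanishing (fun k => cl_normL2 leb (fun b => Xk k b - cl_xcorr f (fun x => cl_rev (h x)) b)).
  apply: (@vanishing_le _ _ (fun k => K%:E * cl_normL2 leb (fun x => e k x - h x)%R)%E); last first.
    by apply: vanishingZ; [exact: K0|move=> k; exact: cl_normL2_ge0|exact: ve].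
  move=> k.
  have -> : (fun b => Xk k b - cl_xcorr f (fun x => cl_rev (h x)) b) =
      cl_xcorr f (fun x => cl_rev (e k x - h x)).
    apply/funext => b; apply: etrans (esym (cl_xcorrB b fL (cl_L2_rev (eP k).2) (cl_L2_rev hL))) _.
    by congr (cl_xcorr f _ b); apply/funext => x; rewrite cl_revB.
  apply: (le_trans (KP _ (cl_L2_rev (cl_L2B (eP k).2 hL)))).
  apply: lee_wpmul2l; first by rewrite lee_fin.
  rewrite le_eqVlt; apply/orP; left; apply/eqP.
  by rewrite /cl_normL2; apply: eq_integral => x _; rewrite cl_sqnorm_rev.
have vY : vanishing (fun k => cl_normL2 leb (fun w => Yk k w - cl_fourier f w * cl_rev (hh w))).
  apply: (@vanishing_le _ _ (fun k => (m * N)%:E * cl_normL2 leb (fun w => cl_fourier (e k) w - hh w)%R)%E); last first.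
    by apply: vanishingZ; [exact: m0|move=> k; exact: cl_normL2_ge0|exact: vee].
  move=> k; have mB : cl_measurable (fun w => cl_fourier (e k) w - hh w).
    apply: cl_measurableB; last exact: hhL.1.
    exact: (cl_measurable_fourier n_mod4 (eP k).1).
  have -> : (fun w => Yk k w - cl_fourier f w * cl_rev (hh w)) =
      (fun w => cl_fourier f w * cl_rev (cl_fourier (e k) w - hh w)).
    by apply/funext => w; rewrite cl_revB mulrBr.
  exact: bound _ mB.
have XY k := cl_normL2_pair s1 fi fL (eP k).1 (eP k).2 (es k).
split; first exact: YL.
apply/eqP; rewrite eq_le; apply/andP; split.
  rewrite -[X in (X <= _)%E]mul1e.
  apply: (cl_normL2_limit_le (X_ := Yk) (Y_ := Xk)); [exact: ler01|exact: c0|exact: mYk|exact: mXk|exact: YL|exact: XL|exact: vY|exact: vX|].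
  by move=> k; rewrite mul1e le_eqVlt; apply/orP; left; apply/eqP; exact: XY.
rewrite -[X in (_ <= X)%E]mul1e.
apply: (cl_normL2_limit_le (X_ := Xk) (Y_ := Yk)); [exact: c0|exact: ler01|exact: mXk|exact: mYk|exact: XL|exact: YL|exact: vX|exact: vY|].
by move=> k; rewrite mul1e le_eqVlt; apply/orP; left; apply/eqP; symmetry; exact: XY.
Qed.

End fourier_approximation.

(** * Similitudes *)

Section dilation.
Variables (R : realType) (n : nat).
Hypothesis n_mod4 : (n %% 4 = 2)%N \/ (n %% 4 = 3)%N.
Local Notation Cl := (clifford R n).
Local Notation Rn := 'cV[R]_n.
Local Notation leb := (lebesgue_cV R n).
Implicit Types (f g h hh : Rn -> Cl) (phi : Rn -> Rn).

Lemma Rintegral_scales phi k (G : Rn -> R) : scales_lebesgue phi k ->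
  leb.-integrable setT (EFin \o G) -> \int[leb]_x G (phi x) = k * \int[leb]_x G x.
Proof.
move=> sk iG; apply: EFin_inj; rewrite EFinM (EFin_Rintegral iG).
rewrite -(integral_scales (F := EFin \o G) sk iG).
by rewrite -(EFin_Rintegral (u := fun x => G (phi x)))//; exact: (integrable_scales sk iG).
Qed.

Lemma cl_measurable_scales phi k (c : R) g : scales_lebesgue phi k -> cl_measurable g ->
  cl_measurable (fun x => c *: g (phi x)).
Proof.
move=> [mphi _ _] mg; apply: cl_measurableZ; first exact: measurable_cst.
by move=> A; exact: (measurableT_comp (mg A) mphi).
Qed.

Lemma cl_normL2_scales phi k (c : R) g : scales_lebesgue phi k -> cl_measurable g ->
  (cl_normL2 leb (fun x => c *: g (phi x))%R = (c ^+ 2 * k)%:E * cl_normL2 leb g)%E.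
Proof.
move=> sk mg; have [_ k0 _] := sk.
have m1 : cl_measurable (fun y => c *: g y).
  by apply: cl_measurableZ; [exact: measurable_cst|exact: mg].
rewrite /cl_normL2 (ge0_integral_scales (F := fun y => (cl_sqnorm (c *: g y))%:E) sk).
- rewrite mulrC EFinM -muleA; congr (_ * _)%E.
  rewrite -ge0_integralZl_EFin; last 4 first.
  + exact: measurableT.
  + by move=> x _; rewrite lee_fin cl_sqnorm_ge0.
  + exact: measurable_sqnormE.
  + exact: sqr_ge0.
  by apply: eq_integral => x _; rewrite cl_sqnormZ EFinM.
- exact: (measurable_sqnormE m1).
- by move=> x; rewrite lee_fin cl_sqnorm_ge0.
Qed.

Lemma cl_L2_scales phi k (c : R) g : scales_lebesgue phi k -> cl_L2 leb g ->
  cl_L2 leb (fun x => c *: g (phi x)).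
Proof.
move=> sk [mg go]; have [_ k0 _] := sk; split; first exact: cl_measurable_scales sk mg.
rewrite (cl_normL2_scales c sk mg); apply: lte_mul_pinfty; [|by []|exact: go].
by rewrite lee_fin mulr_ge0// sqr_ge0.
Qed.

Lemma cl_integrable_scales phi k (c : R) g : scales_lebesgue phi k -> cl_integrable leb g ->
  cl_integrable leb (fun x => c *: g (phi x)).
Proof.
move=> sk gi A; have := integrable_scale c (integrable_scales sk (gi A)).
by congr (integrable _ _ _); apply/funext => x /=; rewrite cl_scaleE.
Qed.

Section cf_scales.
Variables (phi dphi : Rn -> Rn) (k : R).
Hypotheses (phik : scales_lebesgue phi k) (phi_dot : forall w x, dot (dphi w) (phi x) = dot w x).

Lemma cfc_scales (c : R) g w : cl_integrable leb g ->
  cfc (fun x => c *: g (phi x)) w = (c * k) *: cfc g (dphi w).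
Proof.
move=> gi; apply/ffunP => A; rewrite cl_scaleE !cfc_coef /fcos.
have i1 := integrable_scale c (integrable_mul_cos (dphi w) (gi A)).
rewrite (@eq_Rintegral _ _ R leb setT (fun x =>
  (fun y => c * (g y A * cos (dot (dphi w) y))) (phi x))); last first.
  by move=> x _; rewrite cl_scaleE phi_dot mulrA.
rewrite (Rintegral_scales phik i1).
by rewrite RintegralZl; [rewrite mulrCA mulrA|exact: measurableT|exact: (integrable_mul_cos (dphi w) (gi A))].
Qed.

Lemma cfs_scales (c : R) g w : cl_integrable leb g ->
  cfs (fun x => c *: g (phi x)) w = (c * k) *: cfs g (dphi w).
Proof.
move=> gi; apply/ffunP => A; rewrite cl_scaleE !cfs_coef /fsin.
have i1 := integrable_scale c (integrable_mul_sin (dphi w) (gi A)).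
rewrite (@eq_Rintegral _ _ R leb setT (fun x =>
  (fun y => c * (g y A * sin (dot (dphi w) y))) (phi x))); last first.
  by move=> x _; rewrite cl_scaleE phi_dot mulrA.
rewrite (Rintegral_scales phik i1).
by rewrite RintegralZl; [rewrite mulrCA mulrA|exact: measurableT|exact: (integrable_mul_sin (dphi w) (gi A))].
Qed.

Lemma cl_fourier_scales (c : R) g w : cl_integrable leb g ->
  cl_fourier (fun x => c *: g (phi x)) w = (c * k) *: cl_fourier g (dphi w).
Proof.
move=> gi; rewrite (cl_fourierE n_mod4 _ gi) (cl_fourierE n_mod4 _ (cl_integrable_scales c phik gi)).
by rewrite (cfc_scales c w gi) (cfs_scales c w gi) scalerBr -scalerAl.
Qed.

(** Dilating the approximants gives the transform of each daughter wavelet from the one chosen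
    [psihat], without a new choice for each [(a, r)]. *)
Lemma fourier_approx_scales (l c s : R) h hh : scales_lebesgue dphi l ->
  fourier_approx s h hh ->
  fourier_approx s (fun x => c *: h (phi x)) (fun w => (c * k) *: hh (dphi w)).
Proof.
move=> dphil [hL hhL [e [eP es ve vee]]]; have [_ k0 _] := phik; have [_ l0 _] := dphil.
split; [exact: cl_L2_scales phik hL|exact: cl_L2_scales dphil hhL|].
exists (fun j x => c *: e j (phi x)); split.
- by move=> j; split; [exact: cl_integrable_scales phik (eP j).1|exact: cl_L2_scales phik (eP j).2].
- by move=> j x; rewrite /i_commutes -scalerAr es -scalerAl !scalerA mulrC.
- have c2 : 0 <= c ^+ 2 * k by rewrite mulr_ge0// sqr_ge0.
  apply: (@vanishing_le _ _ (fun j => (c ^+ 2 * k)%:E * cl_normL2 leb (fun x => e j x - h x)%R)%E); last first.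
    by apply: vanishingZ; [exact: c2|move=> j; exact: cl_normL2_ge0|exact: ve].
  move=> j; rewrite -(cl_normL2_scales c phik (cl_measurableB (eP j).2.1 hL.1)).
  have -> : (fun x => c *: e j (phi x) - c *: h (phi x)) = (fun x => c *: (e j (phi x) - h (phi x))).
    by apply/funext => x; rewrite scalerBr.
  exact: lexx.
have c2 : 0 <= (c * k) ^+ 2 * l by rewrite mulr_ge0// sqr_ge0.
apply: (@vanishing_le _ _ (fun j => ((c * k) ^+ 2 * l)%:E * cl_normL2 leb (fun w => cl_fourier (e j) w - hh w)%R)%E); last first.
  by apply: vanishingZ; [exact: c2|move=> j; exact: cl_normL2_ge0|exact: vee].
move=> j; have mB : cl_measurable (fun w => cl_fourier (e j) w - hh w).
  by apply: cl_measurableB; [exact: (cl_measurable_fourier n_mod4 (eP j).1)|exact: hhL.1].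
rewrite -(cl_normL2_scales (c * k) dphil mB).
have -> : (fun w => cl_fourier (fun x => c *: e j (phi x)) w - (c * k) *: hh (dphi w)) =
    (fun w => (c * k) *: (cl_fourier (e j) (dphi w) - hh (dphi w))).
  by apply/funext => w; rewrite (cl_fourier_scales c w (eP j).1) scalerBr.
exact: lexx.
Qed.

End cf_scales.

Lemma scales_similitude (a : R) (r : SO R n) : 0 < a ->
  scales_lebesgue (fun x : Rn => invmx r *m (a^-1 *: x)) (a ^+ n).
Proof.
move=> a0; have rr : invmx r *m (invmx r)^T = 1%:M by rewrite so_invmx trmxK so_trmx.
have := scales_lebesgue_comp (scales_rotation rr) (@scales_scale R n a^-1 (invr_neq0 (lt0r_neq0 a0))).
by rewrite mul1r ger0_norm ?invr_ge0 ?ltW// exprVn invrK.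
Qed.

Lemma scales_similitude_dual (a : R) (r : SO R n) : 0 < a ->
  scales_lebesgue (fun w : Rn => a *: (invmx r *m w)) (a ^- n).
Proof.
move=> a0; have rr : invmx r *m (invmx r)^T = 1%:M by rewrite so_invmx trmxK so_trmx.
have := scales_lebesgue_comp (@scales_scale R n a (lt0r_neq0 a0)) (scales_rotation rr).
by rewrite mulr1 gtr0_norm.
Qed.

Lemma dot_similitude (a : R) (r : SO R n) (w x : Rn) : 0 < a ->
  dot (a *: (invmx r *m w)) (invmx r *m (a^-1 *: x)) = dot w x.
Proof.
move=> a0; rewrite !dotE so_invmx linearZ /= trmx_mul trmxK -scalemxAl -!scalemxAr scalerA.
by rewrite divff ?scale1r ?gt_eqF// -mulmxA (mulmxA _ _ x) so_mx_tr mul1mx.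
Qed.

Lemma powR_half_sq (a : R) : 0 < a -> (a `^ (- (n%:R / 2))) ^+ 2 * a ^+ n = 1.
Proof.
move=> a0; rewrite -powR_mulrn ?powR_ge0// -powRrM mulNr divfK// powRN powR_mulrn ?ltW//.
by rewrite mulVf// expf_neq0// gt_eqF.
Qed.

Lemma wavelet_transform_xcorr (psi f : Rn -> Cl) a (r : SO R n) b :
  wavelet_transform psi f (a, r, b) =
  cl_xcorr f (fun x => cl_rev (a `^ (- (n%:R / 2)) *: psi (invmx r *m (a^-1 *: x)))) b.
Proof. by rewrite cl_xcorrE. Qed.

Lemma wavelet_slice (s : R) (psi psihat f : Rn -> Cl) a (r : SO R n) :
  s ^+ 2 = 1 -> fourier_approx s psi psihat -> cl_integrable leb f -> cl_L2 leb f -> 0 < a ->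
  ((plancherel_const R n)%:E * cl_normL2 leb (fun b => wavelet_transform psi f (a, r, b)) =
   \int[leb]_w (a ^+ n * cl_sqnorm (cl_fourier f w * cl_rev (psihat (a *: (invmx r *m w)))))%:E)%E.
Proof.
move=> s1 fa fi fL a0.
have := fourier_approx_scales (scales_similitude r a0) (fun w x => dot_similitude r w x a0)
  (a `^ (- (n%:R / 2))) (scales_similitude_dual r a0) fa.
move=> /(fun H => fourier_approx_xcorr n_mod4 s1 H fi fL)[_ E].
rewrite (_ : (fun b => wavelet_transform psi f (a, r, b)) =
  cl_xcorr f (fun x => cl_rev (a `^ (- (n%:R / 2)) *: psi (invmx r *m (a^-1 *: x))))); last first.
  by apply/funext => b; exact: wavelet_transform_xcorr.
rewrite -E /cl_normL2; apply: eq_integral => w _; congr EFin.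
rewrite cl_revZ -scalerAr cl_sqnormZ; congr (_ * _).
(* The normalization satisfies [k^2 p = 1], so the factor [(k p)^2] of the dilated transform is
   [p = a^n], the weight in the admissibility condition. *)
move: (powR_half_sq a0); move: (a `^ _) (a ^+ n) => k p kp.
by rewrite exprMn [p ^+ 2]expr2 mulrA kp mul1r.
Qed.

End dilation.

(** * Measurability over the similitude group *)

Section similitude_measurability.
Variables (R : realType) (n : nat).
Local Notation Cl := (clifford R n).
Local Notation Rn := 'cV[R]_n.
Local Notation leb := (lebesgue_cV R n).
Implicit Types (f psi : Rn -> Cl).

Lemma measurable_inv : measurable_fun setT (fun a : R => a^-1).
Proof.
rewrite -(setvU [set 0 : R]); apply/measurable_funU.
- exact: measurableC.
- exact: measurable_set1.
split; last exact: measurable_fun_set1.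
apply: open_continuous_measurable_fun.
  by apply: closed_openC; apply: accessible_closed_set1; exact: hausdorff_accessible.
by move=> a; rewrite inE /= => a0; apply: inv_continuous; exact/eqP.
Qed.

Lemma measurable_so_mx : measurable_fun setT (@so_mx R n).
Proof. by move=> _ B mB; rewrite setTI; exists B => //; rewrite setTI. Qed.

Context d (T : measurableType d).

Lemma measurable_inv_rotation (r : T -> SO R n) (v : T -> Rn) :
  measurable_fun setT r -> measurable_fun setT v ->
  measurable_fun setT (fun t => invmx (r t) *m v t).
Proof.
move=> mr mv; under eq_fun do rewrite so_invmx.
apply: measurable_mulmx; last exact: mv.
by apply: measurable_trmx; exact: (measurableT_comp measurable_so_mx mr).
Qed.

Lemma measurable_dual_similitude (a : T -> R) (r : T -> SO R n) (w : T -> Rn) :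
  measurable_fun setT a -> measurable_fun setT r -> measurable_fun setT w ->
  measurable_fun setT (fun t => a t *: (invmx (r t) *m w t)).
Proof. by move=> ma mr mw; apply: measurable_scalemx => //; exact: measurable_inv_rotation. Qed.

Lemma cl_measurable_daughter psi (a : T -> R) (r : T -> SO R n) (b x : T -> Rn) :
  cl_measurable psi ->
  measurable_fun setT a -> measurable_fun setT r -> measurable_fun setT b ->
  measurable_fun setT x ->
  cl_measurable (fun t => daughter psi (a t) (r t) (b t) (x t)).
Proof.
move=> mpsi ma mr mb mx; apply: cl_measurableZ.
  exact: (measurableT_comp (measurable_powR (- (n%:R / 2))) ma).
apply: cl_measurable_comp mpsi; apply: measurable_inv_rotation => //.
apply: measurable_scalemx; first exact: (measurableT_comp measurable_inv ma).
exact: measurable_submx.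
Qed.

End similitude_measurability.

Lemma ae_imply d (T : measurableType d) (R : realType) (mu : {measure set T -> \bar R})
  (P Q : T -> Prop) : {ae mu, forall x, P x} -> (forall x, P x -> Q x) -> {ae mu, forall x, Q x}.
Proof. by move=> hP PQ; apply: filterS hP. Qed.

Section wavelet_measurability.
Variables (R : realType) (n : nat) (theta : probability (SO R n) R).
Local Notation Cl := (clifford R n).
Local Notation Rn := 'cV[R]_n.
Local Notation leb := (lebesgue_cV R n).
Local Notation sr := (scale_rotation_measure theta).

Lemma cl_measurable_wavelet (psi f : Rn -> Cl) :
  cl_measurable psi -> cl_measurable f -> cl_measurable (wavelet_transform psi f).
Proof.
move=> mpsi mf A.
rewrite [X in measurable_fun _ X](_ : _ = (fun z => \int[leb]_x
  (f x * cl_rev (daughter psi z.1.1 z.1.2 z.2 x)) A)); last first.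
  by apply/funext => z; rewrite /wavelet_transform /cl_inner ffunE.
pose h (p : measurableTypeR R * SO R n * Rn * Rn) :=
  (f p.2 * cl_rev (daughter psi p.1.1.1 p.1.1.2 p.1.2 p.2)) A.
have mh : measurable_fun setT h.
  apply: (@cl_measurableM _ _ R n (fun p : measurableTypeR R * SO R n * Rn * Rn => f p.2)).
    by apply: cl_measurable_comp mf; exact: measurable_snd.
  apply: cl_measurable_rev; apply: cl_measurable_daughter => //.
  - by apply: measurableT_comp => //; apply: measurableT_comp.
  - by apply: measurableT_comp => //; apply: measurableT_comp.
  - by apply: measurableT_comp.
exact: (measurable_Rintegral leb mh).
Qed.

Lemma scale_rotation_ae_pos : {ae sr, forall s, 0 < s.1 :> R}.
Proof.
pose D := (`]-oo, 0%R]%classic : set (measurableTypeR R)) `*` [set: SO R n].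
have mI : measurable (`]-oo, 0%R]%classic : set (measurableTypeR R)) by exact: measurable_itv.
have E0 : @scale_measure R n `]-oo, 0%R]%classic = 0%E.
  rewrite /scale_measure (_ : _ `&` _ = set0) ?integral_set0//.
  by apply/seteqP; split => // a /= []; rewrite !in_itv/= andbT ltNge => ->.
exists D; split.
- exact: measurableX.
- apply: (etrans (product_measure1E _ _ mI measurableT)).
  by rewrite [X in (X * _)%E]E0 mul0e.
- by move=> [a r] /= /negP; rewrite -leNgt => a0; split => //=; rewrite in_itv.
Qed.

(** Lebesgue measure is not zero, so a frequency can be picked from almost every one. *)
Lemma leb_ae_exists (P : Rn -> Prop) : {ae leb, forall w, P w} -> exists w, P w.
Proof.
move=> [N [mN N0 PN]]; apply: contrapT => nP.
have NT : N = setT.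
  by apply/seteqP; split => // w _; apply: PN => Pw; apply: nP; exists w.
have := @lebesgue_cV_cube R n 1 ler01.
move=> cube1; have : (((2 * 1) ^+ n : R)%:E <= leb N)%E.
  rewrite NT -cube1; apply: le_measure; rewrite ?inE.
  - apply: (@measurable_box R n (fun=> `[(- 1)%R, 1%R]%classic)) => i; exact: measurable_itv.
  - exact: measurableT.
  - by [].
by rewrite N0 lee_fin leNgt exprn_gt0// mulr1.
Qed.

End wavelet_measurability.

(** * The energy identity *)

HB.lock Definition dual_dilate (R : realType) n (g : 'cV[R]_n -> clifford R n)
  (s : measurableTypeR R * SO R n) (w : 'cV[R]_n) : clifford R n :=
  g ((s.1 : R) *: (invmx s.2 *m w)).

Section clifford_form.
Variables (R : realType) (n : nat).
Hypothesis n_mod4 : (n %% 4 = 2)%N \/ (n %% 4 = 3)%N.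
Local Notation Cl := (clifford R n).
Local Notation i_n := (@cl_pseudoscalar R n).
Implicit Types (C M N : Cl).

Definition cl_form C M : R := cl_scalar (M * C * cl_rev M).

Lemma cl_formN C M : cl_form C (- M) = cl_form C M.
Proof. by rewrite /cl_form cl_revN !mulNr mulrN opprK. Qed.

Lemma cl_form_parallelogram C M N :
  cl_form C (M + N) + cl_form C (M - N) = 2 * (cl_form C M + cl_form C N).
Proof.
rewrite /cl_form cl_revB cl_revD !mulrDl !mulrDr !mulNr !mulrN !opprK !cl_scalarD.
have cN X : cl_scalar (- X) = - cl_scalar X by rewrite /cl_scalar cl_oppE.
rewrite !cN; move: (cl_scalar (M * C * cl_rev M)) (cl_scalar (N * C * cl_rev M)).
by move: (cl_scalar (M * C * cl_rev N)) (cl_scalar (N * C * cl_rev N)) => a b c d; lra.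
Qed.

Lemma cl_form_mul_i C M : i_commutes 1 C -> cl_form C (M * i_n) = cl_form C M.
Proof.
rewrite /i_commutes scale1r /cl_form cl_revM (cl_rev_i R n_mod4) => iC.
rewrite -(mulrA M) iC mulNr mulrN (mulrA M).
by rewrite -(mulrA (M * C)) (mulrA i_n i_n) (cl_i_sqr R n_mod4) mulN1r mulrN opprK.
Qed.

Lemma cl_measurable_form d (T : measurableType d) C (f : T -> Cl) : cl_measurable f ->
  measurable_fun setT (fun x => cl_form C (f x)).
Proof.
move=> mf; apply: measurable_cl_scalar.
apply: cl_measurableM; last exact: cl_measurable_rev.
by apply: cl_measurableM; [exact: mf|exact: cl_measurable_cst].
Qed.

End clifford_form.

(** * Consequences of admissibility for the constant *)

Section admissibility.
Variables (R : realType) (n : nat) (theta : probability (SO R n) R).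
Hypothesis n_mod4 : (n %% 4 = 2)%N \/ (n %% 4 = 3)%N.
Local Notation Cl := (clifford R n).
Local Notation Rn := 'cV[R]_n.
Local Notation leb := (lebesgue_cV R n).
Local Notation S := (measurableTypeR R * SO R n)%type.
Local Notation sr := (scale_rotation_measure theta).
Local Notation i_n := (@cl_pseudoscalar R n).
Implicit Types (p g : Rn -> Cl) (C M : Cl).

Lemma dual_dilateE p (s : S) w : dual_dilate p s w = p ((s.1 : R) *: (invmx s.2 *m w)).
Proof. by rewrite dual_dilate.unlock. Qed.

Lemma cl_measurable_dual_dilate p : cl_measurable p ->
  cl_measurable (fun z : S * Rn => dual_dilate p z.1 z.2).
Proof.
move=> mp; rewrite (_ : (fun z => _) = (fun z : S * Rn =>
    p ((z.1.1 : R) *: (invmx z.1.2 *m z.2)))); last first.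
  by apply/funext => z; rewrite dual_dilateE.
apply: cl_measurable_comp mp; apply: measurable_dual_similitude => //.
  by apply: measurableT_comp.
by apply: measurableT_comp.
Qed.

Lemma cl_measurable_dual_dilate1 p w : cl_measurable p ->
  cl_measurable (fun s : S => dual_dilate p s w).
Proof.
move=> mp A; exact: (measurableT_comp (cl_measurable_dual_dilate mp A) (measurable_pair2 w)).
Qed.

Definition admissible_at p C w : Prop :=
  cl_integrable sr (admissibility_integrand p w) /\
  cl_integral sr (admissibility_integrand p w) = C.

Lemma measurable_norm_scale : measurable_fun setT (fun s : S => `|s.1 : R| ^+ n).
Proof. by apply: measurable_funX; apply: (measurableT_comp (f := fun x : R => `|x|)) => //; exact: measurable_fst. Qed.

Lemma measurable_admissible_form p M w : cl_measurable p ->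
  measurable_fun setT (fun s : S => (`|s.1 : R| ^+ n * cl_sqnorm (M * cl_rev (dual_dilate p s w)))%:E).
Proof.
move=> mp; apply/measurable_EFinP; apply: measurable_funM; first exact: measurable_norm_scale.
apply: measurable_cl_sqnorm; apply: cl_measurableM; first exact: cl_measurable_cst.
by apply: cl_measurable_rev; exact: cl_measurable_dual_dilate1.
Qed.

(** The scalar part of [M p~ p M~] is the squared norm of [M p~]: the constant [C] is thereby opened
    into nonnegative integrals. *)
Lemma admissible_form p C w M : cl_measurable p -> admissible_at p C w ->
  (\int[sr]_s (`|s.1 : R| ^+ n * cl_sqnorm (M * cl_rev (dual_dilate p s w)))%:E = (cl_form C M)%:E)%E.
Proof.
move=> mp [pi pC].
have i1 : sr.-integrable setT (EFin \o (fun s => (M * admissibility_integrand p w s * cl_rev M) finset.set0)).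
  exact: (cl_integrable_mul M (cl_rev M) pi finset.set0).
have <- : (\int[sr]_s (M * admissibility_integrand p w s * cl_rev M) finset.set0 = cl_form C M)%R.
  have := cl_integral_mul M (cl_rev M) pi; rewrite pC => /(congr1 (@cl_scalar R n)).
  by rewrite {1}/cl_scalar ffunE.
rewrite (EFin_Rintegral i1).
apply: ae_eq_integral.
- exact: measurableT.
- exact: measurable_admissible_form.
- by apply/measurable_EFinP; exact: integrable_measurable i1.
apply: ae_imply (scale_rotation_ae_pos theta) _ => s s0 _; congr EFin.
rewrite gtr0_norm// /admissibility_integrand -dual_dilateE.
move: (dual_dilate p s w) => q.
rewrite /cl_sqnorm cl_revM cl_revK -scalerAr -scalerAl cl_scaleE; congr (_ * _).
by rewrite /cl_scalar !mulrA.
Qed.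

Lemma cl_form_ge0 p C w M : cl_measurable p -> admissible_at p C w -> 0 <= cl_form C M.
Proof.
move=> mp pw; rewrite -lee_fin -(admissible_form M mp pw); apply: integral_ge0 => s _.
by rewrite lee_fin mulr_ge0 ?exprn_ge0 ?cl_sqnorm_ge0.
Qed.

Lemma ge0_integral_eq0_ae d (T : measurableType d) (mu : {measure set T -> \bar R}) (F : T -> \bar R) :
  measurable_fun setT F -> (forall x, (0 <= F x)%E) -> (\int[mu]_x F x = 0)%E ->
  {ae mu, forall x, F x = 0%E}.
Proof.
move=> mF F0 IF; have /(ae_eq_integral_abs mu measurableT mF) : (\int[mu]_x `|F x| = 0)%E.
  by rewrite -[RHS]IF; apply: eq_integral => x _; rewrite gee0_abs.
by apply: filterS => x /(_ I).
Qed.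

Lemma integral_ae0 d (T : measurableType d) (mu : {measure set T -> \bar R}) (F : T -> \bar R) :
  measurable_fun setT F -> {ae mu, forall x, F x = 0%E} -> (\int[mu]_x F x = 0)%E.
Proof.
move=> mF F0; rewrite -[RHS](integral0 mu setT); apply: ae_eq_integral.
- exact: measurableT.
- exact: mF.
- exact: measurable_cst.
by apply: filterS F0 => x ->.
Qed.

(** For fixed [(a, r)] with [a > 0] the exceptional null set pulls back to a null set of
    frequencies. Tonelli, applied to the squared norm of the defect [D], exchanges the two
    quantifiers. *)
Lemma ae_dual_dilate_commutes (s0 : R) p : cl_measurable p -> {ae leb, forall w, i_commutes s0 (p w)} ->
  {ae leb, forall w, {ae sr, forall s, i_commutes s0 (dual_dilate p s w)}}.
Proof.
move=> mp hp.
pose D (M : Cl) := i_n * M - s0 *: (M * i_n).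
have mD d (T : measurableType d) (h : T -> Cl) : cl_measurable h -> cl_measurable (fun x => D (h x)).
  move=> mh; apply: cl_measurableB.
    by apply: cl_measurableM; [exact: cl_measurable_cst|exact: mh].
  apply: cl_measurableZ; first exact: measurable_cst.
  by apply: cl_measurableM; [exact: mh|exact: cl_measurable_cst].
have D0 : cl_normL2 leb (fun w => D (p w)) = 0%E.
  apply: integral_ae0.
    by apply: measurable_sqnormE; exact: mD.
  by apply: filterS hp => w hw; rewrite /D hw subrr cl_sqnorm0.
pose H (z : S * Rn) := (cl_sqnorm (D (dual_dilate p z.1 z.2)))%:E.
have mH : measurable_fun setT H.
  by apply: measurable_sqnormE; apply: mD; exact: cl_measurable_dual_dilate.
have H0 z : (0 <= H z)%E by rewrite lee_fin cl_sqnorm_ge0.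
have mF := measurable_fun_fubini_tonelli_F (m2 := leb) H mH H0.
have mG := measurable_fun_fubini_tonelli_G (m1 := sr) H mH H0.
have I0 : (\int[leb]_w \int[sr]_s H (s, w) = 0)%E.
  rewrite -(fubini_tonelli (m1 := sr) (m2 := leb) H mH H0).
  apply: integral_ae0; first exact: mF.
  apply: ae_imply (scale_rotation_ae_pos theta) _ => s spos.
  rewrite /fubini_F.
  have nn w : (0 <= (cl_sqnorm (D (p w)))%:E)%E by rewrite lee_fin cl_sqnorm_ge0.
  have E := ge0_integral_scales (F := fun w => (cl_sqnorm (D (p w)))%:E)
    (scales_similitude_dual s.2 spos) (measurable_sqnormE (mD _ _ _ mp)) nn.
  apply: etrans (etrans E _); last first.
    by apply: (etrans (congr1 (fun y => _ * y)%E D0)); rewrite mule0.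
  by apply: eq_integral => w _; rewrite /H dual_dilateE.
have := ge0_integral_eq0_ae mG (fun w => integral_ge0 _ (fun s _ => H0 (s, w))) I0.
apply: filterS => w Iw.
have := cl_normL2_eq0 (mD _ _ _ (cl_measurable_dual_dilate1 w mp)) Iw.
by move=> h; apply: ae_imply h _ => s /eqP; rewrite subr_eq0 => /eqP.
Qed.

(** Passing [i_n] through [p~] and then through [p] gives the factor [s0 ^+ 2 = 1], for either
    sign. *)
Lemma admissible_commutes (s0 : R) p C w : s0 ^+ 2 = 1 -> admissible_at p C w ->
  {ae sr, forall s, i_commutes s0 (dual_dilate p s w)} -> i_commutes 1 C.
Proof.
move=> s1 [pi pC] hw; rewrite /i_commutes scale1r.
have := cl_integral_mul 1 i_n pi; have := cl_integral_mul i_n 1 pi.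
rewrite pC mulr1 mul1r => <- <-; apply/ffunP => A; rewrite !ffunE /Rintegral; congr fine.
apply: ae_eq_integral.
- exact: measurableT.
- exact: measurable_int (cl_integrable_mul i_n 1 pi A).
- exact: measurable_int (cl_integrable_mul 1 i_n pi A).
apply: ae_imply hw _ => s + _; rewrite /admissibility_integrand -dual_dilateE mulr1 mul1r.
move: (dual_dilate p s w) => q hq; have hq' := i_commutes_rev n_mod4 hq s1.
rewrite -scalerAl -scalerAr.
suff -> : i_n * (cl_rev q * q) = cl_rev q * q * i_n by [].
rewrite mulrA hq' -scalerAl -(mulrA _ i_n q) hq -scalerAr scalerA -expr2 s1 scale1r.
by rewrite mulrA.
Qed.

End admissibility.

Section energy_identity.
Variables (R : realType) (n : nat) (theta : probability (SO R n) R).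
Hypothesis n_mod4 : (n %% 4 = 2)%N \/ (n %% 4 = 3)%N.
Local Notation Cl := (clifford R n).
Local Notation Rn := 'cV[R]_n.
Local Notation leb := (lebesgue_cV R n).
Local Notation S := (measurableTypeR R * SO R n)%type.
Local Notation sr := (scale_rotation_measure theta).
Local Notation sm := (similitude_measure theta).
Local Notation i_n := (@cl_pseudoscalar R n).
Implicit Types (p f g psi : Rn -> Cl) (C M : Cl).

(* |a| rather than a: the integrand has to be nonnegative also for a < 0, which is
   a null set. *)
Let slice_density (p g : Rn -> Cl) (z : S * Rn) : \bar R :=
  (`|z.1.1 : R| ^+ n * cl_sqnorm (g z.2 * cl_rev (dual_dilate p z.1 z.2)))%:E.

Lemma measurable_slice_density p g : cl_measurable p -> cl_measurable g ->
  measurable_fun setT (slice_density p g).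
Proof.
move=> mp mg; apply/measurable_EFinP; apply: measurable_funM.
  exact: (measurableT_comp (@measurable_norm_scale R n) measurable_fst).
apply: measurable_cl_sqnorm; apply: cl_measurableM.
  by apply: cl_measurable_comp mg; exact: measurable_snd.
by apply: cl_measurable_rev; exact: cl_measurable_dual_dilate.
Qed.

Lemma slice_density_ge0 p g z : (0 <= slice_density p g z)%E.
Proof. by rewrite lee_fin mulr_ge0 ?exprn_ge0 ?cl_sqnorm_ge0. Qed.

Lemma integral_slice_density p g C : cl_measurable p -> cl_measurable g ->
  {ae leb, forall w, admissible_at theta p C w} -> (forall M, 0 <= cl_form C M) ->
  (\int[sr]_s \int[leb]_w slice_density p g (s, w) = \int[leb]_w (cl_form C (g w))%:E)%E.
Proof.
move=> mp mg pC C0; have mH := measurable_slice_density mp mg.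
have H0 := slice_density_ge0 p g.
apply: etrans (fubini_tonelli (m1 := sr) (m2 := leb) _ mH H0) _.
apply: ge0_ae_eq_integral.
- exact: measurableT.
- exact: (measurable_fun_fubini_tonelli_G (m1 := sr) _ mH H0).
- by apply/measurable_EFinP; exact: cl_measurable_form.
- by move=> w _; apply: integral_ge0 => s _; exact: H0.
- by move=> w _; rewrite lee_fin.
apply: ae_imply pC _ => w pw _; exact: (admissible_form (g w) mp pw).
Qed.

(** In contrast to [slice_density], the frequency in [p] is frozen at [w0]; for each [(a, r)] the
    function [g] is only multiplied by a constant on the right. *)
Let at_density p w0 g (z : S * Rn) : \bar R :=
  (`|z.1.1 : R| ^+ n * cl_sqnorm (g z.2 * cl_rev (dual_dilate p z.1 w0)))%:E.

Lemma measurable_at_density p w0 g : cl_measurable p -> cl_measurable g ->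
  measurable_fun setT (at_density p w0 g).
Proof.
move=> mp mg; apply/measurable_EFinP; apply: measurable_funM.
  exact: (measurableT_comp (@measurable_norm_scale R n) measurable_fst).
apply: measurable_cl_sqnorm; apply: cl_measurableM.
  by apply: cl_measurable_comp mg; exact: measurable_snd.
apply: cl_measurable_rev => A.
exact: (measurableT_comp (cl_measurable_dual_dilate1 w0 mp A) measurable_fst).
Qed.

Lemma at_density_ge0 p w0 g z : (0 <= at_density p w0 g z)%E.
Proof. by rewrite lee_fin mulr_ge0 ?exprn_ge0 ?cl_sqnorm_ge0. Qed.

Lemma integral_form_at p g C w0 : cl_measurable p -> cl_measurable g ->
  admissible_at theta p C w0 ->
  (\int[leb]_x (cl_form C (g x))%:E = \int[sr]_s \int[leb]_x at_density p w0 g (s, x))%E.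
Proof.
move=> mp mg pw; have mH := measurable_at_density w0 mp mg.
have H0 := at_density_ge0 p w0 g.
apply: etrans (esym (fubini_tonelli (m1 := sr) (m2 := leb) _ mH H0)).
by apply: eq_integral => x _; rewrite -(admissible_form (g x) mp pw).
Qed.

(** The constant [N] comes out of both transforms on the right, so this is the unweighted Parseval
    identity for [f N]. *)
Lemma at_density_parseval p w0 f s : cl_measurable p -> cl_integrable leb f -> cl_L2 leb f ->
  (\int[leb]_w at_density p w0 (cfc f) (s, w) + \int[leb]_w at_density p w0 (cfs f) (s, w) =
   (plancherel_const R n)%:E * \int[leb]_x at_density p w0 f (s, x))%E.
Proof.
move=> mp fi fL; set N := cl_rev (dual_dilate p s w0); set k := `|s.1 : R| ^+ n.
have k0 : 0 <= k by exact: exprn_ge0.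
have fNi : cl_integrable leb (fun x => f x * N) by exact: cl_integrableMr.
have fNL : cl_L2 leb (fun x => f x * N).
  by have := cl_L2_mul 1 N fL; congr (cl_L2 _ _); apply/funext => x; rewrite mul1r.
have mfc := cl_measurable_cfc fL.1; have mfs := cl_measurable_cfs fL.1.
have m1 g : cl_measurable g -> measurable_fun setT (fun x => at_density p w0 g (s, x)).
  by move=> mg; exact: (measurableT_comp (measurable_at_density w0 mp mg) (measurable_pair1 s)).
rewrite -ge0_integralD; last 5 first.
- exact: measurableT.
- by move=> w _; exact: at_density_ge0.
- exact: m1.
- by move=> w _; exact: at_density_ge0.
- exact: m1.
have E : (\int[leb]_x at_density p w0 f (s, x) = k%:E * cl_normL2 leb (fun x => f x * N)%R)%E.
  rewrite /cl_normL2 -ge0_integralZl_EFin; last 4 first.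
  - exact: measurableT.
  - by move=> x _; rewrite lee_fin cl_sqnorm_ge0.
  - exact: measurable_sqnormE fNL.1.
  - exact: k0.
  by apply: eq_integral => x _; rewrite -EFinM.
rewrite E muleCA -(cl_parseval fNi fNL) -ge0_integralZl_EFin; last 4 first.
- exact: measurableT.
- by move=> x _; rewrite lee_fin addr_ge0// cl_sqnorm_ge0.
- apply/measurable_EFinP; apply: measurable_funD; apply: measurable_cl_sqnorm.
    exact: cl_measurable_cfc fNL.1.
  exact: cl_measurable_cfs fNL.1.
- exact: k0.
apply: eq_integral => w _; rewrite -EFinM -EFinD; congr EFin.
have mulE g : (fun x => g x * N) = (fun x => 1 * g x * N) by apply/funext => x; rewrite mul1r.
by rewrite mulE (cfc_mul 1 N w fi) (cfs_mul 1 N w fi) !mul1r mulrDr.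
Qed.

Lemma cl_form_fourier C f : (forall M, 0 <= cl_form C M) -> i_commutes 1 C ->
  cl_integrable leb f ->
  (\int[leb]_w (cl_form C (cl_fourier f w))%:E =
   \int[leb]_w (cl_form C (cfc f w))%:E + \int[leb]_w (cl_form C (cfs f w))%:E)%E.
Proof.
move=> C0 iC fi; have mf := cl_integrable_measurable fi.
have mc : measurable_fun setT (fun w => cl_form C (cfc f w)).
  by apply: cl_measurable_form; exact: cl_measurable_cfc.
have ms : measurable_fun setT (fun w => cl_form C (cfs f w)).
  by apply: cl_measurable_form; exact: cl_measurable_cfs.
rewrite -ge0_integralD; last 5 first.
- exact: measurableT.
- by move=> w _; rewrite lee_fin.
- exact/measurable_EFinP.
- by move=> w _; rewrite lee_fin.
- exact/measurable_EFinP.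
rewrite (integral_reflect (G := fun w => cl_form C (cfc f w) + cl_form C (cfs f w))).
- by [].
- by apply: cl_measurable_form; exact: (cl_measurable_fourier n_mod4 fi).
- by apply: measurable_funD.
- by move=> w; exact: C0.
- by move=> w; rewrite addr_ge0.
move=> w; rewrite !(cl_fourierE n_mod4 _ fi) cfcN (cfsN _ fi) mulNr opprK addrC.
by rewrite cl_form_parallelogram (cl_form_mul_i n_mod4).
Qed.

Lemma wavelet_energy s0 psi psihat f C : s0 ^+ 2 = 1 -> fourier_approx s0 psi psihat ->
  {ae leb, forall w, admissible_at theta psihat C w} ->
  cl_integrable leb f -> cl_L2 leb f ->
  (cl_normL2 sm (wavelet_transform psi f) = \int[leb]_x (cl_form C (f x))%:E)%E.
Proof.
move=> s1 fa pC fi fL; have [[mpsi _] [mp _] _] := fa.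
(* One [w0] is now chosen at which admissibility holds and almost all dilates of [psihat] have the
   sign [s0]. *)
have [mf _] := fL.
have cm := ae_dual_dilate_commutes theta mp (fourier_approx_commutes n_mod4 s1 fa).
have [w0 [pw0 tw0]] : exists w, admissible_at theta psihat C w /\
    {ae sr, forall s, i_commutes s0 (dual_dilate psihat s w)}.
  by apply: leb_ae_exists; apply: filterS2 pC cm.
have iC := admissible_commutes n_mod4 s1 pw0 tw0.
have C0 M := cl_form_ge0 M mp pw0.
have c0 := plancherel_const_gt0 R n.
have mT := cl_measurable_wavelet mpsi mf.
have mT2 := measurable_sqnormE mT.
have T0 z : (0 <= (cl_sqnorm (wavelet_transform psi f z))%:E)%E by rewrite lee_fin cl_sqnorm_ge0.
have mN := measurable_fun_fubini_tonelli_F (m2 := leb) _ mT2 T0.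
have mfc := cl_measurable_cfc mf; have mfs := cl_measurable_cfs mf.
have E1 : ((plancherel_const R n)%:E * cl_normL2 sm (wavelet_transform psi f) =
    \int[leb]_w (cl_form C (cl_fourier f w))%:E)%E.
  rewrite -(integral_slice_density mp (cl_measurable_fourier n_mod4 fi) pC C0).
  rewrite /cl_normL2 /similitude_measure (fubini_tonelli1 _ mT2 T0).
  rewrite -ge0_integralZl_EFin; last 4 first.
  - exact: measurableT.
  - by move=> s _; apply: integral_ge0 => b _; exact: T0.
  - exact: mN.
  - exact: ltW.
  have mH := measurable_slice_density mp (cl_measurable_fourier n_mod4 fi).
  have H0 := slice_density_ge0 psihat (cl_fourier f).
  apply: ge0_ae_eq_integral.
  - exact: measurableT.
  - by apply: measurable_funeM; exact: mN.
  - exact: (measurable_fun_fubini_tonelli_F (m2 := leb) _ mH H0).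
  - move=> s _; apply: mule_ge0; first by rewrite lee_fin ltW.
    by apply: integral_ge0 => b _; exact: T0.
  - by move=> s _; apply: integral_ge0 => w _; exact: H0.
  apply: ae_imply (scale_rotation_ae_pos theta) _ => -[a r] /= a0 _.
  apply: etrans (wavelet_slice n_mod4 r s1 fa fi fL a0) _.
  by apply: eq_integral => w _; rewrite /slice_density /= dual_dilateE gtr0_norm.
have E2 : (\int[leb]_w (cl_form C (cl_fourier f w))%:E =
    (plancherel_const R n)%:E * \int[leb]_x (cl_form C (f x))%:E)%E.
  rewrite (cl_form_fourier C0 iC fi) (integral_form_at mp mfc pw0) (integral_form_at mp mfs pw0).
  rewrite (integral_form_at mp mf pw0).
  have mF g : cl_measurable g ->
      measurable_fun setT (fun s => \int[leb]_x at_density psihat w0 g (s, x))%E.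
    move=> mg; exact: (measurable_fun_fubini_tonelli_F (m2 := leb) _
      (measurable_at_density w0 mp mg) (at_density_ge0 psihat w0 g)).
  have F0 g s : (0 <= \int[leb]_x at_density psihat w0 g (s, x))%E.
    by apply: integral_ge0 => x _; exact: at_density_ge0.
  rewrite -ge0_integralD; last 5 first.
  - exact: measurableT.
  - by move=> s _; exact: F0.
  - exact: mF.
  - by move=> s _; exact: F0.
  - exact: mF.
  rewrite -ge0_integralZl_EFin; last 4 first.
  - exact: measurableT.
  - by move=> s _; exact: F0.
  - exact: mF.
  - exact: ltW.
  by apply: eq_integral => s _; exact: at_density_parseval.
have inj (a b : \bar R) : ((plancherel_const R n)%:E * a = (plancherel_const R n)%:E * b)%E -> a = b.
  move=> /(congr1 (fun y => (plancherel_const R n)^-1%:E * y)%E).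
  by rewrite !muleA -!EFinM mulVf ?gt_eqF// !mul1e.
exact: inj _ _ (etrans E1 E2).
Qed.

End energy_identity.

(** * Extension to L^2 *)

Section truncation.
Variables (R : realType) (n : nat).
Local Notation Cl := (clifford R n).
Local Notation Rn := 'cV[R]_n.
Local Notation leb := (lebesgue_cV R n).
Implicit Types (f : Rn -> Cl).

Definition cube (j : nat) : set Rn := [set x | forall i, `[(- j%:R)%R, j%:R]%classic (x i ord0)].

Definition trunc_cube (j : nat) f (x : Rn) : Cl := (\1_(cube j) x : R) *: f x.

Lemma measurable_cube j : measurable (cube j).
Proof.
apply: (@measurable_box R n (fun=> `[(- j%:R)%R, j%:R]%classic)) => i; exact: measurable_itv.
Qed.

Lemma cube_near (x : Rn) : \forall j \near \oo, cube j x.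
Proof.
exists (Num.trunc (\sum_i `|x i ord0|)).+1 => // j /= hj i.
rewrite /= in_itv /= -ler_norml.
have h : \sum_i `|x i ord0| <= j%:R.
  apply: ltW; apply: (lt_le_trans (truncnS_gt _)); by rewrite ler_nat.
apply: le_trans h; rewrite (bigD1 i)//= lerDl.
by apply: sumr_ge0 => k _.
Qed.

Lemma trunc_cube_near f x : \forall j \near \oo, trunc_cube j f x = f x.
Proof.
have := cube_near x; apply: filterS => j xj.
by rewrite /trunc_cube indicE mem_set// scale1r.
Qed.

Lemma trunc_cubeP j f x : trunc_cube j f x = f x \/ trunc_cube j f x = 0.
Proof.
rewrite /trunc_cube indicE; case: (x \in cube j); first by left; rewrite scale1r.
by right; rewrite scale0r.
Qed.

Lemma cl_measurable_trunc j f : cl_measurable f -> cl_measurable (trunc_cube j f).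
Proof.
by move=> mf; apply: cl_measurableZ; [apply: measurable_indic; exact: measurable_cube|exact: mf].
Qed.

Lemma cl_L2_trunc j f : cl_L2 leb f -> cl_L2 leb (trunc_cube j f).
Proof.
move=> [mf fo]; split; first exact: cl_measurable_trunc.
apply: le_lt_trans fo; rewrite -[X in (_ <= X)%E]mul1e; apply: cl_normL2_le.
- exact: ler01.
- exact: cl_measurable_trunc.
- exact: mf.
- move=> x; rewrite mul1r; have [->|->] := trunc_cubeP j f x; first exact: lexx.
  by rewrite cl_sqnorm0 cl_sqnorm_ge0.
Qed.

Lemma cl_integrable_trunc j f : cl_L2 leb f -> cl_integrable leb (trunc_cube j f).
Proof.
move=> fL A; have m1 : measurable_fun setT (fun x : Rn => \1_(cube j) x : R).
  by apply: measurable_indic; exact: measurable_cube.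
have := @integrable_mul_L2 _ _ R leb (fun x : Rn => \1_(cube j) x : R) (fun x => f x A) m1 (fL.1 A).
rewrite (_ : (\int[leb]_x ((\1_(cube j) x : R) ^+ 2)%:E)%E = leb (cube j)); last first.
  rewrite -(setIT (cube j)) -(integral_indic leb measurableT (measurable_cube j)).
  apply: eq_integral => x _; congr EFin; rewrite setIT indicE.
  by case: (x \in cube j); rewrite ?expr1n ?expr0n.
rewrite lebesgue_cV_cube ?ler0n// => /(_ (ltry _) (cl_L2_coef A fL)).
by congr (integrable _ _ _); apply/funext => x /=; rewrite cl_scaleE.
Qed.

Lemma Rintegral_trunc_cvg (h : Rn -> R) : leb.-integrable setT (EFin \o h) ->
  (fun j => \int[leb]_x (\1_(cube j) x * h x)) @ \oo --> \int[leb]_x h x.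
Proof.
move=> ih; apply: fine_cvg.
rewrite (EFin_Rintegral ih).
have m1 j : measurable_fun setT (fun x : Rn => \1_(cube j) x : R).
  by apply: measurable_indic; exact: measurable_cube.
apply: (@dominated_cvg _ _ R leb setT measurableT
  (fun j x => (\1_(cube j) x * h x)%:E) (fun x => (h x)%:E) (fun x => `|h x|%:E)).
- by move=> j; apply/measurable_EFinP; apply: measurable_funM; [exact: m1|exact: integrable_measurable ih].
- move=> x _; apply: cvg_near_cst; have := cube_near x; apply: filterS => j xj.
  by rewrite indicE mem_set// mul1r.
- by [].
- exact: integrable_norm ih.
- move=> j x _; rewrite abse_EFin lee_fin normrM indicE.
  by case: (x \in cube j); rewrite ?normr1 ?mul1r// normr0 mul0r.
Qed.

End truncation.

(** * Linearity and truncation of the wavelet transform *)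

Section transform_linearity.
Variables (R : realType) (n : nat) (theta : probability (SO R n) R).
Local Notation Cl := (clifford R n).
Local Notation Rn := 'cV[R]_n.
Local Notation leb := (lebesgue_cV R n).
Local Notation S := (measurableTypeR R * SO R n)%type.
Local Notation sm := (similitude_measure theta).
Implicit Types (f g psi : Rn -> Cl) (z : S * Rn).

Lemma similitude_ae_pos : {ae sm, forall z, 0 < z.1.1 :> R}.
Proof.
have [N [mN N0 PN]] := scale_rotation_ae_pos theta.
exists (N `*` setT); split.
- exact: measurableX.
- apply: (etrans (product_measure1E _ _ mN measurableT)).
  by rewrite [X in (X * _)%E]N0 mul0e.
- by move=> [s b] /= h; split => //; apply: PN.
Qed.

Lemma cl_L2_daughter psi z : cl_L2 leb psi -> 0 < z.1.1 :> R ->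
  cl_L2 leb (fun x => daughter psi z.1.1 z.1.2 z.2 x).
Proof.
move=> psiL a0.
have := cl_L2_scales (z.1.1 `^ (- (n%:R / 2))) (scales_similitude z.1.2 a0) psiL.
exact: cl_L2_shift.
Qed.

Lemma integrable_wavelet psi f z : cl_L2 leb psi -> 0 < z.1.1 :> R -> cl_L2 leb f ->
  cl_integrable leb (fun x => f x * cl_rev (daughter psi z.1.1 z.1.2 z.2 x)).
Proof.
by move=> psiL a0 fL; exact: cl_integrableM_L2 fL (cl_L2_rev (cl_L2_daughter psiL a0)).
Qed.

Lemma wavelet_transformD psi f g z : cl_L2 leb psi -> 0 < z.1.1 :> R ->
  cl_L2 leb f -> cl_L2 leb g ->
  wavelet_transform psi (fun x => f x + g x) z = wavelet_transform psi f z + wavelet_transform psi g z.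
Proof.
move=> psiL a0 fL gL.
apply: etrans (cl_integralD (integrable_wavelet psiL a0 fL) (integrable_wavelet psiL a0 gL)).
by congr (cl_integral leb _); apply/funext => x; rewrite mulrDl.
Qed.

Lemma wavelet_transformB psi f g z : cl_L2 leb psi -> 0 < z.1.1 :> R ->
  cl_L2 leb f -> cl_L2 leb g ->
  wavelet_transform psi (fun x => f x - g x) z = wavelet_transform psi f z - wavelet_transform psi g z.
Proof.
move=> psiL a0 fL gL.
apply: etrans (cl_integralB (integrable_wavelet psiL a0 fL) (integrable_wavelet psiL a0 gL)).
by congr (cl_integral leb _); apply/funext => x; rewrite mulrBl.
Qed.

Lemma wavelet_transformMl psi f M z : cl_L2 leb psi -> 0 < z.1.1 :> R -> cl_L2 leb f ->
  wavelet_transform psi (fun x => M * f x) z = M * wavelet_transform psi f z.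
Proof.
move=> psiL a0 fL.
have := cl_integral_mul M 1 (integrable_wavelet psiL a0 fL); rewrite mulr1.
by apply: etrans; congr (cl_integral leb _); apply/funext => x; rewrite mulr1 mulrA.
Qed.

(** For [a > 0] the daughter wavelet is in [L^2], so its product with [f] is integrable and
    dominates the truncated products. *)
Lemma wavelet_trunc_cvg psi f z : cl_L2 leb psi -> 0 < z.1.1 :> R -> cl_L2 leb f ->
  (fun j => (cl_sqnorm (wavelet_transform psi (trunc_cube j f) z))%:E) @ \oo -->
  (cl_sqnorm (wavelet_transform psi f z))%:E.
Proof.
move=> psiL a0 fL; apply: cvg_EFin; first by apply: nearW.
rewrite [X in X @ _ --> _](_ : _ = fun j => \sum_A wavelet_transform psi (trunc_cube j f) z A ^+ 2); last first.
  by apply/funext => j /=; rewrite cl_sqnormE.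
rewrite cl_sqnormE; apply: cvg_big => [|A _]; first exact: add_continuous.
have c1 : (fun j => wavelet_transform psi (trunc_cube j f) z A) @ \oo --> wavelet_transform psi f z A.
  rewrite [X in X @ _ --> _](_ : _ = fun j => \int[leb]_x (\1_(cube j) x *
      (f x * cl_rev (daughter psi z.1.1 z.1.2 z.2 x)) A)); last first.
    apply/funext => j; rewrite /wavelet_transform /cl_inner ffunE; apply: eq_Rintegral => x _.
    by rewrite /trunc_cube -scalerAl cl_scaleE.
  have := Rintegral_trunc_cvg (integrable_wavelet psiL a0 fL A).
  by rewrite /wavelet_transform /cl_inner ffunE.
rewrite expr2; under eq_fun do rewrite expr2.
exact: cvgM.
Qed.

Lemma limn_einf_trunc psi f z : cl_L2 leb psi -> 0 < z.1.1 :> R -> cl_L2 leb f ->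
  limn_einf (fun j => (cl_sqnorm (wavelet_transform psi (trunc_cube j f) z))%:E) =
  (cl_sqnorm (wavelet_transform psi f z))%:E.
Proof.
by move=> psiL a0 fL; have [] := cvg_limn_einf_sup (wavelet_trunc_cvg psiL a0 fL).
Qed.

Lemma cl_normL2_parallelogram d (T : measurableType d) (mu : {measure set T -> \bar R}) (X Y : T -> Cl) :
  cl_measurable X -> cl_measurable Y ->
  (cl_normL2 mu (fun t => X t + Y t)%R + cl_normL2 mu (fun t => X t - Y t)%R =
   2%:E * cl_normL2 mu X + 2%:E * cl_normL2 mu Y)%E.
Proof.
move=> mX mY.
have two (Z : T -> Cl) : cl_measurable Z ->
    (2%:E * cl_normL2 mu Z = \int[mu]_t (2 * cl_sqnorm (Z t))%:E)%E.
  move=> mZ; rewrite /cl_normL2 -ge0_integralZl_EFin; last 4 first.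
  - exact: measurableT.
  - by move=> t _; rewrite lee_fin cl_sqnorm_ge0.
  - exact: measurable_sqnormE mZ.
  - by [].
  by apply: eq_integral => t _; rewrite EFinM.
have addI (F G : T -> R) : measurable_fun setT F -> measurable_fun setT G ->
    (forall t, 0 <= F t) -> (forall t, 0 <= G t) ->
    (\int[mu]_t (F t + G t)%:E = \int[mu]_t (F t)%:E + \int[mu]_t (G t)%:E)%E.
  move=> mF mG F0 G0; rewrite -ge0_integralD; last 5 first.
  - exact: measurableT.
  - by move=> t _; rewrite lee_fin.
  - exact/measurable_EFinP.
  - by move=> t _; rewrite lee_fin.
  - exact/measurable_EFinP.
  by apply: eq_integral => t _; rewrite EFinD.
have m2 (Z : T -> Cl) : cl_measurable Z -> measurable_fun setT (fun t => 2 * cl_sqnorm (Z t)).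
  by move=> mZ; apply: measurable_funM; [exact: measurable_cst|exact: measurable_cl_sqnorm].
have p2 (Z : T -> Cl) t : 0 <= 2 * cl_sqnorm (Z t) by rewrite mulr_ge0// cl_sqnorm_ge0.
apply: etrans (esym (addI _ _ (measurable_cl_sqnorm (cl_measurableD mX mY))
  (measurable_cl_sqnorm (cl_measurableB mX mY)) (fun t => cl_sqnorm_ge0 _) (fun t => cl_sqnorm_ge0 _))) _.
apply: esym; apply: etrans (congr2 (fun a b => (a + b)%E) (two X mX) (two Y mY)) _.
apply: etrans (esym (addI _ _ (m2 X mX) (m2 Y mY) (p2 X) (p2 Y))) _.
apply: eq_integral => t _; congr EFin; symmetry; exact: cl_sqnorm_parallelogram.
Qed.

End transform_linearity.

Section energy_L2.
Variables (R : realType) (n : nat) (theta : probability (SO R n) R).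
Hypothesis n_mod4 : (n %% 4 = 2)%N \/ (n %% 4 = 3)%N.
Local Notation Cl := (clifford R n).
Local Notation Rn := 'cV[R]_n.
Local Notation leb := (lebesgue_cV R n).
Local Notation S := (measurableTypeR R * SO R n)%type.
Local Notation sm := (similitude_measure theta).
Implicit Types (f g : Rn -> Cl) (z : S * Rn).

Lemma cl_form_le (C M : Cl) :
  cl_form C M <= (#|{set 'I_n}|%:R * cl_sqnorm C + 1) * cl_sqnorm M.
Proof.
have h : cl_form C M <= cl_sqnorm (M * C) + cl_sqnorm M.
  rewrite /cl_form cl_scalarMrev !cl_sqnormE -big_split; apply: ler_sum => A _ /=.
  by have := sqr_ge0 ((M * C) A - M A); have := sqr_ge0 ((M * C) A + M A); rewrite sqrrB sqrrD; lra.
apply: (le_trans h); rewrite mulrDl mul1r lerD2r.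
by apply: (le_trans (cl_sqnormM_le _ _)); rewrite mulrAC.
Qed.

Variables (psi psihat : Rn -> Cl) (C : Cl) (s0 : R).
Hypotheses (s1 : s0 ^+ 2 = 1) (fa : fourier_approx s0 psi psihat).
Hypothesis pC : {ae leb, forall w, admissible_at theta psihat C w}.

Lemma admissible_form_ge0 M : 0 <= cl_form C M.
Proof.
have [w pw] := leb_ae_exists pC; have [_ [mp _] _] := fa.
exact: cl_form_ge0 M mp pw.
Qed.

Let Q f : \bar R := (\int[leb]_x (cl_form C (f x))%:E)%E.

Lemma measurable_formE f : cl_measurable f -> measurable_fun setT (fun x => (cl_form C (f x))%:E).
Proof. by move=> mf; apply/measurable_EFinP; exact: cl_measurable_form. Qed.

Lemma integral_form_lty f : cl_L2 leb f -> (Q f < +oo)%E.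
Proof.
move=> [mf fo].
have K0 : 0 <= #|{set 'I_n}|%:R * cl_sqnorm C + 1 :> R.
  by rewrite addr_ge0// mulr_ge0// cl_sqnorm_ge0.
apply: (@le_lt_trans _ _ ((#|{set 'I_n}|%:R * cl_sqnorm C + 1)%:E * cl_normL2 leb f)%E); last first.
  by apply: lte_mul_pinfty; [rewrite lee_fin|by []|exact: fo].
rewrite /cl_normL2 -ge0_integralZl_EFin; last 4 first.
- exact: measurableT.
- by move=> x _; rewrite lee_fin cl_sqnorm_ge0.
- exact: measurable_sqnormE mf.
- exact: K0.
apply: ge0_le_integral.
- exact: measurableT.
- by move=> x _; rewrite lee_fin; exact: admissible_form_ge0.
- exact: measurable_formE.
- by apply: measurable_funeM; exact: measurable_sqnormE mf.
- by move=> x _; rewrite -EFinM lee_fin; exact: cl_form_le.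
Qed.

Lemma cl_form0 : cl_form C 0 = 0.
Proof. by rewrite /cl_form !mul0r /cl_scalar cl_zeroE. Qed.

Lemma integral_form_trunc_le j f : cl_measurable f -> (Q (trunc_cube j f) <= Q f)%E.
Proof.
move=> mf; apply: ge0_le_integral.
- exact: measurableT.
- by move=> x _; rewrite lee_fin; exact: admissible_form_ge0.
- by apply: measurable_formE; exact: cl_measurable_trunc.
- exact: measurable_formE.
move=> x _; rewrite lee_fin; have [->|->] := trunc_cubeP j f x; first exact: lexx.
by rewrite cl_form0; exact: admissible_form_ge0.
Qed.

Lemma wavelet_energy_trunc j f : cl_L2 leb f ->
  cl_normL2 sm (wavelet_transform psi (trunc_cube j f)) = Q (trunc_cube j f).
Proof.
by move=> fL; exact: (wavelet_energy n_mod4 s1 fa pC (cl_integrable_trunc j fL) (cl_L2_trunc j fL)).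
Qed.

Lemma wavelet_energy_le f : cl_L2 leb f -> (cl_normL2 sm (wavelet_transform psi f) <= Q f)%E.
Proof.
move=> fL; have [psiL _ _] := fa.
have mT g : cl_measurable g -> measurable_fun setT (fun z => (cl_sqnorm (wavelet_transform psi g z))%:E).
  by move=> mg; exact: measurable_sqnormE (cl_measurable_wavelet psiL.1 mg).
have mTj j := mT _ (cl_measurable_trunc j fL.1).
have T0 (g : Rn -> Cl) z : (0 <= (cl_sqnorm (wavelet_transform psi g z))%:E)%E by rewrite lee_fin cl_sqnorm_ge0.
apply: (@le_trans _ _ (\int[sm]_z limn_einf (fun j =>
    (cl_sqnorm (wavelet_transform psi (trunc_cube j f) z))%:E))%E).
  (* The limit is identified only where [a > 0], hence an almost everywhere equality in place of a
     pointwise bound. *)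
  rewrite le_eqVlt; apply/orP; left; apply/eqP; apply: ge0_ae_eq_integral.
  - exact: measurableT.
  - exact: mT fL.1.
  - exact: measurable_limn_einf mTj.
  - by move=> z _; exact: T0.
  - by move=> z _; apply: limn_einf_ge; apply: nearW => j; exact: T0.
  apply: ae_imply (similitude_ae_pos theta) _ => z z0 _.
  by rewrite (limn_einf_trunc psiL z0 fL).
apply: (le_trans (fatou sm measurableT mTj (fun j z _ => T0 _ z))).
apply: limn_einf_le => j.
apply: le_trans (integral_form_trunc_le j fL.1).
by rewrite le_eqVlt; apply/orP; left; apply/eqP; exact: wavelet_energy_trunc.
Qed.

Lemma wavelet_L2 f : cl_L2 leb f -> cl_L2 sm (wavelet_transform psi f).
Proof.
move=> fL; have [psiL _ _] := fa; split; first exact: cl_measurable_wavelet psiL.1 fL.1.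
exact: (le_lt_trans (wavelet_energy_le fL) (integral_form_lty fL)).
Qed.

Lemma wavelet_normL2D f g : cl_L2 leb f -> cl_L2 leb g ->
  cl_normL2 sm (wavelet_transform psi (fun x => f x + g x)) =
  cl_normL2 sm (fun z => wavelet_transform psi f z + wavelet_transform psi g z).
Proof.
move=> fL gL; have [psiL _ _] := fa; apply: cl_normL2_ae.
- exact: cl_measurable_wavelet psiL.1 (cl_L2D fL gL).1.
- by apply: cl_measurableD; [exact: (wavelet_L2 fL).1|exact: (wavelet_L2 gL).1].
by apply: ae_imply (similitude_ae_pos theta) _ => z z0; exact: wavelet_transformD psiL z0 fL gL.
Qed.

Lemma wavelet_normL2B f g : cl_L2 leb f -> cl_L2 leb g ->
  cl_normL2 sm (wavelet_transform psi (fun x => f x - g x)) =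
  cl_normL2 sm (fun z => wavelet_transform psi f z - wavelet_transform psi g z).
Proof.
move=> fL gL; have [psiL _ _] := fa; apply: cl_normL2_ae.
- exact: cl_measurable_wavelet psiL.1 (cl_L2B fL gL).1.
- by apply: cl_measurableB; [exact: (wavelet_L2 fL).1|exact: (wavelet_L2 gL).1].
by apply: ae_imply (similitude_ae_pos theta) _ => z z0; exact: wavelet_transformB psiL z0 fL gL.
Qed.

(* [f - trunc] and [trunc] have disjoint supports, so flipping the sign of one of
   them preserves the right-hand side; the parallelogram law then turns the upper
   bound [wavelet_energy_le] into a lower bound. *)
Lemma integral_form_trunc_energy j f : cl_L2 leb f ->
  (2%:E * Q (trunc_cube j f) <= cl_normL2 sm (wavelet_transform psi f) + Q f)%E.
Proof.
move=> fL; have tL := cl_L2_trunc j fL; have rL := cl_L2B fL tL.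
rewrite -(wavelet_energy_trunc j fL).
apply: (@le_trans _ _ (2%:E * cl_normL2 sm (wavelet_transform psi (trunc_cube j f)) +
   2%:E * cl_normL2 sm (wavelet_transform psi (fun x => f x - trunc_cube j f x)%R))%E).
  by apply: leeDl; apply: mule_ge0; [by []|exact: cl_normL2_ge0].
rewrite -(cl_normL2_parallelogram sm (wavelet_L2 tL).1 (wavelet_L2 rL).1).
apply: leeD.
  rewrite -(wavelet_normL2D tL rL).
  have -> : (fun x => trunc_cube j f x + (f x - trunc_cube j f x)) = f.
    by apply/funext => x; rewrite addrC subrK.
  exact: lexx.
rewrite -(wavelet_normL2B tL rL).
apply: (le_trans (wavelet_energy_le (cl_L2B tL rL))).
rewrite le_eqVlt; apply/orP; left; apply/eqP; apply: eq_integral => x _; congr EFin.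
have [->|->] := trunc_cubeP j f x; first by rewrite subrr subr0.
by rewrite subr0 sub0r cl_formN.
Qed.

Lemma wavelet_energy_L2 f : cl_L2 leb f -> cl_normL2 sm (wavelet_transform psi f) = Q f.
Proof.
move=> fL; apply/eqP; rewrite eq_le (wavelet_energy_le fL) /=.
have [q qE] : exists q : R, Q f = q%:E.
  exists (fine (Q f)); rewrite fineK// ge0_fin_numE; first exact: integral_form_lty.
  by apply: integral_ge0 => x _; rewrite lee_fin; exact: admissible_form_ge0.
have [e eE] : exists e : R, cl_normL2 sm (wavelet_transform psi f) = e%:E.
  exists (fine (cl_normL2 sm (wavelet_transform psi f))); rewrite fineK// ge0_fin_numE.
    exact: (wavelet_L2 fL).2.
  exact: cl_normL2_ge0.
(* With [e] the energy of the transform, truncation and Fatou give [q <= (e + q) / 2], that is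
   [q <= e]. Finiteness of both numbers is essential here. *)
have Qj j : (Q (trunc_cube j f) <= ((e + q) / 2)%:E)%E.
  have := integral_form_trunc_energy j fL; rewrite eE qE -EFinD.
  have : (Q (trunc_cube j f) < +oo)%E by exact: integral_form_lty (cl_L2_trunc j fL).
  have : (0 <= Q (trunc_cube j f))%E.
    by apply: integral_ge0 => x _; rewrite lee_fin; exact: admissible_form_ge0.
  move: (Q (trunc_cube j f)) => [t| |] // _ _; rewrite -EFinM !lee_fin; lra.
have Qf : (Q f <= ((e + q) / 2)%:E)%E.
  have mF j : measurable_fun setT (fun x => (cl_form C (trunc_cube j f x))%:E).
    by apply: measurable_formE; exact: cl_measurable_trunc fL.1.
  apply: (@le_trans _ _ (\int[leb]_x limn_einf (fun j => (cl_form C (trunc_cube j f x))%:E))%E).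
    apply: ge0_le_integral.
    - exact: measurableT.
    - by move=> x _; rewrite lee_fin; exact: admissible_form_ge0.
    - exact: measurable_formE fL.1.
    - exact: measurable_limn_einf mF.
    move=> x _; apply: limn_einf_ge; have := trunc_cube_near f x.
    by apply: filterS => j ->.
  apply: (le_trans (fatou leb measurableT mF _)).
    by move=> j x _; rewrite lee_fin; exact: admissible_form_ge0.
  by apply: limn_einf_le.
rewrite eE qE lee_fin; move: Qf; rewrite qE lee_fin; lra.
Qed.

End energy_L2.

(** * The inner product relation *)

Section graded_commutation.
Variables (R : realType) (n : nat).
Local Notation Cl := (clifford R n).
Local Notation i_n := (@cl_pseudoscalar R n).
Implicit Types (M : Cl).

Lemma cl_mul_i_coef M A : M (symd finset.setT A) = 0 -> (M * i_n) A = 0.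
Proof.
move=> MA; have [b ->] := cl_pseudoscalarE R n.
rewrite -scalerAr cl_scaleE cl_coefM big1 ?mulr0// => B _.
rewrite [cl_blade _ _ _]ffunE; case: eqP => [E|]; last by rewrite mulr0.
suff -> : B = symd finset.setT A by rewrite MA mulr0 mul0r.
by rewrite -E -symdA symdd symds0.
Qed.

Lemma cl_even_coef M (A : {set 'I_n}) : cl_even M -> odd #|A| -> M A = 0.
Proof. by move=> eM /eM /(congr1 (fun N : Cl => N A)); rewrite cl_zeroE ffunE eqxx. Qed.

Lemma cl_odd_coef M (A : {set 'I_n}) : cl_odd M -> ~~ odd #|A| -> M A = 0.
Proof. by move=> eM /eM /(congr1 (fun N : Cl => N A)); rewrite cl_zeroE ffunE eqxx. Qed.

(** For odd [n] the exponent [(n - 1) |B|] is even: [i_n] is central, so every value has sign 1. *)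
Lemma i_commutes_odd_dim M : odd n -> i_commutes 1 M.
Proof.
move=> on; apply/ffunP => A; rewrite scale1r cl_pseudoscalar_comm -signr_odd oddM.
by rewrite -(negbK (odd n.-1)) -[~~ odd _]/(odd n.-1.+1) prednK ?odd_gt0// on mul1r.
Qed.

Lemma i_commutes_even M : ~~ odd n -> cl_even M -> i_commutes 1 M.
Proof.
move=> en eM; apply/ffunP => A; rewrite scale1r cl_pseudoscalar_comm.
case: (boolP (odd #|symd finset.setT A|)) => oA.
  by rewrite (cl_mul_i_coef (cl_even_coef eM oA)) mulr0.
by rewrite -signr_odd oddM (negPf oA) andbF mul1r.
Qed.

Lemma i_commutes_odd M : (0 < n)%N -> ~~ odd n -> cl_odd M -> i_commutes (-1) M.
Proof.
move=> n0 en eM; apply/ffunP => A; rewrite cl_scaleE cl_pseudoscalar_comm.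
case: (boolP (odd #|symd finset.setT A|)) => oA; last first.
  by rewrite (cl_mul_i_coef (cl_odd_coef eM oA)) !mulr0.
rewrite -signr_odd oddM oA andbT.
by rewrite -(negbK (odd n.-1)) -[~~ odd _]/(odd n.-1.+1) prednK// en.
Qed.

End graded_commutation.

(** * Polarization and recovery of all coefficients *)

Section polarization.
Variables (R : realType) (n : nat) (theta : probability (SO R n) R).
Hypothesis n_mod4 : (n %% 4 = 2)%N \/ (n %% 4 = 3)%N.
Local Notation Cl := (clifford R n).
Local Notation Rn := 'cV[R]_n.
Local Notation leb := (lebesgue_cV R n).
Local Notation S := (measurableTypeR R * SO R n)%type.
Local Notation sm := (similitude_measure theta).
Implicit Types (f g : Rn -> Cl) (z : S * Rn).

(** The polarization identity is kept as a sum, so that no extended reals are subtracted. *)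
Lemma integral_polar d (T : measurableType d) (mu : {measure set T -> \bar R}) (u v w : T -> R) :
  mu.-integrable setT (EFin \o u) -> mu.-integrable setT (EFin \o v) ->
  (forall x, w x = 4 * u x + v x) ->
  (\int[mu]_x (w x)%:E = (4 * \int[mu]_x u x)%:E + \int[mu]_x (v x)%:E)%E.
Proof.
move=> iu iv wE; rewrite EFinM (EFin_Rintegral iu) -integralZl; [|exact: measurableT|exact: iu].
rewrite -integralD; [|exact: measurableT| |exact: iv]; last first.
  exact: (integrable_scale 4 iu).
by apply: eq_integral => x _; rewrite wE EFinD EFinM.
Qed.

Lemma cl_sqnorm_polar (M N : Cl) :
  cl_sqnorm (M + N) = 4 * cl_scalar (M * cl_rev N) + cl_sqnorm (M - N).
Proof.
rewrite cl_scalarMrev !cl_sqnormE mulr_sumr -big_split; apply: eq_bigr => A _ /=.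
by rewrite cl_addE cl_subE sqrrB sqrrD; lra.
Qed.

Lemma cl_form_polar (C M N : Cl) : cl_rev C = C ->
  cl_form C (M + N) = 4 * cl_scalar (M * C * cl_rev N) + cl_form C (M - N).
Proof.
move=> rC; rewrite /cl_form cl_revB cl_revD !mulrDl !mulrDr !mulNr !mulrN !opprK !cl_scalarD.
have cN X : cl_scalar (- X) = - cl_scalar X :> R by rewrite /cl_scalar cl_oppE.
rewrite !cN (_ : cl_scalar (N * C * cl_rev M) = cl_scalar (M * C * cl_rev N)); last first.
  by rewrite -cl_scalar_rev !cl_revM cl_revK rC mulrA.
move: (cl_scalar (M * C * cl_rev M)) (cl_scalar (N * C * cl_rev N)).
by move: (cl_scalar (M * C * cl_rev N)) => a b c; lra.
Qed.

Lemma integrable_sqnorm d (T : measurableType d) (mu : {measure set T -> \bar R}) (X : T -> Cl) :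
  cl_L2 mu X -> mu.-integrable setT (EFin \o (fun t => cl_sqnorm (X t))).
Proof.
move=> [mX Xo]; apply: ge0_integrableP; [exact: measurable_cl_sqnorm|by move=> t; exact: cl_sqnorm_ge0|exact: Xo].
Qed.

Variables (psi psihat : Rn -> Cl) (C : Cl) (s0 : R).
Hypotheses (s1 : s0 ^+ 2 = 1) (fa : fourier_approx s0 psi psihat).
Hypothesis pC : {ae leb, forall w, admissible_at theta psihat C w}.

(** Each [p~ p] is its own reverse. This makes the bilinear form with weight [C] symmetric, as real
    polarization requires. *)
Lemma admissible_rev : cl_rev C = C.
Proof.
have [w [pi pCw]] := leb_ae_exists pC.
rewrite -pCw -(cl_integral_rev pi); congr (cl_integral _ _); apply/funext => s.
by rewrite /admissibility_integrand cl_revZ cl_revM cl_revK.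
Qed.

Lemma wavelet_scalar_inner f g : cl_L2 leb f -> cl_L2 leb g ->
  \int[sm]_z cl_scalar (wavelet_transform psi f z * cl_rev (wavelet_transform psi g z)) =
  \int[leb]_x cl_scalar (f x * C * cl_rev (g x)).
Proof.
move=> fL gL.
have TfL := wavelet_L2 n_mod4 s1 fa pC fL; have TgL := wavelet_L2 n_mod4 s1 fa pC gL.
have dL := cl_L2B fL gL.
have fCL : cl_L2 leb (fun x => f x * C).
  by have := cl_L2_mul 1 C fL; congr (cl_L2 _ _); apply/funext => x; rewrite mul1r.
have E1 := integral_polar (cl_integrableM_L2 TfL (cl_L2_rev TgL) finset.set0)
  (integrable_sqnorm (cl_L2B TfL TgL)) (fun z => cl_sqnorm_polar _ _).
have i2 : leb.-integrable setT (EFin \o (fun x => cl_form C (f x - g x))).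
  apply: ge0_integrableP.
  - exact: cl_measurable_form dL.1.
  - by move=> x; exact: (admissible_form_ge0 fa pC).
  - exact: (integral_form_lty fa pC dL).
have E2 := integral_polar (cl_integrableM_L2 fCL (cl_L2_rev gL) finset.set0)
  i2 (fun x => cl_form_polar _ _ admissible_rev).
have E3 := wavelet_energy_L2 n_mod4 s1 fa pC (cl_L2D fL gL).
have E4 := wavelet_energy_L2 n_mod4 s1 fa pC dL.
have E5 := etrans (esym (wavelet_normL2D n_mod4 s1 fa pC fL gL)) E3.
have E6 := etrans (esym (wavelet_normL2B n_mod4 s1 fa pC fL gL)) E4.
have E7 := etrans (etrans (esym E1) E5) E2.
have [q qE] : exists q : R, (\int[leb]_x (cl_form C (f x - g x))%:E = q%:E)%E.
  exists (\int[leb]_x (cl_form C (f x - g x))); exact: (esym (EFin_Rintegral i2)).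
have E8 := etrans E6 qE.
have canc (a b : R) (x y : \bar R) : ((4 * a)%:E + x = (4 * b)%:E + y)%E -> x = q%:E -> y = q%:E -> a = b.
  by move=> h xq yq; move: h; rewrite xq yq -!EFinD => -[]; lra.
exact: canc _ _ _ _ E7 E8 qE.
Qed.

(** The coefficient at [A] is a scalar part after left multiplication by [e], and [e] can be
    absorbed into [f] because the transform is left linear for Clifford constants. So the scalar
    identity is applied to [e f]. *)
Lemma wavelet_inner f g : cl_L2 leb f -> cl_L2 leb g ->
  cl_inner sm (wavelet_transform psi f) (wavelet_transform psi g) =
  cl_inner leb (fun x => f x * C) g.
Proof.
move=> fL gL; have [psiL _ _] := fa; apply/ffunP => A; rewrite !ffunE.
have TfL := wavelet_L2 n_mod4 s1 fa pC fL; have TgL := wavelet_L2 n_mod4 s1 fa pC gL.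
set e := cl_rev (cl_blade R A).
have eL : cl_L2 leb (fun x => e * f x).
  by have := cl_L2_mul e 1 fL; congr (cl_L2 _ _); apply/funext => x; rewrite mulr1.
have TeL := wavelet_L2 n_mod4 s1 fa pC eL.
have E := wavelet_scalar_inner eL gL.
apply: (etrans (y := \int[leb]_x cl_scalar (e * f x * C * cl_rev (g x)))); last first.
  by apply: eq_Rintegral => x _; rewrite (cl_coef_scalar (f x * C * cl_rev (g x)) A) -/e !mulrA.
apply: etrans E; rewrite /Rintegral; congr fine; apply: ae_eq_integral.
- exact: measurableT.
- exact: measurable_int (cl_integrableM_L2 TfL (cl_L2_rev TgL) A).
- exact: measurable_int (cl_integrableM_L2 TeL (cl_L2_rev TgL) finset.set0).
apply: ae_imply (similitude_ae_pos theta) _ => z z0 _; congr EFin.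
rewrite (wavelet_transformMl e psiL z0 fL) -mulrA.
exact: cl_coef_scalar.
Qed.

End polarization.

Theorem mainTheorem3 (R : realType) (n : nat)
    (n_mod4 : (n %% 4 = 2)%N \/ (n %% 4 = 3)%N)
    (theta : probability (SO R n) R) (haar : is_haar theta)
    (psi : 'cV[R]_n -> clifford R n) (C : clifford R n)
    (adm : admissible theta psi C)
    (f g : 'cV[R]_n -> clifford R n)
    (fL2 : cl_L2 (lebesgue_cV R n) f) (gL2 : cl_L2 (lebesgue_cV R n) g) :
  [/\ cl_L2 (similitude_measure theta) (wavelet_transform psi f),
      cl_L2 (similitude_measure theta) (wavelet_transform psi g) &
      cl_inner (similitude_measure theta)
        (wavelet_transform psi f) (wavelet_transform psi g)
      = cl_inner (lebesgue_cV R n) (fun x => f x * C) g].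
Proof.
have [psiL [psihat ft pC] _ graded] := adm.
have nodd : odd n = odd (n %% 4) by rewrite {1}(divn_eq n 4) oddD oddM andbF.
(* The sign is -1 only when [n] is 2 modulo 4 and the wavelet has odd values; in the other cases
   [i_n] commutes with the values of [psi]. *)
have [s0 s1 ps] : exists2 s0 : R, s0 ^+ 2 = 1 &
    {ae lebesgue_cV R n, forall x, i_commutes s0 (psi x)}.
  case: n_mod4 => n4; last first.
    exists 1; first exact: expr1n.
    by apply: nearW => x; apply: i_commutes_odd_dim; rewrite nodd n4.
  have en : ~~ odd n by rewrite nodd n4.
  have n0 : (0 < n)%N by move: n4; rewrite lt0n; case: eqP => // ->.
  case: (graded n4) => h.
    exists 1; first exact: expr1n.
    by apply: filterS h => x; exact: i_commutes_even.
  exists (-1); first by rewrite sqrrN expr1n.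
  by apply: filterS h => x; exact: i_commutes_odd.
have fa := fourier_approx_of n_mod4 s1 psiL ft ps.
split.
- exact: (wavelet_L2 n_mod4 s1 fa pC fL2).
- exact: (wavelet_L2 n_mod4 s1 fa pC gL2).
- exact: (wavelet_inner n_mod4 s1 fa pC fL2 gL2).
Qed.
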